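(* Consider the single-class processor-sharing system with arrival rates $\alpha(n)$, service rates $\beta(n)$ and workload distribution $\mu$ (with mean $1$), and the associated Markov process $(X(t))_{t\ge0}$ on $S$, as described in the context. Suppose that the probability distribution $\pi$ on $\mathbb{Z}_+$ is the solution of the balance equations $$\pi(n+1)\beta(n+1)=\pi(n)\alpha(n),\qquad n\ge 0,$$ and that $$\sum_{n\ge0}\pi(n)\alpha(n)<\infty.$$ Then the distribution $\bar\mu_\pi=\sum_{n\in\mathbb{Z}_+}\pi(n)\bar\mu_n$ on $S$ is stationary for the process $(X(t))_{t\ge0}$, and in particular the distribution $\pi$ is stationary for the associated number of individuals in the system.
   Context: Notation: $\mathbb{R}_+=[0,\infty)$, $\mathbb{Z}_+=\{0,1,2,\dots\}$. The system. Individuals arrive at an open system as a Poisson process with state-dependent rate $\alpha(n)\ge0$, where $n$ is the number of individuals currently in the system. Arriving individuals bring workloads which are independent of each other and of the arrivals process, with common distribution $\mu$ on $\mathbb{R}_+$ having mean $m(\mu)=1$. (No continuity of $\mu$ is assumed; atoms, including at $0$, are allowed.) While there are $n$ individuals in the system their total workload is reduced at rate $\beta(n)\ge0$, where $\beta(n)>0$ if and only if $n>0$. The discipline is processor-sharing: when there are $n>0$ individuals in the system, the workload of each is simultaneously reduced at rate $\beta(n)/n$. An individual departs the system when its workload is reduced to zero. State space and process. For $n\ge1$, $S_n$ is the quotient of $\mathbb{R}_+^n$ obtained by identifying points which are obtained from each other by permutation of coordinates, with projection $\theta:\mathbb{R}_+^n\to S_n$ and the $\sigma$-algebra $\mathcal{B}(S_n)$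 induced by the Borel $\sigma$-algebra on $\mathbb{R}_+^n$; $S_0$ is a single point. $S=\bigcup_{n\ge0}S_n$ (disjoint union), with $\sigma$-algebra $\mathcal{B}(S)$ consisting of countable unions of sets in the $\mathcal{B}(S_n)$. $(X(t))_{t\ge0}$ is the (piecewise-deterministic) Markov process on $S$ whose state at time $t$ is the number $n$ of individuals then in the system together with the unordered collection of their residual workloads at that time (a point of $S_n$). Residual workload distributions. If $\mu$ has distribution function $F$, then $\bar\mu$ is the probability distribution on $\mathbb{R}_+$ with distribution function $G(x)=1-\int_x^\infty(1-F(y))\,dy$, $x\ge0$ (the stationary residual life distribution of the renewal process with inter-event distribution $\mu$). For $n\ge1$, $\bar\mu_n$ is the probability distribution on $S_n$ given by $\bar\mu_n(A)=\bar\mu^{n}(\theta^{-1}(A))$, $A\in\mathcal{B}(S_n)$, where $\bar\mu^{n}$ is the product of $n$ copies of $\bar\mu$; $\bar\mu_0$ is the unit mass on the single point of $S_0$. Each $\bar\mu_n$ is also regarded as a distribution on $S$ assigning total mass one to $S_n$. For any probability distribution $\pi$ on $\mathbb{Z}_+$, $\bar\mu_\pi=\sum_{n\in\mathbb{Z}_+}\pi(n)\bar\mu_n$. A distribution $\nu$ on $S$ is stationary for $(X(t))_{t\ge0}$ if, when $X(0)$ has distribution $\nu$, $X(t)$ has distribution $\nu$ for all $t\ge0$. *)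

(* Defs.v *)
From HB Require Import structures.
From mathcomp Require Import all_boot all_order all_algebra.
From mathcomp Require Import finmap multiset.
From mathcomp Require Import all_classical all_reals all_analysis.

Set Implicit Arguments.
Unset Strict Implicit.
Unset Printing Implicit Defensive.

Import Order.TTheory GRing.Theory Num.Theory.
Import numFieldNormedType.Exports.

Local Open Scope classical_set_scope.
Local Open Scope ring_scope.

(* A state of the system: the unordered collection of the residual workloads,
   as a finite multiset of reals; its size is the number of individuals.
   S_n is the set of the multisets of size n all of whose elements are
   nonnegative. As usual for measures on R, nonnegativity is not built into the
   type: it is carried by the distributions and, in [driving], by the random
   variables. *)
Definition config (R : realType) : Type := multiset R.
Identity Coercion multiset_of_config : config >-> multiset.

HB.instance Definition _ (R : realType) := Choice.on (config R).
HB.instance Definition _ (R : realType) :=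
  isPointed.Build (config R) (@mset0 R).

Section config_measurable.
Variable R : realType.

Definition theta n (s : n.-tuple R) : config R := seq_mset s.

(* A is measurable iff its trace on each S_n belongs to the sigma-algebra
   induced by the product sigma-algebra through the projection theta. *)
Definition measurable_config (A : set (config R)) : Prop :=
  forall n, measurable (@theta n @^-1` A).

Let measurable_config0 : measurable_config set0.
Proof. by move=> n; rewrite preimage_set0. Qed.

Let measurable_configC A : measurable_config A -> measurable_config (~` A).
Proof. by move=> mA n; rewrite preimage_setC; apply: measurableC; exact: mA. Qed.

Let measurable_config_bigcup (F : (set (config R))^nat) :
  (forall i, measurable_config (F i)) -> measurable_config (\bigcup_i F i).
Proof.
by move=> mF n; rewrite preimage_bigcup; apply: bigcupT_measurable => i; exact: mF.
Qed.

HB.instance Definition _ := isMeasurable.Build default_measure_display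
  (config R) measurable_config0 measurable_configC measurable_config_bigcup.

Lemma measurable_theta n : measurable_fun setT (@theta n).
Proof. by move=> _ A mA; rewrite setTI; exact: mA. Qed.

HB.instance Definition _ n :=
  isMeasurableFun.Build _ _ _ _ (@theta n) (@measurable_theta n).

Definition tuple_cons n (p : R * n.-tuple R) : n.+1.-tuple R :=
  [tuple of p.1 :: p.2].

Lemma measurable_tuple_cons n : measurable_fun setT (@tuple_cons n).
Proof. exact: measurable_cons. Qed.

HB.instance Definition _ n :=
  isMeasurableFun.Build _ _ _ _ (@tuple_cons n) (@measurable_tuple_cons n).

End config_measurable.

Section residual.
Variable R : realType.
Local Open Scope ereal_scope.

(* mubar is the stationary residual life distribution of mu, whose distribution
   function is G(x) = 1 - \int_x^oo (1 - F(y)) dy for x >= 0. *)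
Definition is_residual_law (mu mubar : probability R R) : Prop :=
  mubar `]-oo, 0%R[%classic = 0 /\
  forall x : R, (0 <= x)%R ->
    mubar `]-oo, x]%classic =
      1 - \int[lebesgue_measure]_(y in `[x, +oo[) (1 - mu `]-oo, y]%classic).

Fixpoint power_prob (m : probability R R) n : probability (n.-tuple R) R :=
  match n with
  | 0 => \d_([tuple] : 0.-tuple R)
  | n'.+1 => distribution (m \x power_prob m n') (@tuple_cons R n')
  end.

Definition config_law (m : probability R R) n : probability (config R) R :=
  distribution (power_prob m n) (@theta R n).

Definition mixture_law (m : probability R R) (pi : probability nat R)
    (A : set (config R)) : \bar R :=
  \sum_(0 <= n <oo) pi [set n] * config_law m n A.

End residual.

Section mixture_probability.
Variables (R : realType) (m : probability R R) (pi : probability nat R).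
Local Open Scope ereal_scope.

Let mixture0 : mixture_law m pi set0 = 0.
Proof.
by rewrite /mixture_law eseries0// => n _ _; rewrite measure0 mule0.
Qed.

Let mixture_ge0 A : 0 <= mixture_law m pi A.
Proof. by apply: nneseries_ge0 => n _ _; exact: mule_ge0. Qed.

Let mixture_sigma_additive : semi_sigma_additive (mixture_law m pi).
Proof.
pose c n : {nonneg R} := NngNum (fine_ge0 (measure_ge0 pi [set n])).
have -> : mixture_law m pi = mseries (fun n => mscale (c n) (config_law m n)) 0.
  apply/funext => A; rewrite /mixture_law /mseries.
  apply: eq_eseriesr => n _; rewrite -[RHS]/((c n)%:num%:E * _) /c /= fineK//.
  exact: fin_num_measure.
exact: measure_semi_sigma_additive.
Qed.

HB.instance Definition _ := isMeasure.Build _ _ _ (mixture_law m pi)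
  mixture0 mixture_ge0 mixture_sigma_additive.

Let mixtureT : mixture_law m pi setT = 1.
Proof.
rewrite /mixture_law -(probability_setT pi).
rewrite (_ : [set: nat] = \bigcup_n [set n]); last first.
  by apply/seteqP; split => // n _; exists n.
rewrite measure_bigcup//; last first.
  by apply/trivIsetP => i j _ _ /eqP ij; apply/seteqP; split => // x [-> /ij].
transitivity (\sum_(0 <= n <oo) pi [set n]).
  apply: eq_eseriesr => n _; rewrite -[RHS]mule1; congr (_ * _).
  exact: probability_setT.
by apply: eq_eseriesl => n; rewrite in_setT.
Qed.

HB.instance Definition _ :=
  Measure_isProbability.Build _ _ _ (mixture_law m pi) mixtureT.

End mixture_probability.

(* The process is the piecewise-deterministic process driven by a sequence xi of
   unit exponential variables and a sequence W of workloads. Between two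
   consecutive events (arrivals or departures) the number n of individuals is
   constant, each residual workload decreases at rate beta n / n, and the
   arrival clock, of rate alpha n, rings after xi_k / alpha n. A departure is
   also an event, after which a fresh xi_(k+1) is used: by lack of memory this
   is the Poisson process of arrivals with state-dependent rate alpha. *)
Section dynamics.
Variables (R : realType) (alpha beta : nat -> R).
Implicit Types (x : config R) (e w s t : R).

Definition speed x : R := beta (size x) / (size x)%:R.

Definition serve s x : config R :=
  seq_mset [seq v <- [seq w - speed x * s | w <- x] | 0 < v].

Definition next_departure x : \bar R :=
  \big[mine/+oo%E]_(w <- x) (w / speed x)%:E.

Definition next_arrival e x : \bar R :=
  if alpha (size x) == 0 then +oo%E else (e / alpha (size x))%:E.

Definition holding e x : \bar R := mine (next_departure x) (next_arrival e x).

(* An arriving workload 0 is added to the state and departs at the next event,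
   which occurs immediately. *)
Definition jump e w x : config R :=
  let y := serve (fine (holding e x)) x in
  if (next_departure x <= next_arrival e x)%E then y else (w +` y)%mset.

(* Time of the k-th event and state just after it; the value of the state is
   irrelevant when the time is +oo. *)
Fixpoint event (x0 : config R) (xi W : nat -> R) (k : nat) :
    \bar R * config R :=
  match k with
  | 0 => (0%E, x0)
  | k'.+1 => let: (T, x) := event x0 xi W k' in
             ((T + holding (xi k') x)%E, jump (xi k') (W k') x)
  end.

(* The state at time t; None once infinitely many events have occurred, so
   that a law on [config R] for this variable entails almost sure
   non-explosion before t. *)
Definition trajectory (x0 : config R) (xi W : nat -> R) (t : R) :
    option (config R) :=
  let ev := event x0 xi W in
  match pselect (exists k, ((ev k).1 <= t%:E < (ev k.+1).1)%E) with
  | left h => let k := ex_minn h in Some (serve (t - fine (ev k).1) (ev k).2)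
  | right _ => None
  end.

End dynamics.

Section process.
Variables (R : realType) (alpha beta : nat -> R) (mu : probability R R).
Local Open Scope ereal_scope.

(* X0 has law nu, the xi_k are exponential with mean 1, the W_k have law mu, and
   all these variables are mutually independent; taking some of the sets below
   to be the full space gives the marginal laws. *)
Record driving d (Om : measurableType d) (P : probability Om R)
    (nu : probability (config R) R)
    (X0 : {RV P >-> config R}) (xi W : nat -> {RV P >-> R}) : Prop := {
  driving_X0_ge0 : forall om (w : R), w \in (X0 om : multiset R) -> (0 <= w)%R ;
  driving_xi_ge0 : forall k om, (0 <= xi k om)%R ;
  driving_W_ge0 : forall k om, (0 <= W k om)%R ;
  driving_law : forall (k : nat) (A : set (config R)) (B C : nat -> set R),
    measurable A -> (forall i, measurable (B i)) ->
    (forall i, measurable (C i)) ->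
    P (X0 @^-1` A `&`
       \bigcap_(i < k) (xi i @^-1` B i `&` W i @^-1` C i)) =
    nu A * \prod_(i < k) (exponential_prob 1%R (B i) * mu (C i)) }.

Definition process d (Om : measurableType d) (P : probability Om R)
    (X0 : {RV P >-> config R}) (xi W : nat -> {RV P >-> R}) (t : R) (om : Om) :
    option (config R) :=
  trajectory alpha beta (X0 om) (xi ^~ om) (W ^~ om) t.

Definition number d (Om : measurableType d) (P : probability Om R)
    (X0 : {RV P >-> config R}) (xi W : nat -> {RV P >-> R}) (t : R) (om : Om) :
    option nat :=
  omap (fun x : config R => size x) (process X0 xi W t om).

Definition has_law d (Om : measurableType d) (P : probability Om R)
    d' (T : measurableType d') (Y : Om -> option T) (nu : probability T R) :
    Prop :=
  forall A : set T, measurable A ->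
    measurable (Y @^-1` (Some @` A)) /\ P (Y @^-1` (Some @` A)) = nu A.

Definition stationary (nu : probability (config R) R) : Prop :=
  forall d (Om : measurableType d) (P : probability Om R)
    (X0 : {RV P >-> config R}) (xi W : nat -> {RV P >-> R}),
  driving nu X0 xi W ->
  forall t : R, (0 <= t)%R -> has_law P (process X0 xi W t) nu.

(* The number of individuals is not itself a Markov process: stationarity of pi
   means that it has law pi at all times when the state is started from nu. *)
Definition number_stationary (nu : probability (config R) R)
    (pi : probability nat R) : Prop :=
  forall d (Om : measurableType d) (P : probability Om R)
    (X0 : {RV P >-> config R}) (xi W : nat -> {RV P >-> R}),
  driving nu X0 xi W ->
  forall t : R, (0 <= t)%R -> has_law P (number X0 xi W t) pi.

End process.

(* Main.v *)
Require Import Defs.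
From HB Require Import structures.
From mathcomp Require Import all_boot all_order all_algebra.
From mathcomp Require Import finmap multiset.
From mathcomp Require Import all_classical all_reals all_analysis.
From mathcomp Require Import measurable_realfun.
From mathcomp Require Import ring lra.

(** Write nu for the mixture of the laws of n independent residual lives. The
    statement asks for the law of the process at time t when it is nu at time 0.

    Why nu is invariant. While each individual receives a service r, those
    whose residual life is at most r leave, and the others have residual lives
    w - r. By the renewal identity for mubar (residual_shift), what is missing
    from mubar after this shift is the law of w - s where w has law mu, s ranges
    over [0, r[ with Lebesgue measure, and w > s: these are the residual workloads of individuals that
    arrive at the unit rate meanwhile. So n independent residual lives remain
    so, provided that the individuals that leave are replaced by newcomers at
    the same rate. With n + 1 individuals each is served at rate
    beta (n + 1) / (n + 1), hence a flow of departures
    pi (n + 1) beta (n + 1) from n + 1 to n, and a flow of arrivals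
    pi n alpha n from n to n + 1: they agree by the balance equations
    (flux_balance).

    How this becomes a proof. It is enough to show that the process is in A at
    time t with probability at least nu A, for every measurable A: applied to
    the complement of A, this bound gives the converse inequality, and for the
    whole space it says that explosion before t has probability 0. Such a lower
    bound is obtained by following a few favourable scenarios. Let reach k t x
    be the probability that from x the state at time t is in A and that fewer
    than k events occur; it is defined by recursion on the first event. A short
    step of length h, during which nothing happens or one individual arrives or
    one leaves, yields (one_step)

      \int[nu] reach k (t - h) <= \int[nu] reach (k + 2) t + h * eps h,

    where two events are allowed because an individual that arrives with
    workload 0 leaves at once. The contribution of n individuals to eps h is
    at most 2 pi n alpha n and tends to 0 with h; since pi n alpha n is
    summable, eps h tends to 0 (error_sum_small), and it depends neither on k
    nor on t. Dividing [0, t] into equal steps gives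
    nu A <= \int[nu] reach k t + d for every d > 0 and some k
    (mixture_le_reach). On the probability space of the process, the state at an
    event is independent of the later driving variables (event_at_markov), and
    telescoping over the events bounds \int[nu] reach k t by the probability
    that the process is in A at time t (mean_reach_le_process). *)

Set Implicit Arguments.
Unset Strict Implicit.
Unset Printing Implicit Defensive.

Import Order.TTheory GRing.Theory Num.Theory.
Import numFieldNormedType.Exports.

Local Open Scope classical_set_scope.
Local Open Scope ring_scope.


(** * Measurability on the space of configurations *)

Lemma measurable_comp2 d d1 d2 d3 (T : measurableType d) (T1 : measurableType d1)
    (T2 : measurableType d2) (T3 : measurableType d3) (F : T1 * T2 -> T3)
    (f : T -> T1) (g : T -> T2) :
  measurable_fun setT F -> measurable_fun setT f -> measurable_fun setT g ->
  measurable_fun setT (fun t => F (f t, g t)).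
Proof.
by move=> mF mf mg; apply: (measurableT_comp mF); exact: measurable_fun_pair.
Qed.

Section configurations.
Variable R : realType.
Implicit Types (x y : config R) (s : seq R) (r w : R).

Definition add_mset w x : config R := (w +` x)%mset.

Lemma seq_mset_cons w s : seq_mset (w :: s) = add_mset w (seq_mset s).
Proof. by apply/msetP => a; rewrite mset1DE !mset_seqE /= eq_sym. Qed.

Lemma seq_mset_nil : seq_mset [::] = mset0 :> config R.
Proof. by apply/msetP => a; rewrite mset_seqE mset0E. Qed.

Lemma config_ind (P : config R -> Prop) : P mset0 ->
  (forall w x, P x -> P (add_mset w x)) -> forall x, P x.
Proof.
move=> P0 PS x; rewrite -(seq_mset_id x); elim: (x : seq R) => [|w s ih].
  by rewrite seq_mset_nil.
by rewrite seq_mset_cons; exact: PS.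
Qed.

Lemma add_msetCA w w' x : add_mset w (add_mset w' x) = add_mset w' (add_mset w x).
Proof. exact: msetDCA. Qed.

Lemma perm_add_mset w x : perm_eq (add_mset w x) (w :: x).
Proof.
rewrite -[in add_mset w x](seq_mset_id x) -seq_mset_cons.
exact: perm_eq_seq_mset.
Qed.

Lemma size_add_mset w x : size (add_mset w x) = (size x).+1.
Proof. by rewrite (perm_size (perm_add_mset w x)). Qed.

Lemma size_theta n (s : n.-tuple R) : size (theta s) = n.
Proof. by rewrite (perm_size (perm_eq_seq_mset s)) size_tuple. Qed.

Lemma theta0 (s : 0.-tuple R) : theta s = mset0.
Proof. by rewrite tuple0 /theta /= seq_mset_nil. Qed.

Lemma theta_cons n w (s : n.-tuple R) :
  theta [tuple of w :: s] = add_mset w (theta s).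
Proof. exact: seq_mset_cons. Qed.

Lemma theta_eta n (s : n.+1.-tuple R) :
  theta s = add_mset (thead s) (theta [tuple of behead s]).
Proof. by rewrite -theta_cons -tuple_eta. Qed.

End configurations.

Section measurable_sections.
Variable R : realType.

(** A measurable section of theta over the configurations of size n. The
    sigma-algebra on configurations is given by preimages under theta, so
    functions of a configuration and of another variable are reached through
    such a section. *)
Definition order_statistics n (x : config R) : n.-tuple R :=
  insubd (nseq_tuple n 0) (sort <=%O x).

Lemma theta_order_statistics n (x : config R) :
  size x = n -> theta (order_statistics n x) = x.
Proof.
move=> xn; rewrite /theta /order_statistics val_insubd size_sort xn eqxx.
rewrite -[RHS]seq_mset_id; apply/eq_seq_msetP.
by rewrite perm_sort.
Qed.

(** Reduces the measurability of an order statistic to that of a sum of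
    indicators. *)
Lemma lt_nth_sort (s : seq R) i c : (i < size s)%N ->
  (nth 0 (sort <=%O s) i < c) = (i < count (< c) s)%N.
Proof.
move=> is_; rewrite -(count_sort <=%O).
have /= := sort_sorted (@le_total _ R) s.
have : (i < size (sort <=%O s))%N by rewrite size_sort.
elim: (sort _ _) i {is_} => //= a u ih i iu au.
have [/allP au' su] : all (>= a) u /\ sorted <=%O u.
  by move: au; rewrite (path_sortedE le_trans) => /andP[].
have count0 : ~~ (a < c) -> count (< c) u = 0%N.
  rewrite -leNgt => ca; apply/eqP.
  rewrite -leqn0 leqNgt -has_count; apply/hasPn => b /au' ab.
  by rewrite -leNgt (le_trans ca).
case: i iu => [|i] iu /=.
  by case: ltP => // ca; rewrite count0// -leNgt.
rewrite ih//; case: ltP => [ac|ca]; first by rewrite add1n ltnS.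
by rewrite count0 -?leNgt// !ltn0.
Qed.

Lemma measurable_count n c :
  measurable_fun setT (fun s : n.-tuple R => (count (< c) s)%:R : R).
Proof.
rewrite (_ : (fun _ => _) =
   fun s : n.-tuple R => \sum_(i < n) \1_(`]-oo, c[%classic : set R) (tnth s i)).
  apply: measurable_sum => i; apply: measurableT_comp => //.
  exact: measurable_tnth.
apply/funext => s; rewrite -sum1_count natr_sum big_tuple big_mkcond/=.
apply: eq_bigr => i _; rewrite indicE mem_setE in_itv/=.
by case: ifP.
Qed.

Lemma measurable_fun_config d (U : measurableType d) (f : config R -> U) :
  (forall n, measurable_fun setT (f \o @theta R n)) -> measurable_fun setT f.
Proof.
move=> mf _ B mB; rewrite setTI.
have mB' n : measurable (@theta R n @^-1` (f @^-1` B)).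
  by rewrite -comp_preimage -[X in measurable X]setTI; exact: mf.
exact: mB'.
Qed.

Lemma measurable_order_statistics n :
  measurable_fun setT (@order_statistics n).
Proof.
apply/measurable_fun_tnthP => i; apply: measurable_fun_config => m.
have [mn|mn] := eqVneq m n; last first.
  rewrite (_ : _ \o _ = cst 0); first exact: measurable_cst.
  apply/funext => s /=; rewrite /order_statistics /insubd insubN/=; last first.
    by rewrite size_sort size_theta.
  by rewrite (tnth_nth 0) nth_nseq ltn_ord.
subst m.
rewrite (_ : _ \o _ = fun s : n.-tuple R => nth 0 (sort <=%O s) i); last first.
  apply/funext => s /=; rewrite (tnth_nth 0) /order_statistics val_insubd.
  rewrite size_sort size_theta eqxx; congr (nth 0 _ i).
  apply/perm_sortP; [exact: le_total|exact: le_trans|exact: le_anti|].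
  exact: perm_eq_seq_mset.
apply: (measurability _ (RGenInftyO.measurableE R)) => //.
move=> _ [_ [c ->] <-]; rewrite setTI.
rewrite (_ : _ @^-1` _ = [set s : n.-tuple R | (count (< c) s)%:R \in `]i%:R : R, +oo[]).
  rewrite -[X in measurable X]setTI.
  exact: (@measurable_count n c measurableT _ (measurable_itv _)).
apply/seteqP; split => s /=; rewrite !in_itv/= lt_nth_sort ?size_tuple// andbT ltr_nat//.
Qed.

Lemma measurable_size_config :
  measurable_fun setT (fun x : config R => size x).
Proof.
apply: measurable_fun_config => n; rewrite (_ : _ \o _ = cst n) //.
by apply/funext => s /=; rewrite size_theta.
Qed.

(** On the configurations of size n, F is the given function of the order
    statistics; the size being measurable, these pieces can be glued. *)
Lemma measurable_fun_config_prod d d' (T : measurableType d)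
    (U : measurableType d') (F : config R * T -> U) :
  (forall n, measurable_fun setT (fun p : n.-tuple R * T => F (theta p.1, p.2))) ->
  measurable_fun setT F.
Proof.
move=> mF _ B mB; rewrite setTI.
have -> : F @^-1` B = \bigcup_n ([set p : config R * T | size p.1 = n] `&`
    ((fun p => (order_statistics n p.1, p.2)) @^-1`
      ((fun p : n.-tuple R * T => F (theta p.1, p.2)) @^-1` B))).
  apply/seteqP; split => [[x t] Bx|[x t] [n _ /= [xn]]].
    by exists (size x) => //=; split => //; rewrite theta_order_statistics.
  by rewrite theta_order_statistics.
apply: bigcupT_measurable => n; apply: measurableI.
  have := measurableT_comp measurable_size_config (@measurable_fst _ _ (config R) T).
  by move=> /(_ measurableT [set n]); rewrite setTI; exact.
rewrite -[X in measurable X]setTI.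
have mpair : measurable_fun setT
    (fun p : config R * T => (order_statistics n p.1, p.2)).
  apply: measurable_fun_pair => //.
  exact: (measurableT_comp (@measurable_order_statistics n) measurable_fst).
apply: mpair => //; rewrite -[X in measurable X]setTI.
exact: mF.
Qed.

Lemma measurable_fun_prod_config d d' (T : measurableType d)
    (U : measurableType d') (F : T * config R -> U) :
  (forall n, measurable_fun setT (fun p : T * n.-tuple R => F (p.1, theta p.2))) ->
  measurable_fun setT F.
Proof.
move=> mF.
have -> : F = (fun p : config R * T => F (p.2, p.1)) \o (fun p => (p.2, p.1)).
  by apply/funext => -[].
apply: measurableT_comp; last exact: measurable_fun_pair.
apply: measurable_fun_config_prod => n.
exact: (measurable_comp2 (mF n) (f := snd) (g := fst)).
Qed.

Lemma measurable_add_mset :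
  measurable_fun setT (fun p : R * config R => add_mset p.1 p.2).
Proof.
apply: measurable_fun_prod_config => n /=.
rewrite (_ : (fun _ => _) = @theta R n.+1 \o @tuple_cons R n); last first.
  by apply/funext => p /=; rewrite -theta_cons.
apply: measurableT_comp; [exact: measurable_theta|exact: measurable_tuple_cons].
Qed.

Lemma measurable_fun_add_mset d (T : measurableType d) (f : T -> R) (g : T -> config R) :
  measurable_fun setT f -> measurable_fun setT g ->
  measurable_fun setT (fun t => add_mset (f t) (g t)).
Proof.
exact: (measurable_comp2 measurable_add_mset).
Qed.

(** The configuration left when each individual has received an amount r of
    service. Unlike serve, which it describes for r the product of the speed
    and of the time, it does not depend on the number of individuals and so
    is amenable to induction on the configuration. *)
Definition clip (r : R) (x : config R) : config R :=
  seq_mset [seq v <- [seq w - r | w <- x] | 0 < v].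

Lemma clip0 r : clip r mset0 = mset0.
Proof. by rewrite /clip enum_mset0 /= seq_mset_nil. Qed.

Lemma clip_add_mset r w x : clip r (add_mset w x) =
  if 0 < w - r then add_mset (w - r) (clip r x) else clip r x.
Proof.
have -> : clip r (add_mset w x) =
    seq_mset [seq v <- [seq u - r | u <- w :: x] | 0 < v].
  apply/eq_seq_msetP; apply: perm_filter; apply: perm_map.
  exact: perm_add_mset.
by rewrite /clip/=; case: ifP => // _; rewrite seq_mset_cons.
Qed.

Lemma measurable_clip :
  measurable_fun setT (fun p : R * config R => clip p.1 p.2).
Proof.
apply: measurable_fun_prod_config => n /=; elim: n => [|n ih].
  rewrite (_ : (fun _ => _) = cst mset0) //.
  by apply/funext => p /=; rewrite theta0 clip0.
pose tl (p : R * n.+1.-tuple R) := (p.1, [tuple of behead p.2] : n.-tuple R).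
have mtl : measurable_fun setT tl.
  apply: measurable_fun_pair => //.
  exact: (measurableT_comp (@measurable_behead _ R n) measurable_snd).
have mhd : measurable_fun setT (fun p : R * n.+1.-tuple R => thead p.2 - p.1).
  apply: measurable_funB => //.
  exact: (measurableT_comp (measurable_tnth _) measurable_snd).
rewrite (_ : (fun _ => _) = fun p : R * n.+1.-tuple R =>
   if 0 < thead p.2 - p.1 then
     add_mset (thead p.2 - p.1) (clip (tl p).1 (theta (tl p).2))
   else clip (tl p).1 (theta (tl p).2)).
  apply: measurable_fun_ifT.
  - by apply: measurable_fun_ltr.
  - apply: measurable_fun_add_mset => //; exact: (measurableT_comp ih mtl).
  - exact: (measurableT_comp ih mtl).
by apply/funext => p; rewrite theta_eta clip_add_mset.
Qed.

End measurable_sections.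

(** * Dynamics up to the next event *)

Section measurable_dynamics.
Variables (R : realType) (alpha beta : nat -> R).
Implicit Types (x : config R) (e w s t r : R).

Lemma serveE s x : serve beta s x = clip (speed beta x * s) x.
Proof. by []. Qed.

Lemma measurable_of_size d (U : measurableType d) (g : nat -> U) :
  measurable_fun setT (fun x : config R => g (size x)).
Proof.
by apply: (measurableT_comp (f := g)) => //; exact: measurable_size_config.
Qed.

Lemma measurable_serve d (T : measurableType d) (f : T -> R) (g : T -> config R) :
  measurable_fun setT f -> measurable_fun setT g ->
  measurable_fun setT (fun z => serve beta (f z) (g z)).
Proof.
move=> mf mg; apply: (measurable_comp2 (@measurable_clip R)) => //.
apply: measurable_funM => //.
exact: (measurableT_comp (measurable_of_size (fun n => beta n / n%:R)) mg).
Qed.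

(** The next departure when the time per unit of service is a parameter r:
    freeing it from the size of the configuration makes induction on the
    configuration possible. *)
Definition first_exit r x : \bar R := \big[mine/+oo%E]_(w <- x) (w * r)%:E.

Lemma first_exit0 r : first_exit r mset0 = +oo%E.
Proof. by rewrite /first_exit enum_mset0 big_nil. Qed.

Lemma first_exit_add_mset r w x :
  first_exit r (add_mset w x) = mine (w * r)%:E (first_exit r x).
Proof.
by rewrite /first_exit (perm_big _ (perm_add_mset w x)) big_cons.
Qed.

Lemma next_departureE x : next_departure beta x = first_exit (speed beta x)^-1 x.
Proof. by []. Qed.

Lemma measurable_first_exit :
  measurable_fun setT (fun p : R * config R => first_exit p.1 p.2).
Proof.
apply: measurable_fun_prod_config => n /=; elim: n => [|n ih].
  rewrite (_ : (fun _ => _) = cst +oo%E) //.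
  by apply/funext => p /=; rewrite theta0 first_exit0.
rewrite (_ : (fun _ => _) = fun p : R * n.+1.-tuple R =>
   mine (thead p.2 * p.1)%:E
     (first_exit p.1 (theta ([tuple of behead p.2] : n.-tuple R)))).
  apply: measurable_mine.
    apply/measurable_EFinP; apply: measurable_funM => //.
    exact: (measurableT_comp (measurable_tnth _) measurable_snd).
  apply: (measurable_comp2 ih) => //.
  exact: (measurableT_comp (@measurable_behead _ R n) measurable_snd).
by apply/funext => p; rewrite theta_eta first_exit_add_mset.
Qed.

Lemma measurable_next_departure : measurable_fun setT (next_departure beta).
Proof.
apply: (measurable_comp2 measurable_first_exit) => //.
exact: (measurable_of_size (fun n => (beta n / n%:R)^-1)).
Qed.

Lemma measurable_next_arrival :
  measurable_fun setT (fun p : R * config R => next_arrival alpha p.1 p.2).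
Proof.
apply: measurable_fun_ifT => //.
- apply: (measurableT_comp (measurable_of_size (fun n => alpha n == 0))) => //.
- apply/measurable_EFinP; apply: measurable_funM => //.
  exact: (measurableT_comp (measurable_of_size (fun n => (alpha n)^-1)) measurable_snd).
Qed.

Lemma measurable_holding d (T : measurableType d) (f : T -> R) (g : T -> config R) :
  measurable_fun setT f -> measurable_fun setT g ->
  measurable_fun setT (fun z => holding alpha beta (f z) (g z)).
Proof.
move=> mf mg; apply: measurable_mine.
  exact: (measurableT_comp measurable_next_departure mg).
exact: (measurable_comp2 measurable_next_arrival).
Qed.

Lemma measurable_jump d (T : measurableType d) (f h : T -> R) (g : T -> config R) :
  measurable_fun setT f -> measurable_fun setT h -> measurable_fun setT g ->
  measurable_fun setT (fun z => jump alpha beta (f z) (h z) (g z)).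
Proof.
move=> mf mh mg.
have ms : measurable_fun setT
    (fun z => serve beta (fine (holding alpha beta (f z) (g z))) (g z)).
  apply: measurable_serve => //.
  apply: (measurableT_comp (f := @fine R)); first exact: fine_measurable.
  exact: measurable_holding.
apply: measurable_fun_ifT => //.
  apply: measurable_fun_lee.
    exact: (measurableT_comp measurable_next_departure mg).
  exact: (measurable_comp2 measurable_next_arrival).
exact: measurable_fun_add_mset.
Qed.

End measurable_dynamics.

Section paths.
Variables (R : realType) (alpha beta : nat -> R).
Implicit Types (x : config R) (e w s t r : R).

Lemma mem_add_mset w u x : (u \in add_mset w x) = (u == w) || (u \in x).
Proof. exact: in_mset1D. Qed.

Lemma mem_clip r u x : u \in clip r x -> 0 < u.
Proof.
by rewrite (perm_mem (perm_eq_seq_mset _)) mem_filter => /andP[].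
Qed.

Lemma clip_pos x : (forall u, u \in x -> 0 < u) -> clip 0 x = x.
Proof.
elim/config_ind : x => [_|w x ih xpos]; first exact: clip0.
rewrite clip_add_mset subr0 xpos ?mem_add_mset ?eqxx// ih// => u ux.
by rewrite xpos// mem_add_mset ux orbT.
Qed.

Lemma size_clip r x : (forall u, u \in x -> r < u) -> size (clip r x) = size x.
Proof.
elim/config_ind : x => [_|w x ih xr]; first by rewrite clip0.
rewrite clip_add_mset subr_gt0 xr ?mem_add_mset ?eqxx// !size_add_mset ih// => u ux.
by rewrite xr// mem_add_mset ux orbT.
Qed.

Lemma mem_clip_lt r r' u x : (forall u, u \in x -> r + r' < u) ->
  u \in clip r x -> r' < u.
Proof.
move=> xr; rewrite (perm_mem (perm_eq_seq_mset _)) mem_filter => /andP[_].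
by move=> /mapP[v /xr rv ->]; rewrite ltrBrDl.
Qed.

Lemma clip_clip r r' x : 0 <= r' -> clip r' (clip r x) = clip (r + r') x.
Proof.
move=> r0; elim/config_ind : x => [|w x ih]; first by rewrite !clip0.
rewrite !clip_add_mset; have [wr|wr] := ltP 0 (w - r).
  by rewrite clip_add_mset opprD addrA ih.
by rewrite ifF// opprD addrA; apply/negbTE; rewrite -leNgt; lra.
Qed.

Lemma first_exit_clip r c x : 0 < r -> (forall u, u \in x -> c < u) ->
  first_exit r x = ((c * r)%:E + first_exit r (clip c x))%E.
Proof.
move=> r0; elim/config_ind : x => [_|w x ih xc].
  by rewrite clip0 first_exit0.
have wc : c < w by rewrite xc// mem_add_mset eqxx.
rewrite clip_add_mset subr_gt0 wc !first_exit_add_mset ih; last first.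
  by move=> u ux; rewrite xc// mem_add_mset ux orbT.
rewrite [in LHS](_ : w * r = c * r + (w - c) * r); last by rewrite mulrBl subrKC.
by rewrite EFinD !minEle leeD2lE//; case: ifP.
Qed.

Lemma lt_first_exit r c x : 0 < r ->
  (c%:E < first_exit r x)%E = all (fun u => c / r < u) x.
Proof.
move=> r0; elim/config_ind : x => [|w x ih].
  by rewrite first_exit0 ltry enum_mset0.
rewrite first_exit_add_mset (perm_all _ (perm_add_mset w x)) /= lt_min ih lte_fin.
by rewrite ltr_pdivrMr.
Qed.

Lemma first_exit_gtNy r x : (-oo < first_exit r x)%E.
Proof.
elim/config_ind : x => [|w x ih]; first by rewrite first_exit0.
by rewrite first_exit_add_mset lt_min ih ltNyr.
Qed.

Lemma first_exit_ge0 r x : 0 <= r -> (forall u, u \in x -> 0 <= u) ->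
  (0 <= first_exit r x)%E.
Proof.
move=> r0; elim/config_ind : x => [|w x ih x0]; first by rewrite first_exit0.
have w0 : 0 <= w by rewrite x0// mem_add_mset eqxx.
rewrite first_exit_add_mset le_min lee_fin mulr_ge0//=.
by apply: ih => u ux; rewrite x0// mem_add_mset ux orbT.
Qed.

Lemma holding_gtNy e x : (-oo < holding alpha beta e x)%E.
Proof.
rewrite lt_min next_departureE first_exit_gtNy /next_arrival.
by case: ifP => //= _; rewrite ltNyr.
Qed.

End paths.

(** * Images and restrictions of measures, and the exponential law *)

Lemma ge0_integral_mrestr d (T : measurableType d) (R : realType)
    (m : {measure set T -> \bar R}) (D : set T) (mD : measurable D) (g : T -> \bar R) :
  measurable_fun setT g -> (forall x, 0 <= g x)%E ->
  (\int[mrestr m mD]_x g x = \int[m]_(x in D) g x)%E.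
Proof.
move=> mg g0.
transitivity (\int[mrestr m mD]_(x in D) g x)%E; last first.
  apply: eq_measure_integral => A mA AD.
  by rewrite -[LHS]/(m (A `&` D)) setIidl.
rewrite -(setUv D) ge0_integral_setU//=; last 3 first.
- exact: measurableC.
- by rewrite setUv.
- exact/disj_setPCl.
rewrite [X in (_ + X)%E]null_set_integral ?adde0//.
- exact: measurableC.
- exact: measurable_funTS.
- by rewrite -[LHS]/(m (~` D `&` D)) setICl measure0.
Qed.

Section image_measures.
Context d d' (T : measurableType d) (T' : measurableType d') (R : realType).
Variable m : {measure set T -> \bar R}.
Variables (D : set T) (mD : measurable D) (mDoo : (m D < +oo)%E).
Variables (f : T -> T') (mf : measurable_fun setT f).

(** The two proofs are arguments so that the structure of finite measure can be
    attached to this constant. *)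
Definition image_restr of (m D < +oo)%E & measurable_fun setT f : set T' -> \bar R :=
  pushforward (mrestr m mD) f.

Local Notation mu := (image_restr mDoo mf).

Let mu0 : mu set0 = 0%E.
Proof. by rewrite /image_restr /pushforward preimage_set0 measure0. Qed.

Let mu_ge0 A : (0 <= mu A)%E.
Proof. by rewrite /image_restr /pushforward measure_ge0. Qed.

Let mu_sigma_additive : semi_sigma_additive mu.
Proof.
exact: (@measure_semi_sigma_additive _ _ _
  (measure_function_pushforward__canonical__measure_function_Measure
     (mrestr m mD) mf)).
Qed.

HB.instance Definition _ := isMeasure.Build _ _ _ mu mu0 mu_ge0 mu_sigma_additive.

Let mu_fin : fin_num_fun mu.
Proof.
move=> A mA; rewrite ge0_fin_numE// (le_lt_trans _ mDoo)//.
have mfA : measurable (f @^-1` A) by rewrite -[X in measurable X]setTI; exact: mf.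
by rewrite /image_restr /pushforward /mrestr le_measure ?inE//; exact: measurableI.
Qed.

HB.instance Definition _ := Measure_isFinite.Build _ _ _ mu mu_fin.

Lemma integral_image_restr (g : T' -> \bar R) :
  measurable_fun setT g -> (forall x, 0 <= g x)%E ->
  (\int[mu]_x g x = \int[m]_(x in D) g (f x))%E.
Proof.
move=> mg g0; rewrite /image_restr ge0_integral_pushforward// preimage_setT.
by rewrite ge0_integral_mrestr//=; exact: measurableT_comp.
Qed.

End image_measures.

Section affine_change_of_variable.
Variable R : realType.
Variables (c d : R).
Hypothesis c0 : c != 0.

Let aff (x : measurableTypeR R) : measurableTypeR R := c * x + d.

Let maff : measurable_fun setT aff.
Proof. by apply: measurable_funD => //; exact: measurable_funM. Qed.

Let pushed : {measure set (measurableTypeR R) -> \bar R} :=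
  measure_function_pushforward__canonical__measure_function_Measure
    (@lebesgue_measure R) maff.

Let lebesgue_image : {measure set (measurableTypeR R) -> \bar R} :=
  mscale (NngNum (normr_ge0 c)) pushed.

Let lebesgue_imageE A : measurable A -> lebesgue_measure A = lebesgue_image A.
Proof.
apply: lebesgue_measure_unique => _ [[a b] _ <-].
rewrite /lebesgue_image /= /mscale /= /pushforward.
have [c_lt0|c_gt0|c00] := ltgtP c 0; last by move: c0; rewrite c00 eqxx.
- rewrite (_ : aff @^-1` _ = [set` `[(b - d) / c, (a - d) / c[%R]); last first.
    apply/seteqP; split => x; rewrite /= /aff !in_itv/= ler_ndivrMr// ltr_ndivlMr//;
      rewrite mulrC; move=> /andP[? ?]; apply/andP; split; lra.
  rewrite !lebesgue_measure_itv/= !lte_fin ltr_nM2r ?invr_lt0// ltrD2r.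
  case: ifPn => ab; last by rewrite mule0.
  rewrite -!EFinD -EFinM; congr EFin; rewrite ltr0_norm//; field.
  exact: c0.
- rewrite (_ : aff @^-1` _ = [set` `](a - d) / c, (b - d) / c]%R]); last first.
    apply/seteqP; split => x; rewrite /= /aff !in_itv/= ler_pdivlMr// ltr_pdivrMr//;
      rewrite mulrC; move=> /andP[? ?]; apply/andP; split; lra.
  rewrite !lebesgue_measure_itv/= !lte_fin ltr_pM2r ?invr_gt0// ltrD2r.
  case: ifPn => ab; last by rewrite mule0.
  rewrite -!EFinD -EFinM; congr EFin; rewrite gtr0_norm//; field.
  exact: c0.
Qed.

(** Lebesgue measure is `|c| times its image under the affine map, because the
    two agree on bounded intervals. *)
Lemma ge0_integral_affine (f : R -> \bar R) :
  measurable_fun setT f -> (forall x, 0 <= f x)%E ->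
  (\int[lebesgue_measure]_x f x =
   `|c|%:E * \int[lebesgue_measure]_x f (c * x + d)%R)%E.
Proof.
move=> mf f0.
rewrite [LHS](eq_measure_integral lebesgue_image); last first.
  by move=> A mA _; exact: lebesgue_imageE.
rewrite ge0_integral_mscale// ge0_integral_pushforward//.
Qed.

End affine_change_of_variable.

Section exponential.
Variable R : realType.

(** A constant that carries the structure of probability measure, which for
    exponential_prob depends on a proof of positivity of the parameter. *)
Definition expo : set R -> \bar R := exponential_prob 1%R.

Let E1 : probability (measurableTypeR R) R :=
  exponential_distribution_exponential_prob__canonical__probability_measure_Probability
    (@ltr01 R).

Let expo0 : expo set0 = 0%E.
Proof. exact: (@measure0 _ _ _ E1). Qed.

Let expo_ge0 A : (0 <= expo A)%E.
Proof. exact: (@measure_ge0 _ _ _ E1). Qed.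

Let expo_sigma_additive : semi_sigma_additive expo.
Proof. exact: (@measure_semi_sigma_additive _ _ _ E1). Qed.

HB.instance Definition _ := isMeasure.Build _ _ _ expo
  expo0 expo_ge0 expo_sigma_additive.

Let expoT : expo setT = 1%E.
Proof. exact: (@probability_setT _ _ _ E1). Qed.

HB.instance Definition _ := Measure_isProbability.Build _ _ _ expo expoT.

Lemma expo_density (A : set R) : measurable A ->
  expo A = (\int[lebesgue_measure]_x (\1_A x * exponential_pdf 1 x)%:E)%E.
Proof.
move=> mA; rewrite /expo /exponential_prob integral_mkcond/=.
apply: eq_integral => x _; rewrite patchE indicE.
by case: ifPn => xA; rewrite ?mul1r ?mul0r.
Qed.

Lemma expo_lt0 : expo `]-oo, 0[%classic = 0%E.
Proof.
rewrite /expo /exponential_prob integral0_eq// => x /=.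
by rewrite in_itv/= => x0; rewrite lt0_exponential_pdf.
Qed.

Lemma expo_le0 : expo `]-oo, 0%R]%classic = 0%E.
Proof.
rewrite -[RHS]expo_lt0 /expo /exponential_prob [RHS]integral_itv_bndo_bndc//.
by apply/measurable_EFinP/measurable_funTS; exact: measurable_exponential_pdf.
Qed.

(** The density at c + x is expR (- c) times the density at x, and negative
    numbers are not charged. *)
Lemma expo_memoryless (c : R) (A : set R) : 0 <= c -> measurable A ->
  expo (A `&` `[c, +oo[) = ((expR (- c))%:E * expo ((fun e => c + e)%R @^-1` A))%E.
Proof.
move=> c0 mA.
have mcA : measurable ((fun e : R => c + e) @^-1` A).
  rewrite -[X in measurable X]setTI.
  by apply: (_ : measurable_fun setT (fun e : R => c + e)) => //; exact: measurable_funD.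
have mAc : measurable (A `&` `[c, +oo[) by exact: measurableI.
rewrite !expo_density//.
have mpdf : measurable_fun setT (exponential_pdf (1 : R)).
  exact: measurable_exponential_pdf.
have pdf0 (x : R) : 0 <= exponential_pdf 1 x by exact: exponential_pdf_ge0.
have mf : measurable_fun setT (fun x : R =>
    (\1_(A `&` `[c, +oo[) x * exponential_pdf 1 x)%:E).
  by apply/measurable_EFinP; apply: measurable_funM.
have f0 (x : R) : (0 <= (\1_(A `&` `[c, +oo[) x * exponential_pdf 1 x)%:E)%E.
  by rewrite lee_fin mulr_ge0.
have -> := ge0_integral_affine c (oner_neq0 R) mf f0.
have mg : measurable_fun setT (fun x : R =>
    (\1_((fun e => c + e)%R @^-1` A) x * exponential_pdf 1 x)%:E).
  by apply/measurable_EFinP; apply: measurable_funM.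
rewrite normr1 mul1e -ge0_integralZl//; last first.
  by move=> x _; rewrite lee_fin mulr_ge0.
apply: eq_integral => x _; rewrite mul1r -EFinM; congr EFin.
have [x0|x0] := ltP x 0.
  rewrite (lt0_exponential_pdf _ x0) !mulr0 indicE memNset ?mul0r//= => -[_].
  by rewrite in_itv/= andbT; apply/negP; rewrite -ltNge gtrDr.
rewrite !exponential_pdfE ?addr_ge0// mulrA (mulrC (expR _)) -!mulrA; congr (_ * _).
  rewrite !indicE; congr (nat_of_bool _)%:R.
  apply/idP/idP => [/set_mem[Axc _]|/set_mem Axc]; apply/mem_set.
    by rewrite /= addrC.
  split; first by move: Axc; rewrite /= addrC.
  by rewrite /= in_itv/= andbT lerDr.
by rewrite !mul1r !mulN1r opprD expRD.
Qed.

Lemma expo_ge (c : R) : 0 <= c -> expo `[c, +oo[ = (expR (- c))%:E.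
Proof.
move=> c0; rewrite -[X in expo X](setTI `[c, +oo[%classic) expo_memoryless// preimage_setT.
by rewrite expoT mule1.
Qed.

Lemma le_lebesgue_expo (c : R) (A : set R) : measurable A -> A `<=` `[0, c[ ->
  ((expR (- c))%:E * lebesgue_measure A <= expo A)%E.
Proof.
move=> mA Ac; rewrite /expo /exponential_prob.
rewrite -integral_cst//; apply: ge0_le_integral => //.
- by move=> x _; rewrite lee_fin expR_ge0.
- by apply/measurable_EFinP/measurable_funTS; exact: measurable_exponential_pdf.
- move=> x /Ac /=; rewrite in_itv/= => /andP[x0 xc].
  by rewrite lee_fin exponential_pdfE// mul1r mulN1r ler_expR lerN2 ltW.
Qed.

End exponential.

(** * The renewal identity of the residual life law *)

Section lebesgue_on_interval.
Variable R : realType.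
Local Open Scope ereal_scope.

Let I0 (r : R) : set (measurableTypeR R) := `[0%R, r[%classic.

Let mI0 r : measurable (I0 r). Proof. exact: measurable_itv. Qed.

Let lebesgue_fin r : @lebesgue_measure R (I0 r) < +oo.
Proof. by rewrite lebesgue_measure_itv/=; case: ifP; rewrite ltry. Qed.

Let mid : @measurable_fun _ _ (measurableTypeR R) R setT (fun x => x).
Proof. by move=> _ A mA; rewrite setTI. Qed.

Definition lebesgue_itv (r : R) : {finite_measure set R -> \bar R} :=
  image_restr (mI0 r) (lebesgue_fin r) mid.

Lemma lebesgue_itvE r (A : set R) :
  lebesgue_itv r A = lebesgue_measure (A `&` `[0%R, r[).
Proof. by []. Qed.

Lemma integral_lebesgue_itv r (g : R -> \bar R) :
  measurable_fun setT g -> (forall x, 0 <= g x) ->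
  \int[lebesgue_itv r]_x g x = \int[lebesgue_measure]_(x in `[0%R, r[) g x.
Proof. by move=> mg g0; rewrite /lebesgue_itv integral_image_restr. Qed.

Lemma lebesgue_itvT (r : R) : (0 <= r)%R -> lebesgue_itv r setT = r%:E.
Proof.
move=> r0; rewrite lebesgue_itvE setTI lebesgue_measure_itv/= lte_fin sube0.
by case: ltP => // r0'; congr EFin; apply/eqP; rewrite eq_le r0 r0'.
Qed.

End lebesgue_on_interval.

Section residual_identity.
Variables (R : realType) (mu mubar : probability R R).
Hypothesis mu_supp : mu `]-oo, 0[%classic = 0%E.
Hypothesis mu_mean : (\int[mu]_x x%:E = 1)%E.
Hypothesis mubar_residual : is_residual_law mu mubar.
Local Open Scope ereal_scope.

(** The identity made nonnegative, so that it is a random variable to which the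
    tail formula for the mean applies; mu does not see the difference. *)
Definition pospart (w : R) : R := Num.max w 0%R.

Lemma measurable_pospart : measurable_fun setT pospart.
Proof. exact: measurable_maxr. Qed.

HB.instance Definition _ := isMeasurableFun.Build _ _ _ _ pospart measurable_pospart.

Definition tail (x : R) : \bar R := mu `]x, +oo[%classic.

Lemma tail_ge0 x : 0 <= tail x. Proof. exact: measure_ge0. Qed.

Lemma tailE x : tail x = 1 - mu `]-oo, x]%classic.
Proof.
rewrite /tail -setCitvl probability_setC//.
Qed.

Lemma measurable_tail : measurable_fun setT tail.
Proof.
pose A := [set p : R * R | (p.1 < p.2)%R].
have mA : measurable A.
  rewrite (_ : A = (fun p : R * R => (p.1 < p.2)%R) @^-1` [set true]).
    by rewrite -[X in measurable X]setTI; exact: measurable_fun_ltr.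
  by apply/seteqP; split.
rewrite (_ : tail = mu \o xsection A); first exact: measurable_fun_xsection.
apply/funext => x /=; congr (mu _); apply/seteqP; split => w /=.
  by rewrite in_itv/= andbT => xw; apply/xsectionP.
by move/xsectionP; rewrite in_itv/= andbT.
Qed.

(** The mean of mu is the integral of its tail. *)
Lemma integral_tail : \int[lebesgue_measure]_(x in `[0%R, +oo[) tail x = 1.
Proof.
have := @ge0_expectation_ccdf _ _ _ mu [the {RV mu >-> R} of pospart].
rewrite unlock => /(_ _)/=.
have -> : \int[mu]_w (pospart w)%:E = 1.
  rewrite -mu_mean; apply: ae_eq_integral => //.
  - by apply/measurable_EFinP; exact: measurable_pospart.
  - exists (`]-oo, 0%R[%classic : set R); split => // x /= /not_implyP[_].
    rewrite in_itv/= /pospart; have [//|x0] := ltP x 0%R.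
    by [].
move=> ->; last by move=> x; rewrite /pospart le_max lexx orbT.
apply: eq_integral => x; rewrite inE/= in_itv/= andbT => x0.
rewrite /ccdf /distribution /= /pushforward; congr (mu _).
apply/seteqP; split => w /=; rewrite !in_itv/= !andbT /pospart lt_max.
  by move=> ->.
by case/orP => // xlt0; move: (lt_le_trans xlt0 x0); rewrite ltxx.
Qed.

Lemma mubar_tail (x : R) : (0 <= x)%R ->
  mubar `]x, +oo[%classic = \int[lebesgue_measure]_(y in `[x, +oo[) tail y.
Proof.
move=> x0; have [_ /(_ x x0)] := mubar_residual.
under eq_integral do rewrite -tailE.
set I := (X in 1 - X) => mubarx.
have I0 : 0 <= I by apply: integral_ge0 => y _; exact: tail_ge0.
have I1 : I <= 1.
  rewrite -integral_tail; apply: ge0_subset_integral => //.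
  - by apply: measurable_funTS; exact: measurable_tail.
  - by apply: subset_itvr; rewrite bnd_simp.
have Ifin : I \is a fin_num by rewrite ge0_fin_numE// (le_lt_trans I1)// ltry.
rewrite -setCitvl probability_setC// mubarx -[in LHS](fineK Ifin) -!EFinB.
by rewrite opprB addrC subrK fineK.
Qed.

Lemma mubar_gt0 : mubar `]0%R, +oo[%classic = 1.
Proof. by rewrite mubar_tail// integral_tail. Qed.

Lemma mubar_le0 : mubar `]-oo, 0%R]%classic = 0.
Proof. by rewrite -setCitvr probability_setC// mubar_gt0 subee. Qed.

Let D := [set p : R * R | (p.1 < p.2)%R].

Let mD : measurable D.
Proof.
rewrite (_ : D = (fun p : R * R => (p.1 < p.2)%R) @^-1` [set true]).
  by rewrite -[X in measurable X]setTI; exact: measurable_fun_ltr.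
by apply/seteqP; split.
Qed.

Let msub : measurable_fun setT (fun p : R * R => p.2 - p.1)%R.
Proof. exact: measurable_funB. Qed.

Let D_fin r : (lebesgue_itv r \x mu) D < +oo.
Proof.
rewrite (@le_lt_trans _ _ ((lebesgue_itv r \x mu) (setT `*` setT)))//.
  by rewrite le_measure ?inE// setXTT.
rewrite product_measure1E// ltey_eq fin_numM//; exact: fin_num_measure.
Qed.

(** The residual workloads w - s of individuals that arrive at the unit rate
    while a service r is given, s being the service that is given after the
    arrival; those with w <= s have left. *)
Definition shifted_out (r : R) : {finite_measure set R -> \bar R} :=
  image_restr mD (D_fin r) msub.

Lemma shifted_outE r (A : set R) : shifted_out r A =
  (lebesgue_itv r \x mu) ((fun p => p.2 - p.1)%R @^-1` A `&` D).
Proof. by []. Qed.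

Lemma integral_shifted_out r (g : R -> \bar R) :
  measurable_fun setT g -> (forall x, 0 <= g x) ->
  \int[shifted_out r]_x g x = \int[lebesgue_measure]_(s in `[0%R, r[)
    \int[mu]_w (if (s < w)%R then g (w - s)%R else 0).
Proof.
move=> mg g0.
have mF : measurable_fun setT (fun p : R * R =>
    if (p.1 < p.2)%R then g (p.2 - p.1)%R else 0).
  apply: measurable_fun_ifT => //; first exact: measurable_fun_ltr.
  exact: measurableT_comp.
have F0 (p : R * R) : 0 <= (if (p.1 < p.2)%R then g (p.2 - p.1)%R else 0).
  by case: ifP.
rewrite integral_image_restr// integral_mkcond.
transitivity (\int[lebesgue_itv r \x mu]_p
    (if (p.1 < p.2)%R then g (p.2 - p.1)%R else 0)).
  apply: eq_integral => p _; rewrite patchE mem_setE//.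
rewrite (fubini_tonelli1 _ mF F0) integral_lebesgue_itv//.
  exact: (measurable_fun_fubini_tonelli_F _ mF F0).
by move=> x; apply: integral_ge0 => y _; exact: (F0 (x, y)).
Qed.

Let measurable_subr (r : R) : measurable_fun setT (fun w : R => w - r)%R.
Proof. exact: measurable_funB. Qed.

Let mubar_fin (r : R) : mubar `]r, +oo[%classic < +oo.
Proof. by rewrite ltey_eq fin_num_measure. Qed.

(** What is left of a residual life after a service r, where it is not
    exhausted. *)
Definition shifted_in (r : R) : {finite_measure set R -> \bar R} :=
  image_restr (measurable_itv _) (mubar_fin r) (@measurable_subr r).

Lemma shifted_inE r (A : set R) : shifted_in r A =
  mubar ((fun w => w - r)%R @^-1` A `&` `]r, +oo[).
Proof. by []. Qed.

Lemma integral_shifted_in r (g : R -> \bar R) :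
  measurable_fun setT g -> (forall x, 0 <= g x) ->
  \int[shifted_in r]_x g x = \int[mubar]_(w in `]r, +oo[) g (w - r)%R.
Proof. by move=> mg g0; rewrite /shifted_in integral_image_restr. Qed.

(** The renewal identity behind the theorem. The tail of mubar at y is the
    integral of the tail of mu over [y, +oo[; its part over [y + r, +oo[ is
    the tail of shifted_in at y, and its part over [y, y + r[ is the tail of
    shifted_out at y. So a population of residual lives subject to a service
    r is restored by the individuals that arrive meanwhile. *)
Lemma residual_shift r (A : set R) : (0 <= r)%R -> measurable A ->
  mubar A = shifted_in r A + shifted_out r A.
Proof.
move=> r0; suff H : forall A, measurable A ->
    mubar A = measure_add (shifted_in r) (shifted_out r) A.
  by move=> mA; rewrite H// measure_addE.
apply: (measure_unique (@RGenOInfty.G R) (fun k => `](- k%:R)%R, +oo[%classic)).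
- exact: RGenOInfty.measurableE.
- move=> _ _ [x ->] [y ->]; exists (Num.max x y).
  apply/seteqP; split => w /=; rewrite !in_itv/= !andbT gt_max.
    by move=> [-> ->].
  by move=> /andP[].
- by move=> k; exists (- k%:R)%R.
- apply/seteqP; split => // x _; exists (Num.truncn `|x|).+1 => //=.
  rewrite in_itv/= andbT ltrNl (le_lt_trans (ler_norm _))// normrN.
  by rewrite truncnS_gt.
- move=> _ [x ->]; apply: etrans; last exact/esym/measure_addE.
  (* Neither side charges ]-oo, 0], so x can be replaced by max x 0. *)
  have shift0 (y : R) : (0 <= y)%R -> mubar `]y, +oo[%classic =
      shifted_in r `]y, +oo[%classic + shifted_out r `]y, +oo[%classic.
    move=> y0.
    have -> : shifted_in r `]y, +oo[%classic = mubar `](y + r)%R, +oo[%classic.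
      rewrite shifted_inE; congr (mubar _).
      apply/seteqP; split => w /=; rewrite !in_itv/= !andbT; lra.
    have -> : shifted_out r `]y, +oo[%classic =
        \int[lebesgue_measure]_(s in `[0%R, r[) tail (y + s)%R.
      have := @integral_shifted_out r (EFin \o \1_`]y, +oo[%classic).
      rewrite integral_indic// setIT => ->; last 2 first.
      - by apply/measurable_EFinP; exact: measurable_indic.
      - by move=> w; rewrite lee_fin.
      apply: eq_integral => s; rewrite inE/= in_itv/= => /andP[s0 _].
      rewrite /tail -[X in _ = mu X]setIT -integral_indic//.
      apply: eq_integral => w _; rewrite !indicE !mem_setE/= !in_itv/= !andbT.
      have -> : (y + s < w)%R = (y < w - s)%R by rewrite ltrBrDr.
      case: ifPn => // sw; rewrite ltNge (_ : (_ <= _)%R)//; lra.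
    rewrite !mubar_tail ?addr_ge0//.
    have mt : measurable_fun setT tail := measurable_tail.
    have -> : \int[lebesgue_measure]_(s in `[0%R, r[) tail (y + s)%R =
        \int[lebesgue_measure]_(s in `[y, (y + r)%R[) tail s.
      rewrite integral_mkcond [RHS]integral_mkcond.
      have mt' : measurable_fun setT (tail \_ `[y, (y + r)%R[).
        by apply/(measurable_restrictT _ _).1 => //; exact: measurable_funTS.
      have t0 w : 0 <= (tail \_ `[y, (y + r)%R[) w.
        by apply: erestrict_ge0 => ? _; exact: tail_ge0.
      rewrite (ge0_integral_affine y (oner_neq0 R) mt' t0) normr1 mul1e.
      apply: eq_integral => s _; rewrite !patchE !mem_setE/= !in_itv/= mul1r.
      by rewrite lerDr (addrC s) ltrD2l.
    rewrite addeC -ge0_integral_setU//=.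
    - by rewrite -itv_bndbnd_setU// bnd_simp// lerDl.
    - exact: measurable_funTS.
    - apply/disj_setPRL => w /=; rewrite !in_itv/= andbT => yw.
      by apply/negP; rewrite negb_and -leNgt yw orbT.
  have [|x0] := leP 0%R x; first exact: shift0.
  change (mubar `]x, +oo[%classic =
    shifted_in r `]x, +oo[%classic + shifted_out r `]x, +oo[%classic).
  have -> : mubar `]x, +oo[%classic = mubar `]0%R, +oo[%classic.
    apply/eqP; rewrite eq_le mubar_gt0 probability_le1//= -mubar_gt0.
    by rewrite le_measure ?inE//; apply: subset_itvr; rewrite bnd_simp ltW.
  have -> : shifted_in r `]x, +oo[%classic = shifted_in r `]0%R, +oo[%classic.
    rewrite !shifted_inE; congr (mubar _).
    by apply/seteqP; split => w /=; rewrite !in_itv/= !andbT; lra.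
  have -> : shifted_out r `]x, +oo[%classic = shifted_out r `]0%R, +oo[%classic.
    rewrite !shifted_outE; congr (_ _).
    by apply/seteqP; split => w /=; rewrite !in_itv/= !andbT /D/=; lra.
  exact: shift0.
- by move=> k; rewrite ltey_eq fin_num_measure.
Qed.

(** The mass of the residual lives exhausted by a service r is the mass of the
    newcomers that are still present. *)
Lemma shifted_outT (r : R) : (0 <= r)%R ->
  shifted_out r setT = mubar `]-oo, r]%classic.
Proof.
move=> r0; have := residual_shift r0 (@measurableT _ R).
rewrite shifted_inE preimage_setT setTI probability_setT.
rewrite -setCitvr probability_setC// => ->.
by rewrite addeAC subee ?add0e// fin_num_measure.
Qed.

Lemma shifted_outT_le (r : R) : (0 <= r)%R -> shifted_out r setT <= r%:E.
Proof.
move=> r0; rewrite shifted_outE preimage_setT setTI.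
rewrite (@le_trans _ _ ((lebesgue_itv r \x mu) (setT `*` setT)))//.
  by rewrite le_measure ?inE// setXTT.
suff -> : (lebesgue_itv r \x mu) (setT `*` setT) = r%:E by [].
transitivity (lebesgue_itv r setT * mu setT); first exact: product_measure1E.
by rewrite lebesgue_itvT// probability_setT mule1.
Qed.

(** The rectangle [0, r[ x ]r, +oo[ lies in the region s < w. *)
Lemma shifted_outT_ge (r : R) : (0 <= r)%R -> r%:E * tail r <= shifted_out r setT.
Proof.
move=> r0; rewrite shifted_outE preimage_setT setTI.
rewrite -(lebesgue_itvT r0) /tail.
have -> : lebesgue_itv r setT = lebesgue_itv r `[0%R, r[%classic.
  by rewrite !lebesgue_itvE setTI setIid.
rewrite -product_measure1E// le_measure ?inE//; first exact: measurableX.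
move=> [s w] /=; rewrite !in_itv/= /D/= => -[/andP[_ sr] /andP[rw _]].
exact: lt_trans rw.
Qed.

End residual_identity.

(** * Integrals over n independent points *)

Section points_integral.
Variable R : realType.
Local Open Scope ereal_scope.
Implicit Types (f g : config R -> \bar R) (m : {finite_measure set R -> \bar R}).

(** The integral of f over n independent points of law m. Iterated single
    integrals make sense for any finite m, in particular for the
    sub-probabilities obtained by cutting mubar, and adding a point is an
    induction step. *)
Fixpoint pint (m : {finite_measure set R -> \bar R}) n f : \bar R :=
  match n with
  | 0 => f mset0
  | n'.+1 => \int[m]_w pint m n' (fun y => f (add_mset w y))
  end.

Lemma pint_ge0 m n f : (forall x, 0 <= f x) -> 0 <= pint m n f.
Proof.
elim: n f => [|n ih] f f0 /=; first exact: f0.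
by apply: integral_ge0 => w _; exact: ih.
Qed.

Lemma measurable_pint m n d (T : measurableType d) (F : T * config R -> \bar R) :
  measurable_fun setT F -> (forall p, 0 <= F p) ->
  measurable_fun setT (fun t => pint m n (fun x => F (t, x))).
Proof.
elim: n d T F => [|n ih] d T F mF F0 /=.
  by apply: (measurable_comp2 mF) => //; exact: measurable_cst.
pose G (p : (T * R) * config R) := F (p.1.1, add_mset p.1.2 p.2).
have mG : measurable_fun setT G.
  apply: (measurable_comp2 mF).
    exact: (measurableT_comp measurable_fst measurable_fst).
  apply: measurable_fun_add_mset => //.
  exact: (measurableT_comp measurable_snd measurable_fst).
apply: (measurable_fun_fubini_tonelli_F (m2 := m)
  (fun p : T * R => pint m n (fun y => F (p.1, add_mset p.2 y)))).
  exact: (ih _ _ G mG (fun p => F0 _)).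
by move=> p; apply: pint_ge0 => x.
Qed.

Lemma measurable_pint_add m n f : measurable_fun setT f -> (forall x, 0 <= f x) ->
  measurable_fun setT (fun w => pint m n (fun y => f (add_mset w y))).
Proof.
move=> mf f0.
apply: (@measurable_pint m n _ _ (fun p : R * config R => f (add_mset p.1 p.2))) => //.
by apply: (measurableT_comp mf); exact: measurable_add_mset.
Qed.

Lemma measurable_fun_shift f w : measurable_fun setT f ->
  measurable_fun setT (fun y => f (add_mset w y)).
Proof.
move=> mf; apply: (measurableT_comp mf).
by apply: measurable_fun_add_mset => //; exact: measurable_cst.
Qed.

Hint Resolve measurable_pint_add measurable_fun_shift : core.

Lemma le_pint_on m (D : set R) n f g : measurable D -> m (~` D) = 0 ->
  measurable_fun setT f -> measurable_fun setT g ->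
  (forall x, 0 <= f x) -> (forall x, 0 <= g x) ->
  (forall x : config R, size x = n -> (forall u, u \in x -> D u) -> f x <= g x) ->
  pint m n f <= pint m n g.
Proof.
move=> mD mD0; elim: n f g => [|n ih] f g mf mg f0 g0 fg /=.
  by apply: fg => [|u]; [rewrite enum_mset0|rewrite in_mset0].
apply: ae_ge0_le_integral => //.
- by move=> w _; exact: pint_ge0.
- exact: measurable_pint_add.
- by move=> w _; exact: pint_ge0.
- exact: measurable_pint_add.
exists (~` D); split => //; first exact: measurableC.
move=> w /= nle Dw; apply: nle => _; apply: ih => //; [exact: measurable_fun_shift..|].
move=> x xn xD; apply: fg; first by rewrite size_add_mset xn.
by move=> u; rewrite mem_add_mset => /orP[/eqP->//|/xD].
Qed.

Lemma eq_pint m n f g : f =1 g -> pint m n f = pint m n g.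
Proof. by move=> /funext ->. Qed.

Lemma pintD m n f g : measurable_fun setT f -> measurable_fun setT g ->
  (forall x, 0 <= f x) -> (forall x, 0 <= g x) ->
  pint m n (fun x => f x + g x) = pint m n f + pint m n g.
Proof.
elim: n f g => [|n ih] f g mf mg f0 g0 //=.
rewrite -ge0_integralD//; last first.
- exact: measurable_pint_add.
- by move=> w _; exact: pint_ge0.
- exact: measurable_pint_add.
- by move=> w _; exact: pint_ge0.
by apply: eq_integral => w _; rewrite ih//; exact: measurable_fun_shift.
Qed.

Lemma pintZl m n f (c : R) : (0 <= c)%R -> measurable_fun setT f ->
  (forall x, 0 <= f x) -> pint m n (fun x => c%:E * f x) = c%:E * pint m n f.
Proof.
move=> c0; elim: n f => [|n ih] f mf f0 //=.
rewrite -ge0_integralZl//; last 2 first.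
- exact: measurable_pint_add.
- by move=> w _; exact: pint_ge0.
by apply: eq_integral => w _; rewrite ih//; exact: measurable_fun_shift.
Qed.

Lemma pint_le1 m n f : m setT <= 1 -> measurable_fun setT f ->
  (forall x, 0 <= f x) -> (forall x, f x <= 1) -> pint m n f <= 1.
Proof.
move=> m1; elim: n f => [|n ih] f mf f0 f1 /=; first exact: f1.
apply: le_trans m1; rewrite -[leRHS]mul1e -integral_cst//.
apply: ge0_le_integral => //.
- by move=> w _; exact: pint_ge0.
- exact: measurable_pint_add.
- by move=> w _; apply: ih => //; exact: measurable_fun_shift.
Qed.

(** Fubini, one point at a time. *)
Lemma pint_integral m n d (T : measurableType d)
    (N : {sigma_finite_measure set T -> \bar R}) (F : T * config R -> \bar R) :
  measurable_fun setT F -> (forall p, 0 <= F p) ->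
  pint m n (fun x => \int[N]_t F (t, x)) = \int[N]_t pint m n (fun x => F (t, x)).
Proof.
elim: n F => [|n ih] F mF F0 //=.
under eq_integral => w _.
  rewrite (ih (fun p => F (p.1, add_mset w p.2)))//=; last first.
    by apply: (measurable_comp2 mF) => //; apply: measurable_fun_add_mset => //;
      exact: measurable_cst.
  over.
pose G (p : (R * T) * config R) := F (p.1.2, add_mset p.1.1 p.2).
have mG : measurable_fun setT G.
  apply: (measurable_comp2 mF).
    exact: (measurableT_comp measurable_snd measurable_fst).
  apply: measurable_fun_add_mset => //.
  exact: (measurableT_comp measurable_fst measurable_fst).
apply: (fubini_tonelli (m1 := m) (m2 := N)
  (fun p : R * T => pint m n (fun y => F (p.2, add_mset p.1 y)))).
  exact: (measurable_pint m n mG (fun p => F0 _)).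
by move=> p; apply: pint_ge0.
Qed.

Lemma le_pint_measure m (m' : {finite_measure set R -> \bar R}) n f :
  (forall A, measurable A -> m A <= m' A) ->
  measurable_fun setT f -> (forall x, 0 <= f x) -> pint m n f <= pint m' n f.
Proof.
move=> mm'; elim: n f => [|n ih] f mf f0 //=.
apply: (@le_trans _ _ (\int[m']_w pint m n (fun y => f (add_mset w y)))).
  apply: ge0_le_measure_integral => //.
  - by move=> w; exact: pint_ge0.
  - exact: measurable_pint_add.
apply: ge0_le_integral => //.
- by move=> w _; exact: pint_ge0.
- exact: measurable_pint_add.
- exact: measurable_pint_add.
- by move=> w _; apply: ih => //; exact: measurable_fun_shift.
Qed.

Section splitting.
Variables m m1 m2 : {finite_measure set R -> \bar R}.
Hypothesis mE : forall A, measurable A -> m A = m1 A + m2 A.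

Lemma integral_split (g : R -> \bar R) : measurable_fun setT g ->
  (forall x, 0 <= g x) -> \int[m]_x g x = \int[m1]_x g x + \int[m2]_x g x.
Proof.
move=> mg g0; rewrite -(ge0_integral_measure_add m1 m2)//.
apply: eq_measure_integral => A mA _; apply: (etrans (mE mA)).
exact/esym/measure_addE.
Qed.

Let m1m A : measurable A -> m1 A <= m A.
Proof. by move=> mA; rewrite mE// leeDl. Qed.

Let measurable_pint2 m' n f : measurable_fun setT f -> (forall x, 0 <= f x) ->
  measurable_fun setT (fun p : R * R =>
    pint m' n (fun y => f (add_mset p.1 (add_mset p.2 y)))).
Proof.
move=> mf f0; apply: (measurable_pint m' n
  (F := fun p : (R * R) * config R => f (add_mset p.1.1 (add_mset p.1.2 p.2)))) => //.
apply: (measurableT_comp mf); apply: measurable_fun_add_mset.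
  exact: (measurableT_comp measurable_fst measurable_fst).
apply: measurable_fun_add_mset => //.
exact: (measurableT_comp measurable_snd measurable_fst).
Qed.

Let integral_exchange (a b m' : {finite_measure set R -> \bar R}) n f :
  measurable_fun setT f -> (forall x, 0 <= f x) ->
  \int[a]_w \int[b]_v pint m' n (fun y => f (add_mset w (add_mset v y))) =
  \int[b]_v \int[a]_w pint m' n (fun y => f (add_mset v (add_mset w y))).
Proof.
move=> mf f0.
rewrite (fubini_tonelli (m1 := a) (m2 := b) _ (measurable_pint2 m' n mf f0)).
  apply: eq_integral => v _; apply: eq_integral => w _.
  by apply: eq_pint => y; rewrite add_msetCA.
by move=> p; exact: pint_ge0.
Qed.

Let measurable_integral_pint2 (b m' : {finite_measure set R -> \bar R}) n f :
  measurable_fun setT f -> (forall x, 0 <= f x) ->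
  measurable_fun setT (fun w =>
    \int[b]_v pint m' n (fun y => f (add_mset w (add_mset v y)))).
Proof.
move=> mf f0; apply: (measurable_fun_fubini_tonelli_F (m2 := b) _
  (measurable_pint2 m' n mf f0)).
by move=> p; exact: pint_ge0.
Qed.

(** A union bound: either all the points come from m1, or one of them comes from
    m2 and nothing is asked of the n others. *)
Lemma pint_split_le n f : measurable_fun setT f -> (forall x, 0 <= f x) ->
  pint m n.+1 f <= pint m1 n.+1 f +
    n.+1%:R%:E * \int[m2]_w pint m n (fun y => f (add_mset w y)).
Proof.
elim: n f => [|n ih] f mf f0.
  by rewrite mul1e -integral_split//; exact: (measurable_pint_add m 0).
have mA := measurable_pint_add m n.+1 mf f0.
have A0 w : 0 <= pint m n.+1 (fun y => f (add_mset w y)) by exact: pint_ge0.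
rewrite [leLHS](integral_split mA A0).
set B := \int[m2]_w _.
have -> : n.+2%:R%:E * B = n.+1%:R%:E * B + B.
  by rewrite -addn1 natrD EFinD ge0_muleDl// mul1e.
rewrite [leRHS]addeA leeD2r//.
have -> : B = \int[m]_w \int[m2]_v
    pint m n (fun y => f (add_mset w (add_mset v y))).
  by rewrite integral_exchange.
have mJ := measurable_integral_pint2 m2 m n mf f0.
have J0 w : 0 <= \int[m2]_v pint m n (fun y => f (add_mset w (add_mset v y))).
  by apply: integral_ge0 => v _; exact: pint_ge0.
apply: (@le_trans _ _ (\int[m1]_w (pint m1 n.+1 (fun y => f (add_mset w y)) +
    n.+1%:R%:E *
    \int[m2]_v pint m n (fun y => f (add_mset w (add_mset v y)))))).
  apply: ge0_le_integral => //.
  - apply: emeasurable_funD; first exact: measurable_pint_add.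
    exact: measurable_funeM.
  - by move=> w _; apply: ih => //; exact: measurable_fun_shift.
rewrite ge0_integralD//; last 4 first.
- by move=> w _; exact: pint_ge0.
- exact: measurable_pint_add.
- by move=> w _; rewrite mule_ge0.
- exact: measurable_funeM.
rewrite leeD2l// ge0_integralZl// lee_wpmul2l//.
exact: ge0_le_measure_integral.
Qed.

(** In the expansion of the n.+1-fold product of m1 + m2, only the terms with at
    most one point from m2 are kept. *)
Lemma pint_split_ge n f : measurable_fun setT f -> (forall x, 0 <= f x) ->
  pint m1 n.+1 f +
    n.+1%:R%:E * \int[m2]_w pint m1 n (fun y => f (add_mset w y))
  <= pint m n.+1 f.
Proof.
elim: n f => [|n ih] f mf f0.
  by rewrite mul1e -integral_split//; exact: (measurable_pint_add m 0).
have mA := measurable_pint_add m n.+1 mf f0.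
have A0 w : 0 <= pint m n.+1 (fun y => f (add_mset w y)) by exact: pint_ge0.
rewrite [leRHS](integral_split mA A0).
set B := \int[m2]_w _.
have -> : n.+2%:R%:E * B = n.+1%:R%:E * B + B.
  rewrite -addn1 natrD EFinD ge0_muleDl// mul1e//.
rewrite addeA; apply: leeD; last first.
  apply: ge0_le_integral => //.
  - by move=> w _; exact: pint_ge0.
  - exact: measurable_pint_add.
  - move=> w _; apply: le_pint_measure => //; exact: measurable_fun_shift.
have -> : B = \int[m1]_w \int[m2]_v
    pint m1 n (fun y => f (add_mset w (add_mset v y))).
  by rewrite integral_exchange.
have mJ := measurable_integral_pint2 m2 m1 n mf f0.
have J0 w : 0 <= \int[m2]_v pint m1 n (fun y => f (add_mset w (add_mset v y))).
  by apply: integral_ge0 => v _; exact: pint_ge0.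
have -> : pint m1 n.+2 f + n.+1%:R%:E * \int[m1]_w \int[m2]_v
      pint m1 n (fun y => f (add_mset w (add_mset v y))) =
    \int[m1]_w (pint m1 n.+1 (fun y => f (add_mset w y)) + n.+1%:R%:E *
      \int[m2]_v pint m1 n (fun y => f (add_mset w (add_mset v y)))).
  rewrite [RHS]ge0_integralD//; last 4 first.
  - by move=> w _; exact: pint_ge0.
  - exact: measurable_pint_add.
  - by move=> w _; rewrite mule_ge0.
  - exact: measurable_funeM.
  by rewrite [in RHS]ge0_integralZl.
apply: ge0_le_integral => //.
- by move=> w _; rewrite adde_ge0 ?mule_ge0//; exact: pint_ge0.
- apply: emeasurable_funD; first exact: measurable_pint_add.
  exact: measurable_funeM.
- by move=> w _; apply: ih => //; exact: measurable_fun_shift.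
Qed.

End splitting.

Lemma integral_power_prob (p : probability R R) n f :
  measurable_fun setT f -> (forall x, 0 <= f x) ->
  \int[power_prob p n]_s f (theta s) = pint p n f.
Proof.
elim: n f => [|n ih] f mf f0 /=.
  rewrite integral_dirac//; last by apply: measurableT_comp => //.
  by rewrite diracT mul1e theta0.
have mth k : measurable_fun setT (fun s : k.-tuple R => f (theta s)).
  by apply: (measurableT_comp mf); exact: measurable_theta.
rewrite ge0_integral_distribution//=; last exact: mth.
have mF : measurable_fun setT (fun q : R * n.-tuple R => f (theta (tuple_cons q))).
  by apply: (measurableT_comp (mth n.+1)); exact: measurable_tuple_cons.
rewrite (fubini_tonelli1 _ mF)//.
apply: eq_integral => w _; rewrite -ih//; last exact: measurable_fun_shift.
by apply: eq_integral => s _; rewrite -theta_cons.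
Qed.

Lemma integral_config_law (p : probability R R) n f :
  measurable_fun setT f -> (forall x, 0 <= f x) ->
  \int[config_law p n]_x f x = pint p n f.
Proof.
by move=> mf f0; rewrite ge0_integral_distribution// -integral_power_prob.
Qed.

End points_integral.

(** * The state at time t, by recursion on the first event *)

Section reach.
Variables (R : realType) (alpha beta : nat -> R) (mu : probability R R).
Hypothesis alpha_ge0 : forall n, 0 <= alpha n.
Hypothesis beta_ge0 : forall n, 0 <= beta n.
Hypothesis beta_gt0 : forall n, 0 < beta n <-> (0 < n)%N.
Variables (A : set (config R)) (mA : measurable A).
Implicit Types (x y : config R) (e w s t h r : R) (q : R -> config R -> \bar R).
Local Open Scope ereal_scope.

Local Notation holding := (holding alpha beta).
Local Notation jump := (jump alpha beta).
Local Notation speed := (speed beta).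
Local Notation serve := (serve beta).

(** The indicator that the state at time t is in A, as long as the first event
    comes after t; otherwise q takes over from the time and the state of
    that event. *)
Definition outcome q t x e w : \bar R :=
  if t%:E < holding e x then (\1_A (serve t x))%:E
  else q (t - fine (holding e x))%R (jump e w x).

(** The probability that, from x, the state at time t is in A and fewer than k
    events occur up to t. Bounding the number of events makes it definable
    by recursion on the first one. *)
Fixpoint reach k t x : \bar R :=
  match k with
  | 0 => 0
  | k'.+1 => \int[@expo R]_e \int[mu]_w outcome (reach k') t x e w
  end.

Lemma reach0 t x : reach 0 t x = 0. Proof. by []. Qed.

Lemma outcome_ge0 q t x e w : (forall t x, 0 <= q t x) -> 0 <= outcome q t x e w.
Proof. by move=> q0; rewrite /outcome; case: ifP. Qed.

Lemma reach_ge0 k t x : 0 <= reach k t x.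
Proof.
elim: k t x => [|k ih] t x //=.
by apply: integral_ge0 => e _; apply: integral_ge0 => w _; exact: outcome_ge0.
Qed.

Lemma measurable_outcome q : measurable_fun setT (fun p : R * config R => q p.1 p.2) ->
  measurable_fun setT (fun p : ((R * config R) * R) * R =>
    outcome q p.1.1.1 p.1.1.2 p.1.2 p.2).
Proof.
move=> mq.
have m11 : measurable_fun setT (fun p : ((R * config R) * R) * R => p.1.1).
  exact: (measurableT_comp measurable_fst measurable_fst).
have mt := measurableT_comp measurable_fst m11.
have mx := measurableT_comp measurable_snd m11.
have me : measurable_fun setT (fun p : ((R * config R) * R) * R => p.1.2).
  exact: (measurableT_comp measurable_snd measurable_fst).
have mH := measurable_holding alpha beta me mx.
apply: measurable_fun_ifT.
- by apply: measurable_fun_lte => //; apply/measurable_EFinP.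
- have mI : measurable_fun setT (\1_A : config R -> R) by exact: measurable_indic.
  apply/measurable_EFinP; apply: (measurableT_comp mI).
  exact: measurable_serve.
- apply: (measurable_comp2 mq); last exact: measurable_jump.
  apply: measurable_funB => //; apply: (measurableT_comp _ mH).
  exact: fine_measurable.
Qed.

Lemma measurable_reach k :
  measurable_fun setT (fun p : R * config R => reach k p.1 p.2).
Proof.
elim: k => [|k ih] /=; first exact: measurable_cst.
have mo := measurable_outcome ih.
have o0 (p : ((R * config R) * R) * R) :
    0 <= outcome (reach k) p.1.1.1 p.1.1.2 p.1.2 p.2.
  by apply: outcome_ge0; exact: reach_ge0.
have m1 := measurable_fun_fubini_tonelli_F (m2 := mu) _ mo o0.
apply: (measurable_fun_fubini_tonelli_F (m2 := @expo R) _ m1) => p.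
by apply: integral_ge0 => w _; exact: (o0 (p, w)).
Qed.

Lemma measurable_outcome_e q t x :
  measurable_fun setT (fun p : R * config R => q p.1 p.2) ->
  measurable_fun setT (fun p : R * R => outcome q t x p.1 p.2).
Proof.
move=> /measurable_outcome mo.
apply: (measurableT_comp mo (g := fun p : R * R => (((t, x), p.1), p.2))).
by apply: measurable_fun_pair => //; exact: measurable_fun_pair.
Qed.

Lemma measurable_outcome_w q t x e :
  measurable_fun setT (fun p : R * config R => q p.1 p.2) ->
  measurable_fun setT (fun w => outcome q t x e w).
Proof.
move=> /(measurable_outcome_e t x) mo.
by apply: (measurableT_comp mo (g := fun w : R => (e, w))); exact: measurable_fun_pair.
Qed.

Definition mean_outcome q t x e := \int[mu]_w outcome q t x e w.

Lemma measurable_mean_outcome q t x : (forall t x, 0 <= q t x) ->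
  measurable_fun setT (fun p : R * config R => q p.1 p.2) ->
  measurable_fun setT (mean_outcome q t x).
Proof.
move=> q0 mq; apply: (measurable_fun_fubini_tonelli_F (m2 := mu) _
  (measurable_outcome_e t x mq)) => p.
exact: outcome_ge0.
Qed.

Lemma mean_outcome_ge0 q t x e : (forall t x, 0 <= q t x) ->
  0 <= mean_outcome q t x e.
Proof. by move=> q0; apply: integral_ge0 => w _; exact: outcome_ge0. Qed.

Lemma integral_prob_cst d (T : measurableType d) (P : probability T R) (v : \bar R) :
  \int[P]_z (cst v) z = v.
Proof.
rewrite integral_cst// [X in _ * X](_ : _ = 1) ?mule1//.
exact: probability_setT.
Qed.

Lemma integral_prob_le1 d (T : measurableType d) (P : probability T R) (f : T -> \bar R) :
  measurable_fun setT f -> (forall z, 0 <= f z) -> (forall z, f z <= 1) ->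
  \int[P]_z f z <= 1.
Proof.
move=> mf f0 f1; rewrite (le_trans (y := \int[P]_z (cst 1 z)))//.
  by apply: ge0_le_integral.
by rewrite integral_prob_cst.
Qed.

Lemma reach_le1 k t x : reach k t x <= 1.
Proof.
elim: k t x => [|k ih] t x //=.
apply: integral_prob_le1.
- by apply: measurable_mean_outcome; [exact: reach_ge0|exact: measurable_reach].
- by move=> e; apply: mean_outcome_ge0; exact: reach_ge0.
move=> e; apply: integral_prob_le1.
- by apply: measurable_outcome_w; exact: measurable_reach.
- by move=> w; apply: outcome_ge0; exact: reach_ge0.
- by move=> w; rewrite /outcome; case: ifP => // _; rewrite lee_fin indicE; case: (_ \in _).
Qed.

Lemma le_reachS k t x : reach k t x <= reach k.+1 t x.
Proof.
elim: k t x => [|k ih] t x; first exact: reach_ge0.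
change (\int[@expo R]_e mean_outcome (reach k) t x e <=
        \int[@expo R]_e mean_outcome (reach k.+1) t x e).
apply: ge0_le_integral => //.
- by move=> e _; apply: mean_outcome_ge0; exact: reach_ge0.
- by apply: measurable_mean_outcome; [exact: reach_ge0|exact: measurable_reach].
- by apply: measurable_mean_outcome; [exact: (@reach_ge0 k.+1)|exact: (measurable_reach k.+1)].
move=> e _; apply: ge0_le_integral => //.
- by move=> w _; apply: outcome_ge0; exact: reach_ge0.
- by apply: measurable_outcome_w; exact: measurable_reach.
- by apply: measurable_outcome_w; exact: (measurable_reach k.+1).
by move=> w _; rewrite /outcome; case: ifP => // _; exact: ih.
Qed.

Lemma le_reach k j t x : (k <= j)%N -> reach k t x <= reach j t x.
Proof.
move=> /subnK <-; elim: (j - k)%N => [|i ih]; first by [].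
by rewrite addSn (le_trans ih)// le_reachS.
Qed.

Lemma speed_gt0 x : (0 < size x)%N -> (0 < speed x)%R.
Proof. by move=> x0; rewrite divr_gt0 ?ltr0n//; exact/beta_gt0. Qed.

Lemma speed_ge0 x : (0 <= speed x)%R.
Proof. by rewrite divr_ge0. Qed.

Definition survives h x := forall u, u \in x -> (speed x * h < u)%R.

Lemma size_serve h x : survives h x -> size (serve h x) = size x.
Proof. by move=> xh; rewrite serveE size_clip. Qed.

Lemma speed_serve h x : survives h x -> speed (serve h x) = speed x.
Proof. by move=> xh; rewrite /Defs.speed size_serve. Qed.

Lemma next_departure_serve h x : survives h x ->
  next_departure beta x = h%:E + next_departure beta (serve h x).
Proof.
move=> xh; rewrite !next_departureE speed_serve// serveE.
have [x0|x0] := posnP (size x).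
  have -> : x = mset0.
    elim/config_ind: x x0 {xh} => // w x _.
    by rewrite size_add_mset.
  by rewrite clip0 !first_exit0.
have s0 := speed_gt0 x0.
rewrite (first_exit_clip (c := (speed x * h)%R)) ?invr_gt0//.
by rewrite mulrAC divff ?mul1r// gt_eqF.
Qed.

Lemma next_arrival_serve h e x : survives h x ->
  next_arrival alpha (alpha (size x) * h + e)%R x =
  h%:E + next_arrival alpha e (serve h x).
Proof.
move=> xh; rewrite /next_arrival size_serve//; case: eqP => // /eqP a0.
by rewrite -EFinD; congr EFin; field.
Qed.

Lemma holding_serve h e x : survives h x ->
  holding (alpha (size x) * h + e)%R x = h%:E + holding e (serve h x).
Proof.
move=> xh; rewrite /Defs.holding (next_departure_serve xh) next_arrival_serve//.
by rewrite !minEle leeD2lE//; case: ifP.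
Qed.

Lemma serve_serve h s x : (0 <= s)%R -> survives h x ->
  serve s (serve h x) = serve (h + s)%R x.
Proof.
move=> s0 xh; rewrite serveE speed_serve// !serveE clip_clip ?mulrDr//.
by rewrite mulr_ge0// speed_ge0.
Qed.

Lemma holding_ge0 e x : (0 <= e)%R -> (forall u, u \in x -> (0 <= u)%R) ->
  0 <= holding e x.
Proof.
move=> e0 x0; rewrite le_min next_departureE first_exit_ge0 ?invr_ge0 ?speed_ge0//=.
by rewrite /next_arrival; case: ifP => //= _; rewrite lee_fin divr_ge0.
Qed.

(** Before the first event, waiting for a time h serves the individuals and uses
    up an amount alpha * h of the arrival clock; the rest of the evolution
    is that of the served state with the rest of the clock. *)
Lemma outcome_serve q h t e w x : survives h x -> (0 <= e)%R -> (h <= t)%R ->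
  outcome q t x (alpha (size x) * h + e) w =
  outcome q (t - h) (serve h x) e w.
Proof.
move=> xh e0 ht; rewrite /outcome holding_serve//.
have x0 u : u \in serve h x -> (0 <= u)%R by move=> /mem_clip/ltW.
have H0 := holding_ge0 e0 x0.
have -> : (t%:E < h%:E + holding e (serve h x)) =
          ((t - h)%:E < holding e (serve h x)) by rewrite EFinB lteBlDl.
case: ifPn => [_|]; first by rewrite serve_serve ?subr_ge0// subrKC.
rewrite -leNgt => Ht.
have Hfin : holding e (serve h x) \is a fin_num.
  by rewrite ge0_fin_numE// (le_lt_trans Ht)// ltry.
rewrite fineD//= opprD addrA; congr (q _ _).
rewrite /Defs.jump (next_departure_serve xh) next_arrival_serve// leeD2lE//.
rewrite holding_serve// fineD//= serve_serve//.
exact: fine_ge0.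
Qed.

Lemma outcome_arrival q h t e w x : survives h x -> (0 <= e)%R ->
  (e < alpha (size x) * h)%R -> (h <= t)%R ->
  outcome q t x e w =
  q (t - e / alpha (size x))%R (add_mset w (serve (e / alpha (size x)) x)).
Proof.
move=> xh e0 eah ht; set a := alpha (size x).
have a0 : (0 < a)%R.
  rewrite lt_neqAle alpha_ge0 andbT eq_sym; apply/eqP => a0.
  by move: eah; rewrite -/a a0 mul0r ltNge e0.
have eh : (e / a < h)%R by rewrite ltr_pdivrMr// mulrC.
have na : next_arrival alpha e x = (e / a)%:E by rewrite /next_arrival gt_eqF.
have nd : (e / a)%:E < next_departure beta x.
  rewrite (next_departure_serve xh) (@lt_le_trans _ _ h%:E)// leeDl//.
  rewrite next_departureE first_exit_ge0 ?invr_ge0 ?speed_ge0// => u.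
  by move=> /mem_clip/ltW.
have H : holding e x = (e / a)%:E.
  by rewrite /Defs.holding na; apply/min_idPr; exact: ltW.
rewrite /outcome /Defs.jump H/= na lte_fin ltNge (le_trans (ltW eh))//=.
by rewrite leNgt nd.
Qed.

Lemma outcome_departure q t e w w0 y :
  (0 <= w0)%R -> (forall u, u \in y -> (w0 < u)%R) ->
  (w0 / speed (add_mset w0 y) <= t)%R ->
  (alpha (size y).+1 * (w0 / speed (add_mset w0 y)) <= e)%R ->
  outcome q t (add_mset w0 y) e w =
  q (t - w0 / speed (add_mset w0 y))%R (clip w0 y).
Proof.
set x := add_mset w0 y => w00 yw0; set s := (w0 / speed x)%R => st ase.
have b0 : (0 < speed x)%R by rewrite speed_gt0// size_add_mset.
have nd : next_departure beta x = s%:E.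
  rewrite next_departureE {2}/x first_exit_add_mset; apply/min_idPl/ltW.
  rewrite lt_first_exit ?invr_gt0// invrK -mulrA mulVf ?mulr1 ?gt_eqF//.
  exact/allP.
have na : s%:E <= next_arrival alpha e x.
  rewrite /next_arrival size_add_mset; case: eqP => [_|/eqP a0]; first exact: leey.
  by rewrite lee_fin ler_pdivlMr 1?mulrC// lt_neqAle eq_sym a0 alpha_ge0.
have H : holding e x = s%:E.
  by rewrite /Defs.holding nd; apply/min_idPl.
rewrite /outcome /Defs.jump H/= nd na lte_fin ltNge st/=; congr (q _ _).
by rewrite serveE mulrC divfK ?gt_eqF// clip_add_mset subrr ltxx.
Qed.

Lemma expo_ae_gt0 : {ae @expo R, forall e, (0 < e)%R}.
Proof.
exists `]-oo, 0%R]%classic; split => //; first exact: expo_le0.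
by move=> e /= /negP; rewrite -leNgt in_itv.
Qed.

Lemma integral_expo_ge c (f : R -> \bar R) : (0 <= c)%R ->
  measurable_fun setT f -> (forall e, 0 <= f e) ->
  \int[@expo R]_(e in `[c, +oo[) f e = (expR (- c))%:E * \int[@expo R]_e f (c + e)%R.
Proof.
move=> c0 mf f0.
have mc : measurable_fun setT (fun e : R => c + e)%R by exact: measurable_funD.
pose P : {measure set R -> \bar R} :=
  measure_function_pushforward__canonical__measure_function_Measure (@expo R) mc.
have -> : \int[@expo R]_e f (c + e)%R = \int[P]_e f e.
  by rewrite ge0_integral_pushforward.
transitivity (\int[mscale (NngNum (expR_ge0 (- c))) P]_e f e); last first.
  by rewrite ge0_integral_mscale.
rewrite -(ge0_integral_mrestr (@expo R) (measurable_itv `[c, +oo[))//.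
apply: eq_measure_integral => B mB _.
exact: (expo_memoryless c0 mB).
Qed.

(** No individual can leave before h, so two cases exhaust the arrival clock: it
    rings after h, and by lack of memory the evolution restarts afresh from
    the served state, or it rings before h and a new individual joins. *)
Lemma reach_no_event k h t x : (0 <= h)%R -> (h <= t)%R -> survives h x ->
  (expR (- (alpha (size x) * h)))%:E * reach k.+1 (t - h) (serve h x) +
  \int[@expo R]_(e in `[0%R, (alpha (size x) * h)%R[) \int[mu]_w
     reach k (t - e / alpha (size x)) (add_mset w (serve (e / alpha (size x)) x))
  <= reach k.+1 t x.
Proof.
move=> h0 ht xh; set a := alpha (size x).
have ah0 : (0 <= a * h)%R by rewrite mulr_ge0 ?alpha_ge0.
have mM t' x' := measurable_mean_outcome t' x' (@reach_ge0 k) (measurable_reach k).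
have M0 t' x' e := @mean_outcome_ge0 _ t' x' e (@reach_ge0 k).
rewrite /= -/(mean_outcome (reach k) _ _ _).
apply: (@le_trans _ _ (\int[@expo R]_(e in `[0%R, (a * h)%R[ `|` `[(a * h)%R, +oo[)
    mean_outcome (reach k) t x e)); last first.
  apply: ge0_subset_integral => //.
  exact: measurableU.
rewrite ge0_integral_setU//; last 2 first.
- exact: measurable_funTS.
- apply/disj_setPRL => e /=; rewrite !in_itv/= andbT => ahe.
  by apply/negP; rewrite negb_and -!leNgt ahe orbT.
rewrite addeC; apply: leeD; last first.
  rewrite le_eqVlt; apply/orP; left; apply/eqP; apply: eq_integral => e.
  rewrite inE/= in_itv/= => /andP[e0 eah]; apply: eq_integral => w _.
  by rewrite (@outcome_arrival _ h).
apply: (@le_trans _ _ ((expR (- (a * h)))%:E *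
    \int[@expo R]_e mean_outcome (reach k) t x (a * h + e)%R)); last first.
  by rewrite -(integral_expo_ge ah0 (mM t x) (M0 t x)).
apply: lee_wpmul2l; first by rewrite lee_fin expR_ge0.
apply: ae_ge0_le_integral => //.
- by move=> e _; exact: M0.
- exact: mM.
- apply: (measurableT_comp (mM t x)); exact: measurable_funD.
apply: filterS expo_ae_gt0 => e /ltW e0 _.
rewrite le_eqVlt; apply/orP; left; apply/eqP; apply: eq_integral => w _.
by rewrite outcome_serve.
Qed.

(** The individual with the smallest workload w0 is the next to leave as soon as
    the arrival clock rings later. *)
Lemma reach_departure k t w0 y :
  (0 <= w0)%R -> (forall u, u \in y -> (w0 < u)%R) ->
  (w0 / speed (add_mset w0 y) <= t)%R ->
  (expR (- (alpha (size y).+1 * (w0 / speed (add_mset w0 y)))))%:E *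
  reach k (t - w0 / speed (add_mset w0 y)) (clip w0 y) <=
  reach k.+1 t (add_mset w0 y).
Proof.
set x := add_mset w0 y => w00 yw0; set s := (w0 / speed x)%R => st.
have s0 : (0 <= s)%R by rewrite divr_ge0// speed_ge0.
set c := (alpha _ * s)%R; have c0 : (0 <= c)%R by rewrite mulr_ge0.
set v := reach k _ _.
have mM := measurable_mean_outcome t x (@reach_ge0 k) (measurable_reach k).
have M0 e := @mean_outcome_ge0 _ t x e (@reach_ge0 k).
apply: (@le_trans _ _ (\int[@expo R]_(e in `[c, +oo[)
    mean_outcome (reach k) t x e)); last exact: ge0_subset_integral.
rewrite -expo_ge// muleC -integral_cst//; apply: ge0_le_integral => //.
- by move=> e _; exact: reach_ge0.
- exact: measurable_funTS.
move=> e /=; rewrite in_itv/= andbT => ce.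
rewrite /mean_outcome (eq_integral (cst v)) ?integral_prob_cst//.
by move=> w _; rewrite outcome_departure.
Qed.

Lemma reachS k t x :
  reach k.+1 t x = \int[@expo R]_e \int[mu]_w outcome (reach k) t x e w.
Proof. by []. Qed.

(** When all the workloads are positive no departure is due at time 0, and the
    arrival clock is almost surely positive. *)
Lemma reach1_ge x : (forall u, u \in x -> (0 < u)%R) -> (\1_A x)%:E <= reach 1 0 x.
Proof.
move=> x0; rewrite reachS -[leLHS](@integral_prob_cst _ _ (@expo R)).
have mM := measurable_mean_outcome 0%R x (@reach_ge0 0) (measurable_reach 0).
have M0 e := @mean_outcome_ge0 _ 0%R x e (@reach_ge0 0).
apply: ae_ge0_le_integral => //.
- by move=> e _; rewrite lee_fin.
- by move=> e _; exact: M0.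
apply: filterS expo_ae_gt0 => e e0 _.
have H : 0 < holding e x.
  rewrite lt_min; apply/andP; split.
    rewrite next_departureE; have [xs|xs] := posnP (size x).
      have -> : x = mset0.
        elim/config_ind: x xs {x0 mM M0} => // w x _.
        by rewrite size_add_mset.
      by rewrite first_exit0.
    rewrite lt_first_exit ?invr_gt0 ?speed_gt0// mul0r.
    exact/allP.
  rewrite /next_arrival; case: eqP => // /eqP a0.
  by rewrite lte_fin divr_gt0// lt_neqAle eq_sym a0/=.
rewrite /= (eq_integral (cst (\1_A x)%:E)) ?integral_prob_cst// => w _.
by rewrite /outcome H serveE mulr0 clip_pos.
Qed.

End reach.

(* Simplification must not expose the nested integrals of the recursion. *)
#[global] Opaque reach.

(** * Scenarios with at most one arrival or departure *)

Section local_bounds.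
Variables (R : realType) (alpha beta : nat -> R) (mu : probability R R).
Hypothesis alpha_ge0 : forall n, 0 <= alpha n.
Hypothesis beta_ge0 : forall n, 0 <= beta n.
Hypothesis beta_gt0 : forall n, 0 < beta n <-> (0 < n)%N.
Variables (A : set (config R)) (mA : measurable A).
Implicit Types (x y : config R) (e w s t h r : R).
Local Open Scope ereal_scope.

Local Notation reach := (reach alpha beta mu A).

Definition rate n : R := (beta n / n%:R)%R.

(** A lower bound for the probability that the arrival clocks remain silent
    during h, whether n or n.+1 individuals are present. *)
Definition damping n h : R := expR (- ((alpha n + alpha n.+1) * h)).

Lemma rate_ge0 n : (0 <= rate n)%R. Proof. by rewrite divr_ge0. Qed.

Lemma rate_gt0 n : (0 < rate n.+1)%R.
Proof. by rewrite divr_gt0 ?ltr0n//; exact/beta_gt0. Qed.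

Let le_exp c (a : R) (v v' : \bar R) : (c <= a)%R -> 0 <= v ->
  (expR a)%:E * v <= v' -> (expR c)%:E * v <= v'.
Proof.
by move=> ca v0; apply: le_trans; rewrite lee_wpmul2r// lee_fin ler_expR.
Qed.

Lemma reach_survive k h t x : (0 <= h)%R -> (h <= t)%R -> survives beta h x ->
  (expR (- (alpha (size x) * h)))%:E * reach k (t - h) (serve beta h x)
  <= reach k t x.
Proof.
move=> h0 ht xh; case: k => [|k]; first by rewrite !reach0 mule0.
apply: le_trans (@reach_no_event _ alpha beta mu _ _ _ A _ k h t x h0 ht xh) => //.
rewrite leeDl// integral_ge0// => e _; rewrite integral_ge0// => w _.
exact: reach_ge0.
Qed.

(** An arrival at time s, then no event until h: the n individuals have been
    served at rate n before s and at rate n.+1 after it. The bound on their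
    workloads leaves none of them time to depart. *)
Lemma reach_arrival k h s t x w : let n := size x in
  (0 <= s)%R -> (s <= h)%R -> (h <= t)%R ->
  (forall u, u \in x -> ((rate n + rate n.+1) * h < u)%R) ->
  (rate n.+1 * (h - s) < w)%R ->
  (damping n h)%:E * reach k (t - h)
    (add_mset (w - rate n.+1 * (h - s))
      (clip (rate n * s + rate n.+1 * (h - s)) x)) <=
  reach k (t - s) (add_mset w (clip (rate n * s) x)).
Proof.
move=> n s0 sh ht xh wh.
have sn := rate_ge0 n; have sn1 := rate_ge0 n.+1.
have xs u : u \in x -> (rate n * s + rate n.+1 * (h - s) < u)%R.
  by move=> /xh; apply: le_lt_trans; nra.
have size_y : size (clip (rate n * s) x) = n.
  by rewrite size_clip// => u /xh; apply: le_lt_trans; nra.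
set y := add_mset w (clip (rate n * s) x).
have sy : speed beta y = rate n.+1 by rewrite /speed size_add_mset size_y.
have yh : survives beta (h - s) y.
  move=> u; rewrite sy mem_add_mset => /orP[/eqP->//|].
  exact: mem_clip_lt.
have := @reach_survive k (h - s) (t - s) y.
rewrite subr_ge0 lerD2r => /(_ sh ht yh).
rewrite opprB addrA subrK serveE sy clip_add_mset subr_gt0 wh.
rewrite clip_clip ?mulr_ge0 ?subr_ge0// size_add_mset size_y.
apply: le_exp; last exact: reach_ge0.
have := alpha_ge0 n; have := alpha_ge0 n.+1; nra.
Qed.

(** An individual with workload 0 leaves at once, at the cost of one more event,
    and the others are served at rate n all along. *)
Lemma reach_arrival0 k h s t x : let n := size x in
  (0 <= s)%R -> (s <= h)%R -> (h <= t)%R ->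
  (forall u, u \in x -> ((rate n + rate n.+1) * h < u)%R) ->
  (damping n h)%:E * reach k (t - h) (clip (rate n * h) x) <=
  reach k.+1 (t - s) (add_mset 0%R (clip (rate n * s) x)).
Proof.
move=> n s0 sh ht xh.
have sn := rate_ge0 n; have sn1 := rate_ge0 n.+1.
set y := clip (rate n * s) x.
have size_y : size y = n.
  by rewrite size_clip// => u /xh; apply: le_lt_trans; nra.
have sy : speed beta y = rate n by rewrite /speed size_y.
have y0 u : u \in y -> (0 < u)%R := @mem_clip _ _ _ _.
have ts : (0 / speed beta (add_mset 0 y) <= t - s)%R.
  by rewrite mul0r subr_ge0 (le_trans sh).
have := @reach_departure _ alpha beta mu alpha_ge0 beta_ge0 beta_gt0 A mA k (t - s)%R
   0%R y (lexx _) y0 ts.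
rewrite mul0r mulr0 oppr0 expR0 mul1e addr0 clip_pos//; apply: le_trans.
have yh : survives beta (h - s) y.
  move=> u; rewrite sy; apply: mem_clip_lt => v /xh; apply: le_lt_trans; nra.
have := @reach_survive k (h - s) (t - s) y.
rewrite subr_ge0 lerD2r => /(_ sh ht yh).
rewrite opprB addrA subrK serveE sy clip_clip ?mulr_ge0 ?subr_ge0// size_y.
rewrite -mulrDr subrKC.
apply: le_exp; last exact: reach_ge0.
have := alpha_ge0 n; have := alpha_ge0 n.+1; nra.
Qed.

(** The individual with workload w leaves at time w / rate n.+1, and nothing
    else happens until h. *)
Lemma reach_departure_survive k h t w y : let n := size y in
  (0 <= h)%R -> (h <= t)%R -> (0 <= w)%R -> (w <= rate n.+1 * h)%R ->
  (forall u, u \in y -> ((rate n + rate n.+1) * h < u)%R) ->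
  (damping n h)%:E * reach k (t - h)
    (clip (w + rate n * (h - w / rate n.+1)) y) <=
  reach k.+1 t (add_mset w y).
Proof.
move=> n h0 ht w0 wh yh.
have sn := rate_ge0 n; have sn1 := rate_gt0 n.
set s := (w / rate n.+1)%R.
have s0 : (0 <= s)%R by rewrite divr_ge0// ltW.
have sh : (s <= h)%R by rewrite ler_pdivrMr// mulrC.
have sy : speed beta (add_mset w y) = rate n.+1 by rewrite /speed size_add_mset.
have yw u : u \in y -> (w < u)%R by move=> /yh; apply: le_lt_trans; nra.
have ts : (w / speed beta (add_mset w y) <= t)%R.
  by rewrite sy (le_trans sh).
have := @reach_departure _ alpha beta mu alpha_ge0 beta_ge0 beta_gt0 A mA k t
   w y w0 yw ts.
rewrite sy -/s; apply: le_trans.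
set z := clip w y.
have size_z : size z = n by rewrite size_clip.
have sz : speed beta z = rate n by rewrite /speed size_z.
have zh : survives beta (h - s) z.
  by move=> u; rewrite sz; apply: mem_clip_lt => v /yh; apply: le_lt_trans; nra.
have := @reach_survive k (h - s) (t - s) z.
rewrite subr_ge0 lerD2r => /(_ sh ht zh).
rewrite opprB addrA subrK serveE sz clip_clip ?mulr_ge0 ?subr_ge0// size_z => zle.
apply: (@le_trans _ _ ((expR (- (alpha n.+1 * s)))%:E *
  ((expR (- (alpha n * (h - s))))%:E *
    reach k (t - h) (clip (w + rate n * (h - s)) y)))); last first.
  by rewrite lee_wpmul2l// lee_fin expR_ge0.
rewrite muleA -EFinM -expRD lee_wpmul2r ?reach_ge0// lee_fin ler_expR.
have := alpha_ge0 n; have := alpha_ge0 n.+1; nra.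
Qed.

End local_bounds.

(** * Residual lives cut at the amount of service *)

Section parts.
Variables (R : realType) (p : probability R R).
Variables (D : set R) (mD : measurable D).
Local Open Scope ereal_scope.

Let pD : p D < +oo. Proof. by rewrite ltey_eq fin_num_measure. Qed.

Let mid : measurable_fun setT (fun x : R => x). Proof. exact: measurable_id. Qed.

Definition part : {finite_measure set R -> \bar R} := image_restr mD pD mid.

Lemma partE B : part B = p (B `&` D). Proof. by []. Qed.

Lemma integral_part (f : R -> \bar R) : measurable_fun setT f ->
  (forall x, 0 <= f x) -> \int[part]_x f x = \int[p]_(x in D) f x.
Proof. by move=> mf f0; rewrite /part integral_image_restr. Qed.

Lemma part_setC : part (~` D) = 0.
Proof. by rewrite partE setICl measure0. Qed.

Lemma part_le B : measurable B -> part B <= p B.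
Proof. by move=> mB; rewrite partE le_measure ?inE//; exact: measurableI. Qed.

End parts.

Section pint_bounds.
Variable R : realType.
Local Open Scope ereal_scope.

(** Replacing m by m1 costs at most the mass of m2 for each of the n points. *)
Lemma pint_split_bound (m m1 m2 : {finite_measure set R -> \bar R}) n f (d : R) :
  (forall B, measurable B -> m B = m1 B + m2 B) ->
  m setT <= 1 -> m2 setT <= d%:E -> (0 <= d)%R ->
  measurable_fun setT f -> (forall x, 0 <= f x) -> (forall x, f x <= 1) ->
  pint m n f <= pint m1 n f + (n%:R * d)%:E.
Proof.
move=> mE m1' m2d d0 mf f0 f1; case: n => [|n].
  by rewrite mul0r adde0.
apply: le_trans (pint_split_le mE n mf f0) _; apply: leeD => //.
rewrite EFinM lee_wpmul2l// (le_trans _ m2d)// -[leRHS]mul1e -integral_cst//.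
apply: ge0_le_integral => //.
- by move=> w _; exact: pint_ge0.
- exact: measurable_pint_add.
- by move=> w _; apply: pint_le1 => //; exact: measurable_fun_shift.
Qed.

End pint_bounds.

Section residual_bounds.
Variables (R : realType) (mu mubar : probability R R).
Hypothesis mu_supp : mu `]-oo, 0[%classic = 0%E.
Hypothesis mu_mean : (\int[mu]_x x%:E = 1)%E.
Hypothesis mubar_residual : is_residual_law mu mubar.
Local Open Scope ereal_scope.

Definition above (r : R) := part mubar (measurable_itv `]r, +oo[).
Definition below (r : R) := part mubar (measurable_itv `]-oo, r]).

Lemma above_below r B : measurable B -> mubar B = above r B + below r B.
Proof.
move=> mB; rewrite !partE -measureU//; last 3 first.
- exact: measurableI.
- exact: measurableI.
- rewrite setIACA setIid [X in _ `&` X](_ : _ = set0) ?setI0//.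
  apply/seteqP; split => w //= []; rewrite !in_itv/= andbT => rw.
  by rewrite leNgt rw.
congr (mubar _); rewrite -setIUr [X in _ `&` X](_ : _ = setT) ?setIT//.
apply/seteqP; split => w //= _; rewrite !in_itv/= andbT.
by have [|] := ltP r w; [left|right].
Qed.

(** By the renewal identity, the mass exhausted by a service r is that of the
    newcomers. *)
Lemma belowT (r : R) : (0 <= r)%R -> below r setT = shifted_out mu r setT.
Proof. by move=> r0; rewrite (shifted_outT (mubar := mubar)) // partE setTI. Qed.

Lemma below_le (r : R) : (0 <= r)%R -> below r setT <= r%:E.
Proof. by move=> r0; rewrite belowT// shifted_outT_le. Qed.

Lemma below_ge (r : R) : (0 <= r)%R -> r%:E * tail mu r <= below r setT.
Proof. by move=> r0; rewrite belowT// shifted_outT_ge. Qed.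

(** Serving each of n points is serving the configuration: no point is lost
    because all are cut above r. *)
Lemma pint_shifted_in r n f : measurable_fun setT f -> (forall x, 0 <= f x) ->
  pint (shifted_in mubar r) n f = pint (above r) n (fun x => f (clip r x)).
Proof.
elim: n f => [|n ih] f mf f0 /=; first by rewrite clip0.
have mclip : measurable_fun setT (fun x : config R => clip r x).
  by apply: (measurable_comp2 (@measurable_clip R)) => //; exact: measurable_cst.
rewrite integral_shifted_in//; last 2 first.
- exact: measurable_pint_add.
- by move=> w; exact: pint_ge0.
rewrite integral_part//; last 2 first.
- apply: (measurable_pint_add _ _ (f := f \o clip r)) => [|x]; last exact: f0.
  exact: measurableT_comp.
- by move=> w; apply: pint_ge0 => x; exact: f0.
apply: eq_integral => w; rewrite inE/= in_itv/= andbT => rw.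
rewrite ih//; last exact: measurable_fun_shift.
by apply: eq_pint => x; rewrite clip_add_mset subr_gt0 rw.
Qed.

Lemma le_above (r s : R) B : (r <= s)%R -> measurable B -> above s B <= above r B.
Proof.
move=> rs mB; rewrite !partE le_measure ?inE//; try exact: measurableI.
by apply: setIS; apply: subset_itvr; rewrite bnd_simp.
Qed.

(** The law of n residual lives is nearly invariant under a small service: each
    of the n points contributes an error at most s when newcomers are
    ignored, and at most s when the points below s are discarded. *)
Lemma pint_clip r s n f : (0 <= r)%R -> (r <= s)%R ->
  measurable_fun setT f -> (forall x, 0 <= f x) -> (forall x, f x <= 1) ->
  pint mubar n f <= pint (above s) n (fun x => f (clip r x)) + (n%:R * s *+ 2)%:E.
Proof.
move=> r0 rs mf f0 f1.
have s0 := le_trans r0 rs.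
have mclip : measurable_fun setT (fun x : config R => clip r x).
  by apply: (measurable_comp2 (@measurable_clip R)) => //; exact: measurable_cst.
have mg : measurable_fun setT (fun x => f (clip r x)) by exact: measurableT_comp.
have P1 : mubar setT <= 1 by rewrite probability_le1.
apply: (@le_trans _ _ (pint (above r) n (fun x => f (clip r x)) + (n%:R * s)%:E)).
  rewrite -pint_shifted_in//.
  apply: (@pint_split_bound _ mubar (shifted_in mubar r) (shifted_out mu r)) => //.
    by move=> B mB; exact: residual_shift.
  by rewrite (le_trans (shifted_outT_le _ r0)).
rewrite mulr2n EFinD addeA leeD2r//.
have aE B : measurable B -> above r B = above s B +
    part mubar (measurable_itv `]r, s]) B.
  move=> mB; rewrite !partE -measureU//; last 3 first.
  - exact: measurableI.
  - exact: measurableI.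
  - rewrite setIACA setIid [X in _ `&` X](_ : _ = set0) ?setI0//.
    apply/seteqP; split => w //= []; rewrite !in_itv/= andbT => sw /andP[_].
    by rewrite leNgt sw.
  congr (mubar _); rewrite -setIUr; congr (_ `&` _).
  apply/seteqP; split => w /=; rewrite !in_itv/= !andbT.
    by move=> rw; have [|] := ltP s w; [left|right; rewrite rw].
  by move=> [/(le_lt_trans rs)|/andP[]].
apply: (pint_split_bound _ aE) => //.
- by rewrite (le_trans _ P1)// part_le.
- apply: le_trans (below_le s0); rewrite !partE le_measure ?inE//; try exact: measurableI.
  by move=> w /= [_]; rewrite !in_itv/= => /andP[].
Qed.

End residual_bounds.

(** * Mean effect of an arrival or a departure *)

Section one_step.
Variables (R : realType) (alpha beta : nat -> R) (mu mubar : probability R R).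
Hypothesis alpha_ge0 : forall n, 0 <= alpha n.
Hypothesis beta_ge0 : forall n, 0 <= beta n.
Hypothesis beta_gt0 : forall n, 0 < beta n <-> (0 < n)%N.
Hypothesis mu_supp : mu `]-oo, 0[%classic = 0%E.
Hypothesis mu_mean : (\int[mu]_x x%:E = 1)%E.
Hypothesis mubar_residual : is_residual_law mu mubar.
Variables (A : set (config R)) (mA : measurable A).
Implicit Types (x y : config R) (e w s : R).
Local Open Scope ereal_scope.

Local Notation reach := (reach alpha beta mu A).
Local Notation rate := (rate beta).
Local Notation damping := (damping alpha).
Local Notation above := (above mubar).
Local Notation below := (below mubar).

Let mreach k := measurable_reach alpha beta mu mA k.
Let reach_ge0' k t x := @reach_ge0 R alpha beta mu A k t x.
Let reach_le1' k t x := @reach_le1 R alpha beta mu A mA k t x.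
Let rt0 n : (0 <= rate n)%R := rate_ge0 beta_ge0 n.
Let rt1 n : (0 < rate n.+1)%R := rate_gt0 beta_gt0 n.

Lemma measurable_reach_comp k d (T : measurableType d) (f : T -> R) (z : T -> config R) :
  measurable_fun setT f -> measurable_fun setT z ->
  measurable_fun setT (fun u => reach k (f u) (z u)).
Proof. by move=> mf mz; exact: (measurable_comp2 (mreach k)). Qed.

Variables (n k : nat) (h t : R).
Hypotheses (h0 : (0 <= h)%R) (ht : (h <= t)%R).

Local Notation g := (reach k (t - h)).
Local Notation V := (reach k.+2 t).

Let mg : measurable_fun setT g.
Proof. by apply: measurable_reach_comp => //; exact: measurable_cst. Qed.

Definition mean_add (y : R) : \bar R := pint mubar n (fun x => g (add_mset y x)).

Lemma mean_add_ge0 (y : R) : 0 <= mean_add y.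
Proof. by apply: pint_ge0 => x; exact: reach_ge0'. Qed.

Lemma mean_add_le1 (y : R) : mean_add y <= 1.
Proof.
apply: pint_le1 => //; first by rewrite probability_le1.
exact: measurable_fun_shift.
Qed.

Lemma measurable_mean_add : measurable_fun setT mean_add.
Proof. exact: measurable_pint_add. Qed.

(** The mean effect of an arrival after which a service s is given; the
    newcomers that leave meanwhile are neglected. *)
Definition mean_arrival (s : R) : \bar R :=
  \int[mu]_w (if (s < w)%R then mean_add (w - s)%R else 0).

Let measurable_lt_sub (f : R -> \bar R) : measurable_fun setT f ->
  measurable_fun setT (fun p : R * R => if (p.1 < p.2)%R then f (p.2 - p.1)%R else 0).
Proof.
move=> mf; apply: measurable_fun_ifT => //; first exact: measurable_fun_ltr.
by apply: (measurableT_comp mf); exact: measurable_funB.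
Qed.

Lemma measurable_mean_arrival : measurable_fun setT mean_arrival.
Proof.
apply: (measurable_fun_fubini_tonelli_F (m2 := mu) _
  (measurable_lt_sub measurable_mean_add)) => p.
by case: ifP => // _; exact: mean_add_ge0.
Qed.

Lemma mean_arrival_ge0 s : 0 <= mean_arrival s.
Proof.
by apply: integral_ge0 => w _; case: ifP => // _; exact: mean_add_ge0.
Qed.

Let rho := ((rate n + rate n.+1) * h)%R.
Let C := damping n h.
Let G := pint mubar n g.
Let slack := (n%:R * rho *+ 2)%R.

Let rho0 : (0 <= rho)%R.
Proof. by rewrite mulr_ge0// addr_ge0// ltW. Qed.

Let C0 : (0 <= C)%R. Proof. exact: expR_ge0. Qed.

Let C1 : (C <= 1)%R.
Proof. by rewrite -expR0 ler_expR oppr_le0 mulr_ge0// addr_ge0. Qed.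

Let slack0 : (0 <= slack)%R.
Proof. by rewrite mulrn_wge0// mulr_ge0. Qed.

Let G0 : 0 <= G. Proof. by apply: pint_ge0 => x; exact: reach_ge0'. Qed.

Let G1 : G <= 1.
Proof. by apply: pint_le1 => //; rewrite probability_le1. Qed.

(** Integrates a bound that holds for the configurations whose points exceed
    rho, where rho bounds all the service given during h. The configurations
    that this leaves out cost the slack 2 n rho. *)
Lemma damped_pint (f F : config R -> \bar R) r :
  (0 <= r)%R -> (r <= rho)%R ->
  measurable_fun setT f -> measurable_fun setT F ->
  (forall x, 0 <= f x) -> (forall x, f x <= 1) -> (forall x, 0 <= F x) ->
  (forall x : config R, size x = n -> (forall u, u \in x -> (rho < u)%R) ->
     C%:E * f (clip r x) <= F x) ->
  C%:E * pint mubar n f <= pint (above rho) n F + slack%:E.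
Proof.
move=> r0 rrho mf mF f0 f1 F0 fF.
have mclip : measurable_fun setT (fun x : config R => clip r x).
  by apply: (measurable_comp2 (@measurable_clip R)) => //; exact: measurable_cst.
have mfc : measurable_fun setT (fun x => f (clip r x)) by exact: measurableT_comp.
apply: (@le_trans _ _ (C%:E * (pint (above rho) n (fun x => f (clip r x)) + slack%:E))).
  apply: lee_wpmul2l; first by rewrite lee_fin.
  exact: (pint_clip mu_supp).
rewrite ge0_muleDr//; last by apply: pint_ge0.
apply: leeD; last by rewrite -EFinM lee_fin ler_piMl.
rewrite -pintZl//; apply: (le_pint_on (D := `]rho, +oo[)) => //.
- exact: part_setC.
- exact: measurable_funeM.
- by move=> x; rewrite mule_ge0 ?lee_fin.
- move=> x xn xrho; apply: fF => // u /xrho /=.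
  by rewrite in_itv/= andbT.
Qed.

(** A workload larger than the remaining service joins the others, a workload 0
    leaves at once, and the workloads in between, which are rare for small
    h, are dropped. *)
Lemma mean_arrival_bound s : (0 <= s)%R -> (s <= h)%R ->
  C%:E * (mean_arrival (rate n.+1 * (h - s)) + mu [set 0%R] * G) <=
  \int[mu]_w pint (above rho) n
     (fun x => reach k.+1 (t - s) (add_mset w (clip (rate n * s) x))) + slack%:E.
Proof.
move=> s0 sh; set sig := (rate n.+1 * (h - s))%R.
have sig0 : (0 <= sig)%R by rewrite mulr_ge0 ?subr_ge0// ltW.
have mclip r : measurable_fun setT (fun x : config R => clip r x).
  by apply: (measurable_comp2 (@measurable_clip R)) => //; exact: measurable_cst.
pose F (p : R * config R) :=
  reach k.+1 (t - s) (add_mset p.1 (clip (rate n * s) p.2)).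
have mF : measurable_fun setT F.
  apply: measurable_reach_comp; first exact: measurable_cst.
  apply: measurable_fun_add_mset => //.
  exact: (measurableT_comp (mclip _) measurable_snd).
have F0 p : 0 <= F p by exact: reach_ge0'.
have mFw w : measurable_fun setT (fun x => F (w, x)).
  by apply: (measurableT_comp mF); exact: pair1_measurable.
pose H w := pint (above rho) n (fun x => F (w, x)).
have mH : measurable_fun setT H by exact: measurable_pint.
have H0 w : 0 <= H w by exact: pint_ge0.
pose a1 w := if (sig < w)%R then mean_add (w - sig)%R else 0.
have ma1 : measurable_fun setT a1.
  apply: (measurableT_comp (measurable_lt_sub measurable_mean_add)
    (g := fun w : R => (sig, w))).
  exact: pair1_measurable.
have a10 w : 0 <= a1 w by rewrite /a1; case: ifP => // _; exact: mean_add_ge0.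
pose a2 w := (\1_[set 0%R] w)%:E * G.
have mset10 : measurable [set 0%R : R] by exact: measurable_set1.
have ma2 : measurable_fun setT a2.
  apply: emeasurable_funM => //.
  by apply/measurable_EFinP; exact: measurable_indic.
have a20 w : 0 <= a2 w by rewrite mule_ge0// lee_fin.
have -> : mean_arrival sig + mu [set 0%R] * G = \int[mu]_w (a1 w + a2 w).
  rewrite ge0_integralD//; congr (_ + _).
  rewrite muleC -[X in mu X]setIT -integral_indic// -ge0_integralZl//.
  - by apply: eq_integral => w _; rewrite muleC.
  - by apply/measurable_EFinP; exact: measurable_indic.
have ma : measurable_fun setT (fun w => a1 w + a2 w) by exact: emeasurable_funD.
have a0 w : 0 <= a1 w + a2 w by rewrite adde_ge0.
have slackE : slack%:E = \int[mu]_w (cst slack%:E) w by rewrite integral_prob_cst.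
rewrite -ge0_integralZl// slackE -ge0_integralD//; last first.
  by move=> w _; exact: H0.
apply: ge0_le_integral => //.
- by move=> w _; rewrite mule_ge0// lee_fin.
- exact: measurable_funeM.
- exact: emeasurable_funD.
move=> w _; change (C%:E * (a1 w + a2 w) <= H w + slack%:E).
rewrite /a1 /a2 indicE.
have [sw|ws] := ltP sig w.
  rewrite memNset ?mul0e ?adde0; last first.
    by move=> /= w0; move: sw; rewrite w0 ltNge sig0.
  refine (@damped_pint (fun x => g (add_mset (w - sig)%R x)) (fun x => F (w, x))
    (rate n * s + sig)%R _ _ _ _ _ _ _ _).
  - by rewrite addr_ge0// mulr_ge0.
  - by rewrite /rho /sig; have := rt0 n; have := rt1 n; nra.
  - exact: measurable_fun_shift.
  - exact: mFw.
  - by move=> x; exact: reach_ge0'.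
  - by move=> x; exact: reach_le1'.
  - by move=> x; exact: F0.
  - move=> x xn xrho.
    apply: le_trans (le_reachS alpha beta mu mA k _ _).
    have := @reach_arrival _ alpha beta mu alpha_ge0 beta_ge0 beta_gt0 A mA k h s t x w.
    by rewrite xn; apply.
rewrite add0e; have [->|w0] := eqVneq w 0%R; last first.
  by rewrite memNset ?mul0e ?mule0 ?adde_ge0 ?lee_fin//; exact/eqP.
rewrite mem_set// mul1e.
refine (@damped_pint g (fun x => F (0%R, x)) (rate n * h)%R _ _ _ _ _ _ _ _).
- by rewrite mulr_ge0.
- by rewrite /rho; have := rt0 n; have := rt1 n; nra.
- exact: mg.
- exact: mFw.
- by move=> x; exact: reach_ge0'.
- by move=> x; exact: reach_le1'.
- by move=> x; exact: F0.
- move=> x xn xrho; have := @reach_arrival0 _ alpha beta mu alpha_ge0 beta_ge0 beta_gt0 A mA k h s t x.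
  by rewrite xn; apply.
Qed.

(** An arrival at time e / a leaves a service b * (h - e / a) to be given until
    h. This substitution turns the arrival clock, uniform on [0, a h[ to
    first order, into the variable s of shifted_out. *)
Lemma integral_rescaled (f : R -> \bar R) (a b : R) : (0 < a)%R -> (0 < b)%R ->
  measurable_fun setT f -> (forall z, 0 <= f z) ->
  \int[lebesgue_measure]_(e in `[0%R, (a * h)%R[) f (b * (h - e / a))%R =
  (a / b)%:E * \int[lebesgue_measure]_(s in `[0%R, (b * h)%R[) f s.
Proof.
move=> a0 b0 mf f0.
have mf' (D : set R) : measurable_fun D f by exact: measurable_funTS.
rewrite [X in _ * X]integral_itv_bndo_bndc// -[X in _ * X]integral_itv_obnd_cbnd//.
rewrite integral_mkcond [in RHS]integral_mkcond.
have ba : (- (b / a) != 0)%R by rewrite oppr_eq0 gt_eqF// divr_gt0.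
have mf2 : measurable_fun setT (f \_ `]0%R, (b * h)%R]).
  by apply/(measurable_restrictT _ _).1 => //; exact: measurable_funTS.
have f20 (x : R) : 0 <= (f \_ `]0%R, (b * h)%R]) x by apply: erestrict_ge0.
rewrite (ge0_integral_affine (b * h) ba mf2 f20) muleA -EFinM normrN.
rewrite gtr0_norm ?divr_gt0// mulrA divfK ?gt_eqF// divff ?gt_eqF// mul1e.
apply: eq_integral => e _; rewrite !patchE.
have E1 : (- (b / a) * e + b * h = b * (h - e / a))%R by ring.
rewrite E1 !mem_setE/= !in_itv/=.
rewrite pmulr_rgt0// subr_gt0 ltr_pdivrMr// mulrC (mulrC h).
rewrite ler_pM2l// gerBl andbC; congr (if _ && _ then _ else _).
by rewrite pmulr_lge0 ?invr_gt0.
Qed.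

Let a := alpha n.
Let b' := rate n.+1.

Definition arrivals_part x : \bar R := \int[@expo R]_(e in `[0%R, (a * h)%R[)
  \int[mu]_w reach k.+1 (t - e / a) (add_mset w (clip (rate n * (e / a)) x)).

Definition mean_arrivals : \bar R := \int[shifted_out mu (b' * h)]_y mean_add y.

Let ah0 : (0 <= a * h)%R. Proof. by rewrite mulr_ge0 ?alpha_ge0. Qed.

Let expo_part := part (@expo R) (measurable_itv `[0%R, (a * h)%R[).

Let expo_partT : expo_part setT <= (a * h)%:E.
Proof.
rewrite partE setTI /expo /exponential_prob.
rewrite (@le_trans _ _ (\int[lebesgue_measure]_(x in `[0%R, (a * h)%R[) (cst 1 x)))//.
  apply: ge0_le_integral => //.
  - by move=> x _; rewrite lee_fin exponential_pdf_ge0.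
  - by apply/measurable_EFinP/measurable_funTS; exact: measurable_exponential_pdf.
  - move=> x /=; rewrite in_itv/= => /andP[x0 _].
    by rewrite exponential_pdfE// mul1r lee_fin mulN1r -expR0 ler_expR oppr_le0.
rewrite integral_cst// mul1e -[X in X _ <= _]/(lebesgue_measure) .
by rewrite -(lebesgue_itvT ah0) lebesgue_itvE setTI.
Qed.

Let expo_part_ge (f : R -> \bar R) : measurable_fun setT f -> (forall z, 0 <= f z) ->
  (expR (- (a * h)))%:E * \int[lebesgue_itv (a * h)]_e f e <= \int[expo_part]_e f e.
Proof.
move=> mf f0.
rewrite -(ge0_integral_mscale _ measurableT (NngNum (expR_ge0 (- (a * h)))))//.
apply: ge0_le_measure_integral => // B mB.
apply: le_lebesgue_expo; first exact: measurableI.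
by move=> x [].
Qed.

Let mclip r : measurable_fun setT (fun x : config R => clip r x).
Proof.
by apply: (measurable_comp2 (@measurable_clip R)) => //; exact: measurable_cst.
Qed.

Lemma mean_arrivals_ge0 : 0 <= mean_arrivals.
Proof. by apply: integral_ge0 => y _; exact: mean_add_ge0. Qed.

Lemma mean_arrivals_le : mean_arrivals <= (b' * h)%:E.
Proof.
have bh : (0 <= b' * h)%R by rewrite mulr_ge0// ltW// rt1.
apply: le_trans (shifted_outT_le mu bh).
rewrite -[leRHS]mul1e -integral_cst//; apply: ge0_le_integral => //.
- by move=> y _; exact: mean_add_ge0.
- exact: measurable_mean_add.
- by move=> y _; exact: mean_add_le1.
Qed.

Let F (p : (R * R) * config R) :=
  reach k.+1 (t - p.1.1 / a) (add_mset p.1.2 (clip (rate n * (p.1.1 / a)) p.2)).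

Let mF : measurable_fun setT F.
Proof.
have m11 : measurable_fun setT (fun p : (R * R) * config R => p.1.1 / a)%R.
  by apply: measurable_funM => //; exact: (measurableT_comp measurable_fst measurable_fst).
apply: measurable_reach_comp; first exact: measurable_funB.
apply: measurable_fun_add_mset.
  exact: (measurableT_comp measurable_snd measurable_fst).
apply: (measurable_comp2 (@measurable_clip R)) => //.
exact: measurable_funM.
Qed.

Let F1 (p : R * config R) := \int[mu]_w F ((p.1, w), p.2).

Let mF' : measurable_fun setT (fun q : (R * config R) * R => F ((q.1.1, q.2), q.1.2)).
Proof.
apply: (measurableT_comp mF
  (g := fun q : (R * config R) * R => ((q.1.1, q.2), q.1.2))).
apply: measurable_fun_pair; last exact: (measurableT_comp measurable_snd measurable_fst).
by apply: measurable_fun_pair => //; exact: (measurableT_comp measurable_fst measurable_fst).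
Qed.

Let mF1 : measurable_fun setT F1.
Proof.
by apply: (measurable_fun_fubini_tonelli_F (m2 := mu) _ mF') => q; exact: reach_ge0'.
Qed.

Let F10 p : 0 <= F1 p.
Proof. by apply: integral_ge0 => w _; exact: reach_ge0'. Qed.

Let arrivals_partE x : arrivals_part x = \int[expo_part]_e F1 (e, x).
Proof.
have mFx : measurable_fun setT (fun e => F1 (e, x)).
  by apply: (measurableT_comp mF1); exact: pair2_measurable.
by rewrite (integral_part (@expo R) _ mFx (fun e => F10 (e, x))).
Qed.

Lemma measurable_arrivals_part : measurable_fun setT arrivals_part.
Proof.
rewrite (_ : arrivals_part = fun x => \int[expo_part]_e F1 (e, x)); last first.
  by apply/funext => x; rewrite arrivals_partE.
exact: (measurable_fun_fubini_tonelli_G (m1 := expo_part) _ mF1 F10).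
Qed.

Lemma arrivals_part_ge0 x : 0 <= arrivals_part x.
Proof. by rewrite arrivals_partE integral_ge0. Qed.

(** The exponential density is at least expR (- (a h)) on [0, a h[, so the
    arrival clock can be replaced by Lebesgue measure, and the newcomers
    then have the law shifted_out. The term with mu [set 0] comes from the
    null workloads. *)
Lemma arrivals_bound :
  (C * expR (- (a * h)))%:E *
    ((a / b')%:E * mean_arrivals + (a * h)%:E * (mu [set 0%R] * G)) <=
  pint (above rho) n arrivals_part + (slack * (a * h))%:E.
Proof.
have [a0|a_neq0] := eqVneq a 0%R.
  rewrite a0 !mul0r !mul0e adde0 mule0 mulr0 adde0.
  by apply: pint_ge0 => x; exact: arrivals_part_ge0.
have a0 : (0 < a)%R by rewrite lt_neqAle eq_sym a_neq0 alpha_ge0.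
pose H e := \int[mu]_w pint (above rho) n (fun x => F ((e, w), x)).
have HE e : pint (above rho) n (fun x => F1 (e, x)) = H e.
  apply: (@pint_integral _ _ _ _ _ mu (fun p : R * config R => F ((e, p.1), p.2))).
    apply: (measurableT_comp mF (g := fun p : R * config R => ((e, p.1), p.2))).
    apply: measurable_fun_pair => //; apply: measurable_fun_pair => //.
  by move=> p; exact: reach_ge0'.
have H0 e : 0 <= H e.
  by apply: integral_ge0 => w _; apply: pint_ge0 => x; exact: reach_ge0'.
have mH : measurable_fun setT H.
  rewrite (_ : H = fun e => pint (above rho) n (fun x => F1 (e, x))).
    exact: measurable_pint.
  by apply/funext => e; rewrite HE.
have -> : pint (above rho) n arrivals_part = \int[expo_part]_e H e.
  rewrite (eq_pint _ _ arrivals_partE) pint_integral//.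
  by apply: eq_integral => e _; rewrite HE.
pose c0 := mu [set 0%R] * G.
have c00 : 0 <= c0 by rewrite mule_ge0.
pose f e := mean_arrival (b' * (h - e / a))%R + c0.
have mfa : measurable_fun setT (fun e : R => mean_arrival (b' * (h - e / a))%R).
  apply: (measurableT_comp measurable_mean_arrival).
  by apply: measurable_funM => //; apply: measurable_funB => //; exact: measurable_funM.
have mf : measurable_fun setT f by exact: emeasurable_funD.
have f0 e : 0 <= f e by rewrite adde_ge0 ?mean_arrival_ge0.
have -> : (a / b')%:E * mean_arrivals + (a * h)%:E * c0 =
    \int[lebesgue_itv (a * h)]_e f e.
  rewrite ge0_integralD//; last by move=> e _; exact: mean_arrival_ge0.
  have -> : \int[lebesgue_itv (a * h)]_e (cst c0 e) = (a * h)%:E * c0.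
    rewrite integral_cst// muleC; congr (_ * _); exact: lebesgue_itvT.
  congr (_ + _); rewrite integral_lebesgue_itv//; last first.
    by move=> e; exact: mean_arrival_ge0.
  rewrite (integral_rescaled (f := mean_arrival))//.
  - rewrite /mean_arrivals integral_shifted_out//; first exact: measurable_mean_add.
    exact: mean_add_ge0.
  - exact: rt1.
  - exact: measurable_mean_arrival.
  - exact: mean_arrival_ge0.
rewrite EFinM -muleA; apply: (@le_trans _ _ (C%:E * \int[expo_part]_e f e)).
  by rewrite lee_wpmul2l ?lee_fin// expo_part_ge.
have mslack : measurable_fun setT (fun e => H e + slack%:E) by exact: emeasurable_funD.
apply: (@le_trans _ _ (\int[expo_part]_e (H e + slack%:E))).
  rewrite -ge0_integralZl// !integral_part//; last 3 first.
  - by move=> e; rewrite adde_ge0// lee_fin.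
  - exact: measurable_funeM.
  - by move=> e; rewrite mule_ge0// lee_fin.
  apply: ge0_le_integral => //.
  - by move=> e _; rewrite mule_ge0// lee_fin.
  - by apply: measurable_funTS; exact: measurable_funeM.
  - exact: measurable_funTS.
  move=> e /=; rewrite in_itv/= => /andP[e0 eah].
  apply: mean_arrival_bound; first by rewrite divr_ge0// ltW.
  by rewrite ler_pdivrMr// mulrC ltW.
rewrite ge0_integralD// leeD2l// integral_cst// EFinM lee_wpmul2l ?lee_fin//.
Qed.

(** A departure within h amounts to a residual life of at most b h, an event of
    mass at least b h times the tail of mu at b h by the renewal identity. *)
Lemma departures_bound :
  (b' * h * C)%:E * (tail mu (b' * h) * G) <=
  \int[below (b' * h)]_w pint (above (b' * h)) n (fun y => V (add_mset w y)) +
  (slack * (b' * h))%:E.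
Proof.
set r := (b' * h)%R.
have r0 : (0 <= r)%R by rewrite mulr_ge0// ltW// rt1.
have r_rho : (r <= rho)%R by rewrite /rho mulrDl lerDr mulr_ge0.
have mV : measurable_fun setT V.
  by apply: measurable_reach_comp => //; exact: measurable_cst.
have V0 x : 0 <= V x by exact: reach_ge0'.
pose H w := pint (above r) n (fun y => V (add_mset w y)).
have mH : measurable_fun setT H by exact: measurable_pint_add.
have H0 w : 0 <= H w by apply: pint_ge0 => x; exact: V0.
have CG0 : 0 <= C%:E * G by rewrite mule_ge0// lee_fin.
apply: (@le_trans _ _ (\int[below r]_w (cst (C%:E * G) w))).
  rewrite integral_cst// EFinM.
  rewrite [leLHS](_ : _ = C%:E * G * (r%:E * tail mu r)).
    by rewrite lee_wpmul2l// (below_ge mu_supp).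
  by rewrite (muleC (tail mu r)) !muleA (muleC r%:E) -!muleA; congr (_ * _); rewrite muleCA.
apply: (@le_trans _ _ (\int[below r]_w (H w + slack%:E))); last first.
  rewrite ge0_integralD// leeD2l// integral_cst// EFinM lee_wpmul2l ?lee_fin//.
  exact: (below_le mu_supp).
apply: ae_ge0_le_integral => //.
- by move=> w _; rewrite adde_ge0// lee_fin.
- exact: emeasurable_funD.
exists (~` `]0%R, r]%classic); split => //.
- exact: measurableC.
- change (mubar (~` `]0%R, r] `&` `]-oo, r]) = 0).
  apply/eqP; rewrite eq_le measure_ge0 andbT.
  rewrite -(mubar_le0 mu_supp mu_mean mubar_residual) le_measure ?inE//.
    by apply: measurableI => //; exact: measurableC.
  move=> w /= []; rewrite !in_itv/= => /negP; rewrite negb_and -leNgt.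
  by move=> /orP[//|/negP].
move=> w /= + wr; apply => _; move: wr; rewrite in_itv/= => /andP[w0 wr].
have wb : (w / b' <= h)%R by rewrite ler_pdivrMr ?rt1// mulrC.
apply: (@le_trans _ _ (pint (above rho) n (fun y => V (add_mset w y)) + slack%:E)).
  have bn := rt0 n; have bn1 := rt1 n.
  refine (@damped_pint g (fun y => V (add_mset w y))
    (w + rate n * (h - w / b'))%R _ _ _ _ _ _ _ _).
  - by rewrite addr_ge0 ?mulr_ge0 ?subr_ge0// ltW.
  - have wb0 : (0 <= w / b')%R by rewrite divr_ge0// ltW.
    by rewrite /rho; move: wr; rewrite /r /b'; nra.
  - exact: mg.
  - exact: measurable_fun_shift.
  - by move=> x; exact: reach_ge0'.
  - by move=> x; exact: reach_le1'.
  - by move=> x; exact: V0.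
  - move=> x xn xrho.
    have := @reach_departure_survive _ alpha beta mu alpha_ge0 beta_ge0 beta_gt0 A mA k.+1 h t w x.
    rewrite xn => /(_ h0 ht (ltW w0) wr xrho); apply: le_trans.
    by apply: lee_wpmul2l; [rewrite lee_fin|exact: le_reachS].
apply: leeD => //; apply: le_pint_measure.
- by move=> B mB; exact: le_above.
- exact: measurable_fun_shift.
- by move=> x; exact: V0.
Qed.

End one_step.

(** * Balance of the flows between n and n + 1 individuals *)

Section balance_arithmetic.
Variable R : realType.

(** The numerical core of flux_balance. I and G are the means of the later state
    with and without a newcomer, J and D the flows by arrival and by
    departure, C and C' the probabilities that clocks remain silent, c0 and
    tau the masses of the null and of the large workloads, sl the slack. The
    bound by 2 h p a is trivial; the other error sums what is lost in the
    bounds on J and D. The weights match because p a = p' N b, which is the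
    balance equation. *)
Lemma balance_arith (p p' a b N h C' C I G tau c0 sl J D : R) :
  0 <= p -> 0 <= p' -> 0 <= a -> 0 < b -> 0 <= N -> 0 <= h ->
  p * a = p' * (N * b) ->
  0 <= I -> I <= b * h -> 0 <= G -> G <= 1 -> 0 <= tau -> 0 <= c0 ->
  0 <= C' -> C' <= C -> C' <= 1 -> C' * (c0 + tau) <= 1 -> 0 <= sl -> 0 <= J -> 0 <= D ->
  C' * (a / b * I + a * h * (c0 * G)) <= J + sl * (a * h) ->
  b * h * C * (tau * G) <= D + sl * (b * h) ->
  p' * (N * I) + p * (a * h * G) <=
    p * J + p' * (N * D) +
    h * (p * a) * Num.min 2 ((1 - C') + (1 - C' * (c0 + tau)) + sl *+ 2).
Proof.
move=> p0 p'0 a0 b0 N0 h0 bal I0 Ibh G0 G1 tau0 c00 C'0 C'C C'1 C't1 sl0 J0 D0 HJ HD.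
have pa0 : 0 <= p * a by exact: mulr_ge0.
have pah0 : 0 <= p * a * h by exact: mulr_ge0.
have pN0 : 0 <= p' * N by exact: mulr_ge0.
have le2 : p' * (N * I) + p * (a * h * G) <= h * (p * a) * 2.
  have : p' * N * I <= p' * N * (b * h) by exact: ler_wpM2l.
  have : p * a * h * G <= p * a * h * 1 by exact: ler_wpM2l.
  have -> : p' * N * (b * h) = p * a * h by rewrite bal; ring.
  lra.
have pJ0 : 0 <= p * J + p' * (N * D) by rewrite addr_ge0 ?mulr_ge0.
rewrite minEle; case: ifP => _; first by lra.
have HJ' : C' * (p' * N * I + p * a * h * (c0 * G)) <= p * J + sl * (p * a * h).
  have -> : p' * N * I = p * (a / b) * I.
    by rewrite mulrA bal; field; rewrite gt_eqF.
  have := ler_wpM2l p0 HJ; lra.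
have HD' : p * a * h * C * (tau * G) <= p' * (N * D) + sl * (p * a * h).
  rewrite bal; have := ler_wpM2l pN0 HD; lra.
have HC : p * a * h * (tau * G) * C' <= p * a * h * (tau * G) * C.
  by apply: ler_wpM2l => //; rewrite mulr_ge0// mulr_ge0.
have H1 : (1 - C') * (p' * N * I) <= (1 - C') * (p * a * h).
  apply: ler_wpM2l; first by rewrite subr_ge0.
  have -> : p * a * h = p' * N * (b * h) by rewrite bal; ring.
  exact: ler_wpM2l.
have H2 : (p * a * h) * (1 - C' * (c0 + tau)) * G <=
          (p * a * h) * (1 - C' * (c0 + tau)) * 1.
  by apply: ler_wpM2l => //; rewrite mulr_ge0// subr_ge0.
lra.
Qed.

End balance_arithmetic.

Section series_balance.
Variable R : realType.
Local Open Scope ereal_scope.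

Lemma nneseriesS (u : nat -> \bar R) : (forall n, 0 <= u n) ->
  \sum_(0 <= n <oo) u n = u 0%N + \sum_(0 <= n <oo) u n.+1.
Proof.
move=> u0; rewrite nneseries_recl//; congr (_ + _).
rewrite -(nneseries_addn 1 u0).
by apply: eq_eseriesr => n _; rewrite addn1.
Qed.

(** Here u and v are the mean values after and before a step, split into the
    part kp in which the number does not change, the parts j and d with an
    arrival and a departure, and the part l with a newcomer. Flows out of n
    are compared with flows into n.+1, whence the shift of l and d. *)
Lemma series_balance (u kp j d l g v e : nat -> \bar R) :
  (forall n, 0 <= u n) -> (forall n, 0 <= kp n) -> (forall n, 0 <= j n) ->
  (forall n, 0 <= d n) -> (forall n, 0 <= l n) -> (forall n, 0 <= g n) ->
  (forall n, 0 <= e n) ->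
  (forall n, u n <= kp n + (l n + g n)) ->
  (forall n, kp n + j n + d n <= v n) ->
  (forall n, l n.+1 + g n <= j n + d n.+1 + e n) -> l 0%N = 0 ->
  \sum_(0 <= n <oo) u n <= \sum_(0 <= n <oo) v n + \sum_(0 <= n <oo) e n.
Proof.
move=> u0 k0 j0 d0 l0 g0 e0 before after flux l00.
have lg0 n : 0 <= l n + g n by rewrite adde_ge0.
have jd0 n : 0 <= j n + d n.+1 by rewrite adde_ge0.
have kj0 n : 0 <= kp n + j n by rewrite adde_ge0.
apply: (@le_trans _ _ (\sum_(0 <= n <oo) (kp n + (l n + g n)))).
  by apply: lee_nneseries => // n _ _; exact: u0.
rewrite nneseriesD// [X in _ + X]nneseriesD//.
rewrite (nneseriesS l0) l00 add0e -[X in _ + X]nneseriesD//.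
apply: (@le_trans _ _ (\sum_(0 <= n <oo) (kp n + j n + d n) + \sum_(0 <= n <oo) e n)).
  rewrite [X in _ <= X + _]nneseriesD// [X in _ <= X + _ + _]nneseriesD//.
  rewrite -!addeA leeD2l//.
  apply: (@le_trans _ _ (\sum_(0 <= n <oo) (j n + d n.+1 + e n))).
    by apply: lee_nneseries => // n _ _; rewrite adde_ge0.
  rewrite nneseriesD// nneseriesD// -!addeA leeD2l// leeD2r//.
  by rewrite (nneseriesS d0) leeDr.
rewrite leeD2r//; apply: lee_nneseries => // n _ _.
by rewrite adde_ge0.
Qed.

End series_balance.

Section one_step_sum.
Variables (R : realType) (alpha beta : nat -> R) (mu mubar : probability R R)
  (pi : probability nat R).
Hypothesis alpha_ge0 : forall n, 0 <= alpha n.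
Hypothesis beta_ge0 : forall n, 0 <= beta n.
Hypothesis beta_gt0 : forall n, 0 < beta n <-> (0 < n)%N.
Hypothesis mu_supp : mu `]-oo, 0[%classic = 0%E.
Hypothesis mu_mean : (\int[mu]_x x%:E = 1)%E.
Hypothesis mubar_residual : is_residual_law mu mubar.
Hypothesis balance : forall n, (pi [set n.+1] * (beta n.+1)%:E
                          = pi [set n] * (alpha n)%:E)%E.
Hypothesis summable : (\sum_(0 <= n <oo) pi [set n] * (alpha n)%:E < +oo)%E.
Variables (A : set (config R)) (mA : measurable A).
Implicit Types (x y : config R) (e w s : R).
Local Open Scope ereal_scope.

Local Notation reach := (reach alpha beta mu A).
Local Notation rate := (rate beta).
Local Notation damping := (damping alpha).
Local Notation above := (above mubar).
Local Notation below := (below mubar).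

Let reach_ge0' k t x := @reach_ge0 R alpha beta mu A k t x.
Let reach_le1' k t x := @reach_le1 R alpha beta mu A mA k t x.
Let rt0 n : (0 <= rate n)%R := rate_ge0 beta_ge0 n.
Let rt1 n : (0 < rate n.+1)%R := rate_gt0 beta_gt0 n.

Let mclip r : measurable_fun setT (fun x : config R => clip r x).
Proof.
by apply: (measurable_comp2 (@measurable_clip R)) => //; exact: measurable_cst.
Qed.

Lemma measurable_reach_x k t : measurable_fun setT (reach k t).
Proof.
by apply: (measurable_reach_comp alpha beta mu mA) => //; exact: measurable_cst.
Qed.

Section fixed.
Variables (k : nat) (h t : R).
Hypotheses (h0 : (0 <= h)%R) (ht : (h <= t)%R).

Local Notation g := (reach k (t - h)).
Local Notation V := (reach k.+2 t).
Local Notation arrivals n := (arrivals_part alpha beta mu A n k h t).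

Let mg : measurable_fun setT g := measurable_reach_x k (t - h).
Let mV : measurable_fun setT V := measurable_reach_x k.+2 t.
Let mgc r : measurable_fun setT (fun x => g (clip r x)).
Proof. exact: (measurableT_comp mg (mclip r)). Qed.

(** The n individuals present at the end of the step were all present at its
    beginning, where their residual lives exceeded the service. *)
Definition kept n := pint (above (rate n * h)) n (fun x => g (clip (rate n * h) x)).

(** At the beginning of the step n individuals are present, none of which can
    leave, and one arrives. *)
Definition joined n := pint (above (rate n * h)) n (arrivals n).

(** At the beginning of the step n individuals are present, and exactly one of
    them has a residual life short enough to leave. *)
Definition departed n := n%:R%:E * \int[below (rate n * h)]_w
  pint (above (rate n * h)) n.-1 (fun y => V (add_mset w y)).

(** What kept misses at the end of the step, in the light of the renewal
    identity: one of the n individuals is a newcomer. *)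
Definition lost n := n%:R%:E * \int[shifted_out mu (rate n * h)]_w
  pint mubar n.-1 (fun y => g (add_mset w y)).

Let rh0 n : (0 <= rate n * h)%R. Proof. by rewrite mulr_ge0. Qed.

Let marr n : measurable_fun setT (arrivals n).
Proof. exact: measurable_arrivals_part. Qed.

Let arr0 n x : 0 <= arrivals n x.
Proof. exact: arrivals_part_ge0. Qed.

Lemma kept_ge0 n : 0 <= kept n.
Proof. by apply: pint_ge0 => x; exact: reach_ge0'. Qed.

Lemma joined_ge0 n : 0 <= joined n.
Proof. by apply: pint_ge0 => x; exact: arr0. Qed.

Lemma departed_ge0 n : 0 <= departed n.
Proof.
rewrite mule_ge0// integral_ge0// => w _.
by apply: pint_ge0 => x; exact: reach_ge0'.
Qed.

Lemma lost_ge0 n : 0 <= lost n.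
Proof.
rewrite mule_ge0// integral_ge0// => w _.
by apply: pint_ge0 => x; exact: reach_ge0'.
Qed.

Lemma before_le n : pint mubar n g <= kept n + lost n.
Proof.
rewrite /lost /kept; case: n => [|n].
  by rewrite mul0e adde0 /= clip0.
rewrite -pint_shifted_in//.
apply: (pint_split_le (m1 := shifted_in mubar (rate n.+1 * h))) => //.
by move=> B mB; exact: residual_shift.
Qed.

(** From n individuals at the beginning of the step, three disjoint scenarios:
    no event, an arrival, a departure. *)
Lemma after_ge n :
  (expR (- (alpha n * h)))%:E * kept n + joined n + departed n <= pint mubar n V.
Proof.
apply: (@le_trans _ _ (pint (above (rate n * h)) n V + departed n)).
  apply: leeD => //; rewrite /kept /joined -pintZl//.
  pose f x := (expR (- (alpha n * h)))%:E * g (clip (rate n * h) x).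
  have mf : measurable_fun setT f by exact: measurable_funeM.
  have f0 x : 0 <= f x by rewrite mule_ge0 ?lee_fin ?expR_ge0.
  rewrite -(pintD (above (rate n * h)) n mf (marr n) f0 (arr0 n)).
  apply: (@le_pint_on _ _ (`](rate n * h)%R, +oo[%classic)).
  - exact: measurable_itv.
  - exact: part_setC.
  - exact: (emeasurable_funD mf (marr n)).
  - exact: mV.
  - by move=> x; apply: adde_ge0; [exact: f0|exact: arr0].
  - by move=> x; exact: reach_ge0'.
  move=> x xn xr.
  have xh : survives beta h x.
    by move=> u /xr /=; rewrite in_itv/= andbT /speed xn.
  have := @reach_no_event _ alpha beta mu alpha_ge0 beta_ge0 beta_gt0 A mA k.+1 h t x h0 ht xh.
  rewrite xn; apply: le_trans; apply: leeD.
    apply: lee_wpmul2l; first by rewrite lee_fin expR_ge0.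
    by rewrite serveE /speed xn; apply: le_reach => //; rewrite leqW.
  rewrite /arrivals_part le_eqVlt; apply/orP; left; apply/eqP.
  apply: eq_integral => e _; apply: eq_integral => w _.
  by rewrite serveE /speed xn.
rewrite /departed; case: n => [|n].
  by rewrite mul0e adde0.
apply: pint_split_ge => //.
by move=> B mB; exact: above_below.
Qed.

Let p m : R := fine (pi [set m]).

Let pE m : pi [set m] = (p m)%:E.
Proof. by rewrite /p fineK// fin_num_measure. Qed.

Let p0 m : (0 <= p m)%R. Proof. exact: fine_ge0. Qed.

Let balance_p n : (p n * alpha n = p n.+1 * (n.+1%:R * rate n.+1))%R.
Proof.
have := balance n; rewrite !pE -!EFinM => bal.
have <- : (p n.+1 * beta n.+1 = p n * alpha n)%R by exact: EFin_inj.
by congr (_ * _)%R; rewrite /rate mulrCA divff ?mulr1// pnatr_eq0.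
Qed.

Let V1 n : pint mubar n V <= 1.
Proof.
by apply: pint_le1 => //; rewrite probability_le1.
Qed.

Let joined_fin n : joined n \is a fin_num.
Proof.
rewrite ge0_fin_numE ?joined_ge0// (le_lt_trans _ (ltry 1))//.
apply: le_trans (V1 n); apply: le_trans (after_ge n).
by rewrite addeAC leeDr// adde_ge0 ?departed_ge0// mule_ge0 ?kept_ge0// lee_fin expR_ge0.
Qed.

Let departed_le1 n : departed n <= 1.
Proof.
apply: le_trans (V1 n); apply: le_trans (after_ge n).
by rewrite leeDr// adde_ge0 ?joined_ge0// mule_ge0 ?kept_ge0// lee_fin expR_ge0.
Qed.

Let joined_ge n :
  pint (above ((rate n + rate n.+1) * h)) n (arrivals n) <= joined n.
Proof.
refine (@le_pint_measure _ _ _ _ _ _ (@marr n) (@arr0 n)).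
have le : (rate n * h <= (rate n + rate n.+1) * h)%R.
  by rewrite mulrDl lerDl mulr_ge0// ltW.
by move=> B mB; exact: le_above.
Qed.

(** The first argument of the minimum makes the errors summable against pi n *
    alpha n; the second tends to 0 with h. *)
Definition error n : R :=
  Num.min 2%:R ((1 - damping n h * expR (- (alpha n * h))) +
    (1 - damping n h * expR (- (alpha n * h)) *
       (fine (mu [set 0%R]) + fine (tail mu (rate n.+1 * h)))) +
    (n%:R * ((rate n + rate n.+1) * h) *+ 2) *+ 2)%R.

Let decay_ge0 n : (0 <= damping n h * expR (- (alpha n * h)))%R.
Proof. by rewrite mulr_ge0 ?expR_ge0. Qed.

Let decay_le1 n : (damping n h * expR (- (alpha n * h)) <= 1)%R.
Proof.
by rewrite mulr_ile1 ?expR_ge0// -expR0 ler_expR oppr_le0 mulr_ge0// addr_ge0.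
Qed.

Let slack_ge0 n : (0 <= n%:R * ((rate n + rate n.+1) * h) *+ 2)%R.
Proof. by rewrite mulrn_wge0// mulr_ge0// mulr_ge0// addr_ge0. Qed.

Let atom_tail_le1 n :
  (fine (mu [set 0%R]) + fine (tail mu (rate n.+1 * h)) <= 1)%R.
Proof.
rewrite -lee_fin EFinD !fineK ?fin_num_measure//.
rewrite /tail -measureU//.
  by apply: probability_le1; exact: measurableU.
apply/seteqP; split => w //= [->]; rewrite in_itv/= andbT.
by rewrite ltNge rh0.
Qed.

(** What a newcomer brings to n.+1 individuals, and what an arrival takes away
    from n individuals, are made up for, up to the error, by the scenarios
    of an arrival to n and of a departure from n.+1 individuals. The balance
    equation makes the weights agree. *)
Lemma flux_balance n :
  pi [set n.+1] * lost n.+1 + pi [set n] * ((alpha n * h)%:E * pint mubar n g) <=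
  pi [set n] * joined n + pi [set n.+1] * departed n.+1 +
  (h * (p n * alpha n) * error n)%:E.
Proof.
have G0 : 0 <= pint mubar n g by apply: pint_ge0 => x; exact: reach_ge0'.
have G1 : pint mubar n g <= 1.
  by apply: pint_le1 => //; rewrite probability_le1.
have I0 := mean_arrivals_ge0 alpha beta mu mubar A n k h t.
have I1 := @mean_arrivals_le _ alpha beta mu mubar beta_gt0 A mA n k h t h0.
have HJ := @arrivals_bound _ alpha beta mu mubar alpha_ge0 beta_ge0 beta_gt0 mu_supp mu_mean
   mubar_residual A mA n k h t h0 ht.
have HD := @departures_bound _ alpha beta mu mubar alpha_ge0 beta_ge0 beta_gt0 mu_supp mu_mean
   mubar_residual A mA n k h t h0 ht.
set I := mean_arrivals _ _ _ _ _ _ _ _ _ in I0 I1 HJ.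
set D := \int[below _]_w _ in HD.
have D0 : 0 <= D.
  by apply: integral_ge0 => w _; apply: pint_ge0 => x; exact: reach_ge0'.
have fin (x : \bar R) (c : R) : 0 <= x -> x <= c%:E -> exists2 r : R, x = r%:E & (0 <= r)%R.
  move=> x0 xc; exists (fine x); last by rewrite fine_ge0.
  by rewrite fineK// ge0_fin_numE// (le_lt_trans xc)// ltry.
have D1 : D <= 1.
  apply: le_trans (departed_le1 n.+1); rewrite -[leLHS]mul1e.
  by rewrite lee_wpmul2r// lee_fin ler1n.
change (pi [set n.+1] * (n.+1%:R%:E * I) + pi [set n] * ((alpha n * h)%:E * pint mubar n g) <=
  pi [set n] * joined n + pi [set n.+1] * (n.+1%:R%:E * D) +
  (h * (p n * alpha n) * error n)%:E).
have tE : tail mu (rate n.+1 * h) = (fine (tail mu (rate n.+1 * h)))%:E.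
  by rewrite fineK// fin_num_measure.
have cE : mu [set 0%R] = (fine (mu [set 0%R]))%:E.
  by rewrite fineK// fin_num_measure.
have c_tail := atom_tail_le1 n.
have bal := balance_p n.
have [i iE i0] := fin _ _ I0 I1.
have [gm gE gm0] := fin _ _ G0 G1.
have [d dE d0] := fin _ _ D0 D1.
have jE : joined n = (fine (joined n))%:E by rewrite fineK.
have jge0 : (0 <= fine (joined n))%R by rewrite fine_ge0// joined_ge0.
have HJ' := joined_ge n.
have {}HJ := le_trans HJ (leeD HJ' (lexx _)).
rewrite iE gE dE !pE jE -!EFinM -!EFinD lee_fin.
move: HJ HD; rewrite iE gE dE jE cE tE -!EFinM -!EFinD !lee_fin => HJ HD.
have dm1 : (damping n h <= 1)%R.
  by rewrite -expR0 ler_expR oppr_le0 mulr_ge0// addr_ge0.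
have C'C : (damping n h * expR (- (alpha n * h)) <= damping n h)%R.
  by rewrite ler_piMr ?expR_ge0// -expR0 ler_expR oppr_le0 mulr_ge0.
apply: (balance_arith (b := rate n.+1) (C := damping n h)) => //.
- by move: I1; rewrite iE lee_fin.
- by move: G1; rewrite gE lee_fin.
- by apply: fine_ge0; exact: tail_ge0.
- exact: fine_ge0.
- by rewrite mulr_ile1 ?decay_ge0 ?decay_le1// addr_ge0 ?fine_ge0 ?tail_ge0.
Qed.

Lemma error_ge0 n : (0 <= error n)%R.
Proof.
have ? := decay_ge0 n; have ? := decay_le1 n; have ? := atom_tail_le1 n.
rewrite /error le_min ler0n/=.
apply: addr_ge0; last by rewrite mulrn_wge0// slack_ge0.
apply: addr_ge0; rewrite subr_ge0//.
by rewrite mulr_ile1// addr_ge0 ?fine_ge0 ?tail_ge0.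
Qed.

(** A part 1 - expR (- (alpha n * h)) <= alpha n * h of the mean at n
    individuals is not preserved by kept, because an arrival may occur, and
    lost is missing as well; flux_balance makes up for both. *)
Lemma one_step :
  \sum_(0 <= n <oo) pi [set n] * pint mubar n g <=
  \sum_(0 <= n <oo) pi [set n] * pint mubar n V +
  \sum_(0 <= n <oo) (h * (p n * alpha n) * error n)%:E.
Proof.
have G0 n : 0 <= pint mubar n g by apply: pint_ge0 => x; exact: reach_ge0'.
have pi0 n : 0 <= pi [set n] by exact: measure_ge0.
have E0 n : 0 <= (expR (- (alpha n * h)))%:E by rewrite lee_fin expR_ge0.
have E1 n : (expR (- (alpha n * h)) <= 1)%R.
  by rewrite -expR0 ler_expR oppr_le0 mulr_ge0.
have ah0 n : 0 <= (alpha n * h)%:E by rewrite lee_fin mulr_ge0.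
pose K n := pi [set n] * ((expR (- (alpha n * h)))%:E * kept n).
apply: (@series_balance _ _ K
  (fun n => pi [set n] * joined n) (fun n => pi [set n] * departed n)
  (fun n => pi [set n] * lost n)
  (fun n => pi [set n] * ((alpha n * h)%:E * pint mubar n g))) => //.
- by move=> n; rewrite mule_ge0.
- by move=> n; rewrite mule_ge0// mule_ge0// kept_ge0.
- by move=> n; rewrite mule_ge0// joined_ge0.
- by move=> n; rewrite mule_ge0// departed_ge0.
- by move=> n; rewrite mule_ge0// lost_ge0.
- by move=> n; rewrite mule_ge0// mule_ge0.
- by move=> n; rewrite lee_fin !mulr_ge0// error_ge0.
- move=> n; have ag0 : 0 <= (alpha n * h)%:E * pint mubar n g by rewrite mule_ge0.
  have l0 := lost_ge0 n; have k0 := kept_ge0 n.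
  have ek0 : 0 <= (expR (- (alpha n * h)))%:E * kept n by rewrite mule_ge0.
  have lg0 : 0 <= lost n + (alpha n * h)%:E * pint mubar n g by rewrite adde_ge0.
  rewrite -(ge0_muleDr _ l0 ag0) -(ge0_muleDr _ ek0 lg0) lee_wpmul2l//.
  rewrite -[leLHS]mul1e -[1%E]/(1%R%:E).
  rewrite -(subrK (expR (- (alpha n * h))) 1%R) addrC EFinD.
  have d0 : 0 <= (1 - expR (- (alpha n * h)))%:E by rewrite lee_fin subr_ge0.
  rewrite (ge0_muleDl _ (E0 n) d0) addeA; apply: leeD; last first.
    rewrite lee_wpmul2r// lee_fin lerBlDr -lerBlDl.
    exact: expR_ge1Dx.
  apply: (@le_trans _ _ ((expR (- (alpha n * h)))%:E * (kept n + lost n))).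
    by rewrite lee_wpmul2l// before_le.
  rewrite (ge0_muleDr _ k0 l0) leeD2l//.
  apply: (@le_trans _ _ (1 * lost n)); last by rewrite mul1e.
  by apply: lee_wpmul2r; rewrite ?lee_fin.
- move=> n; have l0 := lost_ge0 n; have k0 := kept_ge0 n.
  have j0 := joined_ge0 n; have d0 := departed_ge0 n.
  have ek0 : 0 <= (expR (- (alpha n * h)))%:E * kept n by rewrite mule_ge0.
  have ekj0 : 0 <= (expR (- (alpha n * h)))%:E * kept n + joined n by rewrite adde_ge0.
  rewrite -(ge0_muleDr _ ek0 j0) -(ge0_muleDr _ ekj0 d0).
  by apply: lee_wpmul2l; [exact: pi0|exact: after_ge].
- by move=> n; exact: flux_balance.
- by rewrite /lost mul0e mule0.
Qed.

End fixed.

End one_step_sum.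

(** * The error made in a short step *)

Section vanishing_error.
Variables (R : realType) (alpha beta : nat -> R) (mu : probability R R)
  (pi : probability nat R).
Hypothesis alpha_ge0 : forall n, 0 <= alpha n.
Hypothesis beta_ge0 : forall n, 0 <= beta n.
Hypothesis beta_gt0 : forall n, 0 < beta n <-> (0 < n)%N.
Hypothesis mu_supp : mu `]-oo, 0[%classic = 0%E.
Hypothesis summable : (\sum_(0 <= n <oo) pi [set n] * (alpha n)%:E < +oo)%E.

Lemma cvg_linear (a : R) : (a * h) @[h --> (0 : R)] --> (0 : R).
Proof.
rewrite -[X in _ --> X](mulr0 a).
by apply: cvgMr; exact: cvg_id.
Qed.

Lemma cvg_linear_right (a : R) : (a * h) @[h --> 0^'+] --> (0 : R).
Proof. by apply: cvg_within_filter; exact: cvg_linear. Qed.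

Lemma cvg_linear_at_right (a : R) : 0 < a -> (a * h) @[h --> 0^'+] --> 0^'+.
Proof.
move=> a0 S S0; have {}S0 : nbhs (0 : R) [set u | 0 < u -> S u] by exact: S0.
change (nbhs (0 : R) [set h | 0 < h -> S (a * h)]).
have H : nbhs (0 : R) [set h | 0 < a * h -> S (a * h)] by exact: (cvg_linear a S0).
by apply: filterS H => h /= aS h0; apply: aS; rewrite mulr_gt0.
Qed.

Lemma cvg_expR_linear (a : R) : expR (- (a * h)) @[h --> 0^'+] --> (1 : R).
Proof.
rewrite -[X in _ --> X]expR0 -[X in expR X]oppr0.
apply: (cvg_comp _ expR (cvgN (@cvg_linear_right a))).
exact: continuous_expR.
Qed.

(** Right-continuity of distribution functions, read off the positive part since
    only x >= 0 matters. *)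
Lemma cvg_tail : tail mu x @[x --> 0^'+] --> tail mu 0.
Proof.
have := @ccdf_right_continuous _ _ _ mu [the {RV mu >-> R} of @pospart R] 0.
have E x : 0 <= x -> ccdf (P := mu) (@pospart R) x = tail mu x.
  move=> x0; rewrite /ccdf /tail /distribution/= /pushforward.
  congr (mu _); apply/seteqP; split => w /=; rewrite !in_itv/= !andbT /pospart lt_max.
    by rewrite (le_gtF x0) orbF.
  by move=> ->.
rewrite E//; apply: cvg_trans; apply: near_eq_cvg.
by near=> x; rewrite E//.
Unshelve. all: end_near. Qed.


Lemma atom_tail0 : fine (mu [set 0]) + fine (tail mu 0) = 1.
Proof.
apply: EFin_inj; rewrite EFinD !fineK ?fin_num_measure// tailE.
rewrite (_ : `]-oo, 0%R]%classic = `]-oo, 0%R[%classic `|` [set 0]); last first.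
  apply/seteqP; split => w /=; rewrite !in_itv/= le_eqVlt.
    by move=> /orP[/eqP ->|]; [right|left].
  by move=> [->|->]; rewrite ?orbT// eqxx.
rewrite measureU//; last first.
  by apply/seteqP; split => w //= [+ e]; rewrite e in_itv/= ltxx.
have -> : (mu `]-oo, 0%R[%classic + mu [set 0%R] = mu [set 0%R])%E.
  by rewrite -[RHS]add0e; congr (_ + _)%E; exact: mu_supp.
by rewrite addeCA subee ?adde0// fin_num_measure.
Qed.

(** The probabilities that clocks remain silent tend to 1, the slack to 0, and
    the workloads that are null or larger than a vanishing service exhaust
    mu. *)
Lemma error_small n (d : R) : 0 < d ->
  \forall h \near 0^'+, error alpha beta mu h n <= d.
Proof.
move=> d0; have r1 := rate_gt0 beta_gt0 n.
have cd : damping alpha n h * expR (- (alpha n * h)) @[h --> 0^'+] --> (1 : R).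
  by rewrite -[X in _ --> X](mulr1 1); apply: cvgM; exact: cvg_expR_linear.
have ct : fine (mu [set 0]) + fine (tail mu (rate beta n.+1 * h)) @[h --> 0^'+]
    --> (1 : R).
  rewrite -atom_tail0; apply: cvgD; first exact: cvg_cst.
  apply: fine_cvg; rewrite fineK ?fin_num_measure//.
  exact: (cvg_comp _ _ (cvg_linear_at_right r1) cvg_tail).
have cs : (n%:R * ((rate beta n + rate beta n.+1) * h) *+ 2) @[h --> 0^'+] --> (0 : R).
  have := @cvg_linear_right (n%:R * (rate beta n + rate beta n.+1) *+ 2).
  by under eq_cvg do rewrite mulrnAl -mulrA.
have : (1 - damping alpha n h * expR (- (alpha n * h)) +
    (1 - damping alpha n h * expR (- (alpha n * h)) *
       (fine (mu [set 0%R]) + fine (tail mu (rate beta n.+1 * h)))) +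
    (n%:R * ((rate beta n + rate beta n.+1) * h) *+ 2) *+ 2)%R @[h --> 0^'+] --> (0 : R).
  rewrite -[X in _ --> X](_ : (1 - 1) + (1 - 1 * 1) + (0 + 0) = 0 :> R); last by ring.
  apply: cvgD.
    apply: cvgD; apply: cvgB; try exact: cvg_cst; first exact: cd.
    exact: cvgM.
  by apply: cvgD.
move=> /cvgr_le /(_ _ d0); apply: filterS => h.
by apply: le_trans; rewrite /error ge_min lexx orbT.
Qed.

(** Dominated convergence for series, with dominating terms 2 c n. *)
Lemma vanishing_series (c : nat -> R) (err : R -> nat -> R) (d : R) :
  (forall n, 0 <= c n) -> (\sum_(0 <= n <oo) (c n)%:E < +oo)%E ->
  (forall h n, 0 < h -> 0 <= err h n <= 2) ->
  (forall n (d : R), 0 < d -> \forall h \near 0^'+, err h n <= d) ->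
  0 < d -> \forall h \near 0^'+, (\sum_(0 <= n <oo) (c n * err h n)%:E <= d%:E)%E.
Proof.
move=> c0 csum err02 err_small d0.
have tl := nneseries_tail_cvg csum (fun k _ => c0 k).
have d4 : (0 < (d / 4)%:E)%E by rewrite lte_fin divr_gt0.
have [N _ HN] : \forall N \near \oo, (\sum_(N <= n <oo) (c n)%:E < (d / 4)%:E)%E.
  exact: (tl [set y : \bar R | (y < (d / 4)%:E)%E] (open_ereal_lt' d4)).
have {}HN := HN N (leqnn N).
pose M := \sum_(i < N) c i + 1.
have M0 : 0 < M by rewrite ltr_wpDl// sumr_ge0.
have near_small : \forall h \near 0^'+, forall i : 'I_N, err h i <= d / (2 * M).
  by apply: filter_forall => i; apply: err_small; rewrite divr_gt0// mulr_gt0.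
near=> h.
have h0 : 0 < h by near: h; exact: nbhs_right_gt.
have small : forall i : 'I_N, err h i <= d / (2 * M) by near: h.
have ce0 n : (0 <= (c n * err h n)%:E)%E.
  by rewrite lee_fin mulr_ge0//; have /andP[] := err02 h n h0.
rewrite (nneseries_split 0 N)// add0n.
have -> : d = d / 2 + 2 * (d / 4) by field.
rewrite EFinD; apply: leeD.
  rewrite big_mkord sumEFin lee_fin.
  apply: (@le_trans _ _ (\sum_(i < N) c i * (d / (2 * M)))).
    by apply: ler_sum => i _; rewrite ler_wpM2l.
  rewrite -mulr_suml; apply: (@le_trans _ _ (M * (d / (2 * M)))).
    by rewrite ler_wpM2r ?lerDl// ltW// divr_gt0// mulr_gt0.
  by rewrite le_eqVlt; apply/orP; left; apply/eqP; field; rewrite gt_eqF.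
apply: (@le_trans _ _ (2%:E * \sum_(N <= n <oo) (c n)%:E)%E).
  rewrite -(@nneseriesZl _ (fun n => (c n)%:E) xpredT 2 N); last first.
    by move=> n _; rewrite lee_fin.
  apply: lee_nneseries => // n _.
  rewrite -EFinM lee_fin mulrC ler_wpM2r//.
  by have /andP[] := err02 h n h0.
by rewrite EFinM lee_wpmul2l// ltW.
Unshelve. all: end_near. Qed.

Lemma error_sum_small (d : R) : 0 < d -> \forall h \near 0^'+,
  (\sum_(0 <= n <oo) (h * (fine (pi [set n]) * alpha n) * error alpha beta mu h n)%:E
    <= (h * d)%:E)%E.
Proof.
move=> d0; pose c n := fine (pi [set n]) * alpha n.
have c0 n : 0 <= c n by rewrite mulr_ge0// fine_ge0.
have csum : (\sum_(0 <= n <oo) (c n)%:E < +oo)%E.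
  rewrite (eq_eseriesr (g := fun n => (pi [set n] * (alpha n)%:E)%E))// => n _.
  by rewrite EFinM fineK// fin_num_measure.
have small := vanishing_series c0 csum _ error_small d0.
near=> h; have h0 : 0 < h by near: h; exact: nbhs_right_gt.
under eq_eseriesr do rewrite -mulrA EFinM.
rewrite nneseriesZl; last first.
  move=> n _; rewrite lee_fin; apply: mulr_ge0; first exact: c0.
  exact: error_ge0 (ltW h0) _.
rewrite EFinM lee_wpmul2l ?lee_fin ?(ltW h0)//.
near: h; apply: small => h n h0.
rewrite (error_ge0 mu alpha_ge0 beta_ge0 (ltW h0) n)/=.
by rewrite /error ge_min lexx.
Unshelve. all: end_near. Qed.

End vanishing_error.

(** * From time 0 to time t *)

Section flow.
Variables (R : realType) (alpha beta : nat -> R) (mu mubar : probability R R)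
  (pi : probability nat R).
Hypothesis alpha_ge0 : forall n, 0 <= alpha n.
Hypothesis beta_ge0 : forall n, 0 <= beta n.
Hypothesis beta_gt0 : forall n, 0 < beta n <-> (0 < n)%N.
Hypothesis mu_supp : mu `]-oo, 0[%classic = 0%E.
Hypothesis mu_mean : (\int[mu]_x x%:E = 1)%E.
Hypothesis mubar_residual : is_residual_law mu mubar.
Hypothesis balance : forall n, (pi [set n.+1] * (beta n.+1)%:E
                          = pi [set n] * (alpha n)%:E)%E.
Hypothesis summable : (\sum_(0 <= n <oo) pi [set n] * (alpha n)%:E < +oo)%E.
Variables (A : set (config R)) (mA : measurable A).
Local Open Scope ereal_scope.

Local Notation reach := (reach alpha beta mu A).

Lemma integral_mixture_law (f : config R -> \bar R) :
  measurable_fun setT f -> (forall x, 0 <= f x) ->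
  \int[mixture_law mubar pi]_x f x =
  \sum_(0 <= n <oo) pi [set n] * pint mubar n f.
Proof.
move=> mf f0; pose c n : {nonneg R} := NngNum (fine_ge0 (measure_ge0 pi [set n])).
have cE n : (c n)%:num%:E = pi [set n] by rewrite /= fineK// fin_num_measure.
transitivity (\int[mseries (fun n => mscale (c n) (config_law mubar n)) 0]_x f x).
  apply: eq_measure_integral => B mB _; rewrite /mixture_law.
  apply: eq_eseriesr => n _.
  by rewrite -[RHS]/((c n)%:num%:E * _) cE.
rewrite ge0_integral_measure_series//; apply: eq_eseriesr => n _.
by rewrite ge0_integral_mscale// cE integral_config_law.
Qed.

Definition mean_reach k t := \int[mixture_law mubar pi]_x reach k t x.

Let mean_reachE k t :
  mean_reach k t = \sum_(0 <= n <oo) pi [set n] * pint mubar n (reach k t).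
Proof.
apply: integral_mixture_law; first exact: measurable_reach_x.
by move=> x; exact: reach_ge0.
Qed.

(** The law mubar does not charge 0, so almost all configurations have no
    departure due at time 0. *)
Lemma mixture_le_reach1 : mixture_law mubar pi A <= mean_reach 1 0.
Proof.
have mI : measurable_fun setT (fun x : config R => (\1_A x)%:E : \bar R).
  by apply/measurable_EFinP; exact: measurable_indic.
rewrite mean_reachE -[A in leLHS]setIT -integral_indic// integral_mixture_law//.
apply: lee_nneseries => [n _ _|n _].
  by rewrite mule_ge0// pint_ge0.
apply: lee_wpmul2l => //.
apply: (@le_pint_on _ _ `]0%R, +oo[%classic) => //.
- by rewrite setCitvr; exact: (mubar_le0 mu_supp mu_mean mubar_residual).
- exact: measurable_reach_x.
- by move=> x; exact: reach_ge0.
- move=> x _ x0; apply: reach1_ge => // u /x0 /=.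
  by rewrite in_itv/= andbT.
Qed.

Lemma iterate_one_step (h d : R) m : (0 <= h)%R ->
  \sum_(0 <= n <oo) (h * (fine (pi [set n]) * alpha n) * error alpha beta mu h n)%:E
    <= (h * d)%:E ->
  mixture_law mubar pi A <=
  mean_reach (1 + m.*2) (m%:R * h)%R + (m%:R * (h * d))%:E.
Proof.
move=> h0 err; elim: m => [|m ih].
  by rewrite !mul0r adde0; exact: mixture_le_reach1.
apply: (le_trans ih).
have sucE (u : R) : (m.+1%:R * u = m%:R * u + u)%R by rewrite -natr1 mulrDl mul1r.
have shift (M M' : \bar R) (c b : R) :
    M <= M' + b%:E -> M + c%:E <= M' + (c + b)%:E.
  by move=> MM'; rewrite (addrC c) EFinD addeA leeD2r.
rewrite (sucE h) (sucE (h * d)%R); apply: shift.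
have ht : (h <= m%:R * h + h)%R by rewrite lerDr mulr_ge0.
have := @one_step _ alpha beta mu mubar pi alpha_ge0 beta_ge0 beta_gt0 mu_supp
  mu_mean mubar_residual balance A mA (1 + m.*2) h _ h0 ht.
rewrite addrK !mean_reachE doubleS !addnS => /le_trans; apply.
exact: leeD.
Qed.

(** Divides [0, t] into m short steps: each allows two more events and costs
    t / m * (d / t), which adds up to d. *)
Lemma mixture_le_reach (t d : R) : (0 <= t)%R -> (0 < d)%R ->
  exists k, mixture_law mubar pi A <= mean_reach k t + d%:E.
Proof.
rewrite le_eqVlt => /predU1P[<-|t0] d0.
  by exists 1%N; rewrite (le_trans mixture_le_reach1)// leeDl// lee_fin ltW.
have dt0 : (0 < d / t)%R by rewrite divr_gt0.
have [e /= e0 He] := error_sum_small alpha_ge0 beta_ge0 beta_gt0 mu_supp summable dt0.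
pose m := (Num.truncn (t / e)).+1.
have m0 : (0 < m%:R :> R)%R by rewrite ltr0n.
have te : (t / e < m%:R)%R by exact: truncnS_gt.
exists (1 + m.*2)%N.
have h0 : (0 < t / m%:R)%R by rewrite divr_gt0.
have := @iterate_one_step (t / m%:R) (d / t) m (ltW h0).
have -> : (m%:R * (t / m%:R) = t)%R by field; rewrite gt_eqF.
have -> : (m%:R * (t / m%:R * (d / t)) = d)%R by field; rewrite !gt_eqF.
apply; apply: He => //=.
rewrite sub0r normrN gtr0_norm//.
by rewrite ltr_pdivrMr// mulrC -ltr_pdivrMr.
Qed.

End flow.

(** * Independence at the event times *)

Section product_uniqueness.
Variables (R : realType).
Local Open Scope ereal_scope.

(** Rectangles determine a measure on a product also when it is only
    proportional to a product of probabilities; the constant c will be the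
    probability of an event of the future. *)
Lemma scaled_product_unique d1 d2 (T1 : measurableType d1) (T2 : measurableType d2)
    (m1 : probability T1 R) (m2 : probability T2 R) (c : {nonneg R})
    (m' : {measure set (T1 * T2) -> \bar R}) :
  (forall A B, measurable A -> measurable B ->
     m' (A `*` B) = c%:num%:E * (m1 A * m2 B)) ->
  forall S, measurable S -> m' S = c%:num%:E * (m1 \x m2) S.
Proof.
move=> m'E S mS.
pose m1c : {sigma_finite_measure set T1 -> \bar R} := mscale c m1.
have E1 : (m1c \x m2) S = m' S.
  by apply: product_measure_unique => // A B mA mB; rewrite m'E// muleA.
rewrite -E1; apply: (product_measure_unique (m' := mscale c (m1 \x m2))) => // A B mA mB.
change (c%:num%:E * (m1 \x m2) (A `*` B) = c%:num%:E * m1 A * m2 B).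
by rewrite product_measure1E// muleA.
Qed.

End product_uniqueness.

Section events.
Variables (R : realType) (alpha beta : nat -> R) (mu : probability R R).
Hypothesis alpha_ge0 : forall n, (0 <= alpha n)%R.
Hypothesis beta_ge0 : forall n, (0 <= beta n)%R.
Variables (d : measure_display) (Om : measurableType d) (P : probability Om R)
  (nu : probability (config R) R)
  (X0 : {RV P >-> config R}) (xi W : nat -> {RV P >-> R}).
Hypothesis drv : driving mu nu X0 xi W.
Local Open Scope ereal_scope.

Definition event_at j om : \bar R * config R :=
  event alpha beta (X0 om) (xi ^~ om) (W ^~ om) j.

Definition step (p : (\bar R * config R) * (R * R)) : \bar R * config R :=
  (p.1.1 + holding alpha beta p.2.1 p.1.2, jump alpha beta p.2.1 p.2.2 p.1.2).

Lemma event_atS j om : event_at j.+1 om = step (event_at j om, (xi j om, W j om)).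
Proof. by rewrite /event_at /step /=; case: event. Qed.

Lemma measurable_step : measurable_fun setT step.
Proof.
have m12 : measurable_fun setT (fun p : (\bar R * config R) * (R * R) => p.1.2).
  exact: (measurableT_comp measurable_snd measurable_fst).
have m21 : measurable_fun setT (fun p : (\bar R * config R) * (R * R) => p.2.1).
  exact: (measurableT_comp measurable_fst measurable_snd).
have m22 : measurable_fun setT (fun p : (\bar R * config R) * (R * R) => p.2.2).
  exact: (measurableT_comp measurable_snd measurable_snd).
apply: measurable_fun_pair; last exact: measurable_jump.
apply: emeasurable_funD; last exact: measurable_holding.
exact: (measurableT_comp measurable_fst measurable_fst).
Qed.

Lemma measurable_event_at j : measurable_fun setT (event_at j).
Proof.
elim: j => [|j ih].
  by apply: measurable_fun_pair => //; exact: measurable_cst.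
rewrite (_ : event_at j.+1 = fun om => step (event_at j om, (xi j om, W j om))).
  apply: (measurableT_comp measurable_step).
  by apply: measurable_fun_pair => //; exact: measurable_fun_pair.
by apply/funext => om; rewrite event_atS.
Qed.

HB.instance Definition _ j :=
  isMeasurableFun.Build _ _ _ _ (event_at j) (measurable_event_at j).

Let lam : probability (R * R)%type R := @expo R \x mu.

Let drive j om : R * R := (xi j om, W j om).

Let mdrive j : measurable_fun setT (drive j).
Proof. exact: measurable_fun_pair. Qed.

Definition future j k (B C : nat -> set R) : set Om :=
  \bigcap_(i < k) (xi (j + i)%N @^-1` B i `&` W (j + i)%N @^-1` C i).

Let weight k (B C : nat -> set R) : \bar R :=
  \prod_(i < k) (@expo R (B i) * mu (C i)).

Let measurable_future j k B C : (forall i, measurable (B i)) ->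
  (forall i, measurable (C i)) -> measurable (future j k B C).
Proof.
move=> mB mC; apply: bigcap_measurableType => i _.
by apply: measurableI; rewrite -[X in measurable X]setTI; exact: measurable_funP.
Qed.

Let weight_fin k B C : (forall i, measurable (B i)) ->
  (forall i, measurable (C i)) -> weight k B C \is a fin_num.
Proof.
move=> mB mC; rewrite /weight; elim/big_ind: _ => // [x y|i _]; first exact: fin_numM.
by rewrite fin_numM// fin_num_measure.
Qed.

Let weight_ge0 k B C : 0 <= weight k B C.
Proof.
by rewrite /weight; elim/big_ind: _ => // [x y|i _]; [exact: mule_ge0|rewrite mule_ge0].
Qed.

Let future0 j B C : future j 0 B C = setT.
Proof. by apply/seteqP; split. Qed.

Let scons (T : Type) (b : T) (B : nat -> T) i := if i is i'.+1 then B i' else b.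

Let futureS j k b c B C : future j k.+1 (scons b B) (scons c C) =
  (xi j @^-1` b `&` W j @^-1` c) `&` future j.+1 k B C.
Proof.
apply/seteqP; split => om.
  move=> H; split; first by have := H 0%N (ltn0Sn k); rewrite addn0.
  by move=> i ik; have := H i.+1 ik; rewrite addnS.
by move=> [h H] [|i] /= ik; [rewrite addn0|rewrite addnS; exact: H].
Qed.

(** The state at the j-th event is independent of the variables that drive the
    later events. The future ranges over rectangles since this is how the
    independence of the driving variables is given. *)
Let independent j := forall k (D : set (\bar R * config R)) (B C : nat -> set R),
  measurable D -> (forall i, measurable (B i)) -> (forall i, measurable (C i)) ->
  P (event_at j @^-1` D `&` future j k B C) =
  P (event_at j @^-1` D) * weight k B C.

Let mpair j : measurable_fun setT (fun om => (event_at j om, drive j om)).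
Proof. exact: measurable_fun_pair. Qed.

(** Rectangles are extended to measurable sets twice: in the pair (xi j, W j)
    for a fixed event D of the past, then in the past and this pair. *)
Let independent_product j : independent j ->
  forall k S B C, measurable S -> (forall i, measurable (B i)) ->
  (forall i, measurable (C i)) ->
  P ((fun om => (event_at j om, drive j om)) @^-1` S `&` future j.+1 k B C) =
  weight k B C * (distribution P (event_at j) \x lam) S.
Proof.
move=> ind k S B C mS mB mC.
have mG := measurable_future j.+1 k mB mC.
pose c : {nonneg R} := NngNum (fine_ge0 (weight_ge0 k B C)).
have cE : c%:num%:E = weight k B C by rewrite /= fineK// weight_fin.
pose m' : {measure set _ -> \bar R} :=
  measure_function_pushforward__canonical__measure_function_Measure (mrestr P mG) (mpair j).
rewrite -cE.
apply: (@scaled_product_unique _ _ _ _ _ (distribution P (event_at j))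
  lam c m') => // D S2 mD mS2.
have mDe : measurable (event_at j @^-1` D).
  by rewrite -[X in measurable X]setTI; exact: measurable_event_at.
have mDG := measurableI _ _ mDe mG.
pose m2 : {measure set _ -> \bar R} :=
  measure_function_pushforward__canonical__measure_function_Measure (mrestr P mDG) (mdrive j).
pose c2 : {nonneg R} :=
  NngNum (mulr_ge0 (fine_ge0 (weight_ge0 k B C))
    (fine_ge0 (measure_ge0 P (event_at j @^-1` D)))).
have c2E : c2%:num%:E = weight k B C * P (event_at j @^-1` D).
  by rewrite /= EFinM !fineK ?weight_fin// fin_num_measure.
have -> : m' (D `*` S2) = m2 S2.
  change (P ((fun om => (event_at j om, drive j om)) @^-1` (D `*` S2) `&` future j.+1 k B C) =
    P (drive j @^-1` S2 `&` (event_at j @^-1` D `&` future j.+1 k B C))).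
  rewrite setIA; congr (P (_ `&` _)).
  by apply/seteqP; split => om /= [].
change (m2 S2 = c%:num%:E * (P (event_at j @^-1` D) * lam S2)).
rewrite cE muleA -c2E.
apply: (@scaled_product_unique _ _ _ _ _ (@expo R) mu c2 m2) => // b b' mb mb'.
have mB' i : measurable (scons b B i) by case: i.
have mC' i : measurable (scons b' C i) by case: i.
have := ind k.+1 D (scons b B) (scons b' C) mD mB' mC'.
rewrite futureS /weight big_ord_recl/= -/(weight k B C) => indE.
rewrite c2E [RHS]muleC [weight k B C * _]muleC [RHS]muleCA -[RHS]indE.
change (P (drive j @^-1` (b `*` b') `&` (event_at j @^-1` D `&` future j.+1 k B C)) =
  P (event_at j @^-1` D `&`
     ((xi j @^-1` b `&` W j @^-1` b') `&` future j.+1 k B C))).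
by rewrite setICA.
Qed.

Let independentS j : independent j -> independent j.+1.
Proof.
move=> ind k D B C mD mB mC.
have mS : measurable (step @^-1` D).
  by rewrite -[X in measurable X]setTI; exact: measurable_step.
have E : event_at j.+1 @^-1` D =
    (fun om => (event_at j om, drive j om)) @^-1` (step @^-1` D).
  by apply/seteqP; split => om /=; rewrite event_atS.
rewrite E (independent_product ind k mS mB mC) muleC; congr (_ * _).
have := independent_product ind 0 mS mB mC.
rewrite /weight big_ord0 mul1e => <-; congr (P _).
by rewrite future0 setIT.
Qed.

Lemma law_X0 A : measurable A -> P (X0 @^-1` A) = nu A.
Proof.
move=> mA; have m0 (i : nat) : measurable (set0 : set R) by [].
have := driving_law drv 0 mA m0 m0.
rewrite big_ord0 mule1 => <-; congr (P _).
by apply/esym/setIidl => om _ i.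
Qed.

Let independent0 : independent 0.
Proof.
move=> k D B C mD mB mC.
have mD0 : measurable [set x : config R | D (0, x)].
  have m0 : measurable_fun setT (fun x : config R => (0 : \bar R, x)).
    by apply: measurable_fun_pair => //; exact: measurable_cst.
  by rewrite -[X in measurable X]setTI; exact: m0.
have -> : event_at 0 @^-1` D = X0 @^-1` [set x | D (0, x)] by [].
rewrite law_X0// /future /weight.
exact: (driving_law drv k mD0 mB mC).
Qed.

Let independentT j : independent j.
Proof. by elim: j => [|j ih]; [exact: independent0|exact: independentS]. Qed.

(** The next event can be computed by integrating fresh driving variables. *)
Lemma event_at_markov j (F : (\bar R * config R) * (R * R) -> \bar R) :
  measurable_fun setT F -> (forall z, 0 <= F z) ->
  \int[P]_om F (event_at j om, (xi j om, W j om)) =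
  \int[P]_om \int[@expo R]_e \int[mu]_w F (event_at j om, (e, w)).
Proof.
move=> mF F0.
pose m' : {measure set _ -> \bar R} :=
  measure_function_pushforward__canonical__measure_function_Measure P (mpair j).
have -> : \int[P]_om F (event_at j om, (xi j om, W j om)) = \int[m']_z F z.
  by rewrite ge0_integral_pushforward.
pose law : probability _ R := distribution P (event_at j).
pose m2 : {measure set _ -> \bar R} := law \x lam.
have lawE S : measurable S -> S `<=` setT -> m' S = m2 S.
  move=> mS _.
  have m0 (i : nat) : measurable (set0 : set R) by [].
  have := independent_product (independentT j) 0 mS m0 m0.
  by rewrite future0 setIT /weight big_ord0 mul1e.
have -> : \int[m']_z F z = \int[m2]_z F z.
  exact: (eq_measure_integral m2 lawE).
rewrite (fubini_tonelli1 (m1 := law) (m2 := lam) _ mF F0) /fubini_F.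
have mG : measurable_fun setT (fun y => \int[lam]_z F (y, z)).
  exact: (measurable_fun_fubini_tonelli_F (m2 := lam) _ mF F0).
rewrite (ge0_integral_distribution (event_at j) mG) => [|y]; last exact: integral_ge0.
apply: eq_integral => om _ /=.
have mFo : measurable_fun setT (fun z => F (event_at j om, z)).
  by apply: (measurableT_comp mF); exact: pair1_measurable.
exact: (fubini_tonelli1 (m1 := @expo R) (m2 := mu) _ mFo (fun z => F0 (_, z))).
Qed.

End events.

(** * The law of the process at a fixed time *)

Section law_at_time.
Variables (R : realType) (alpha beta : nat -> R) (mu : probability R R).
Hypothesis alpha_ge0 : forall n, (0 <= alpha n)%R.
Hypothesis beta_ge0 : forall n, (0 <= beta n)%R.
Hypothesis beta_gt0 : forall n, (0 < beta n)%R <-> (0 < n)%N.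
Variables (d : measure_display) (Om : measurableType d) (P : probability Om R)
  (nu : probability (config R) R)
  (X0 : {RV P >-> config R}) (xi W : nat -> {RV P >-> R}).
Hypothesis drv : driving mu nu X0 xi W.
Variables (A : set (config R)) (mA : measurable A) (t : R).
Local Open Scope ereal_scope.

Local Notation reach := (reach alpha beta mu A).
Local Notation event_at := (event_at alpha beta X0 xi W).
Local Notation step := (step alpha beta).
Local Notation holding := (holding alpha beta).

Lemma event_at_ge0 j om (u : R) : u \in (event_at j om).2 -> (0 <= u)%R.
Proof.
elim: j u => [|j ih] u; first exact: (driving_X0_ge0 drv).
rewrite event_atS /step /= /jump; case: ifP => _.
  by rewrite serveE => /mem_clip/ltW.
rewrite mem_add_mset => /orP[/eqP ->|]; first exact: (driving_W_ge0 drv).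
by rewrite serveE => /mem_clip/ltW.
Qed.

Lemma event_time_le j om : (event_at j om).1 <= (event_at j.+1 om).1.
Proof.
rewrite event_atS /step /= leeDl//; apply: holding_ge0 => //.
  exact: (driving_xi_ge0 drv).
by move=> u; exact: event_at_ge0.
Qed.

Lemma event_time_mono om : {homo (fun j => (event_at j om).1) : i j / (i <= j)%N >-> i <= j}.
Proof.
apply: homo_leq => // [x y z|j]; first exact: le_trans.
exact: event_time_le.
Qed.

Lemma event_time_gtNy j om : -oo < (event_at j om).1.
Proof.
apply: (@lt_le_trans _ _ (event_at 0 om).1); first exact: ltNy0.
exact: event_time_mono.
Qed.

Definition holds j : set Om := [set om |
  (event_at j om).1 <= t%:E < (event_at j.+1 om).1].

Definition occurs j : set Om := [set om | holds j om /\
  A (serve beta (t - fine (event_at j om).1) (event_at j om).2)].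

Lemma measurable_occurs j : measurable (occurs j).
Proof.
have m1 i : measurable_fun setT (fun om => (event_at i om).1).
  exact: (measurableT_comp measurable_fst (measurable_event_at alpha beta X0 xi W i)).
have m2 : measurable_fun setT (fun om => (event_at j om).2).
  exact: (measurableT_comp measurable_snd (measurable_event_at alpha beta X0 xi W j)).
have ms : measurable_fun setT
    (fun om => serve beta (t - fine (event_at j om).1) (event_at j om).2).
  apply: measurable_serve => //; apply: measurable_funB => //.
  exact: (measurableT_comp _ (m1 j)).
pose now om := ((event_at j om).1 <= t%:E < (event_at j.+1 om).1).
have mnow : measurable_fun setT now.
  apply: measurable_and; first by apply: measurable_fun_lee => //; exact: measurable_cst.
  by apply: measurable_fun_lte => //; exact: measurable_cst.
have -> : occurs j = now @^-1` [set true] `&`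
  (fun om => serve beta (t - fine (event_at j om).1) (event_at j om).2) @^-1` A.
  by apply/seteqP; split => om /= [].
apply: measurableI; rewrite -[X in measurable X]setTI; last exact: ms.
exact: mnow.
Qed.

Lemma holds_uniq i j om : holds i om -> holds j om -> i = j.
Proof.
wlog ij : i j / (i <= j)%N => [H hi hj|].
  by have [/H|/ltnW/H] := leqP i j; [exact|move=> /(_ hj hi)].
move=> /andP[_ ti] /andP[tj _]; apply/eqP; rewrite eqn_leq ij/= leqNgt.
apply/negP => ji; have := lt_le_trans ti (event_time_mono om ji).
by rewrite ltNge tj.
Qed.

Lemma trivIset_occurs : trivIset setT occurs.
Proof.
apply/trivIsetP => i j _ _ /eqP ij; apply/seteqP; split => // om [[hi _] [hj _]].
by apply: ij; exact: (@holds_uniq _ _ om).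
Qed.

(** The event times being nondecreasing, t lies between two consecutive ones for
    at most one index, which is then the one that the trajectory selects. *)
Lemma process_occurs :
  process alpha beta X0 xi W t @^-1` (Some @` A) = \bigcup_j occurs j.
Proof.
apply/seteqP; split => om /=.
  rewrite /process /trajectory; case: pselect => [h|_]; last by case.
  move=> [x Ax [xE]]; exists (ex_minn h) => //.
  case: ex_minnP xE => j hj _ xE; split => //.
  by rewrite -xE.
move=> [j _ [hj Aj]]; rewrite /process /trajectory.
case: pselect => [h|]; last by case; exists j.
exists (serve beta (t - fine (event_at j om).1) (event_at j om).2) => //.
congr Some; case: ex_minnP => i hi _.
by rewrite (@holds_uniq _ _ om hj hi).
Qed.

Lemma measurable_process :
  measurable (process alpha beta X0 xi W t @^-1` (Some @` A)).
Proof.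
rewrite process_occurs; apply: bigcupT_measurable => j.
exact: measurable_occurs.
Qed.

(** The value of reach for the time that is left, from an event at time y.1 and
    state y.2. *)
Definition reach_from k (y : \bar R * config R) : \bar R :=
  if y.1 <= t%:E then reach k (t - fine y.1) y.2 else 0.

Definition outcome_from k (p : (\bar R * config R) * (R * R)) : \bar R :=
  if p.1.1 <= t%:E
  then outcome alpha beta A (reach k) (t - fine p.1.1) p.1.2 p.2.1 p.2.2 else 0.

Let measurable_before : measurable_fun setT (fun y : \bar R => y <= t%:E).
Proof. by apply: measurable_fun_lee => //; exact: measurable_cst. Qed.

Lemma measurable_reach_from k : measurable_fun setT (reach_from k).
Proof.
apply: measurable_fun_ifT => //.
  exact: (measurableT_comp measurable_before measurable_fst).
apply: (measurable_reach_comp alpha beta mu mA) => //.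
apply: measurable_funB => //.
exact: (measurableT_comp (@fine_measurable R setT measurableT) measurable_fst).
Qed.

Lemma reach_from_ge0 k y : 0 <= reach_from k y.
Proof. by rewrite /reach_from; case: ifP => // _; exact: reach_ge0. Qed.

Lemma measurable_outcome_from k : measurable_fun setT (outcome_from k).
Proof.
have m11 : measurable_fun setT (fun p : (\bar R * config R) * (R * R) => p.1.1).
  exact: (measurableT_comp measurable_fst measurable_fst).
apply: measurable_fun_ifT => //.
  exact: (measurableT_comp measurable_before m11).
have mo := measurable_outcome alpha beta mA (measurable_reach alpha beta mu mA k).
have mg : measurable_fun setT (fun p : (\bar R * config R) * (R * R) =>
    ((((t - fine p.1.1)%R, p.1.2), p.2.1), p.2.2)).
  apply: measurable_fun_pair; last exact: (measurableT_comp measurable_snd measurable_snd).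
  apply: measurable_fun_pair; last exact: (measurableT_comp measurable_fst measurable_snd).
  apply: measurable_fun_pair; last exact: (measurableT_comp measurable_snd measurable_fst).
  apply: measurable_funB => //.
  exact: (measurableT_comp (@fine_measurable R setT measurableT) m11).
exact: (measurableT_comp mo mg).
Qed.

Lemma outcome_from_ge0 k p : 0 <= outcome_from k p.
Proof.
by rewrite /outcome_from; case: ifP => // _; apply: outcome_ge0; exact: reach_ge0.
Qed.

Lemma reach_fromS k y : reach_from k.+1 y =
  \int[@expo R]_e \int[mu]_w outcome_from k (y, (e, w)).
Proof.
rewrite /reach_from /outcome_from /=; case: ifP => _; first by rewrite reachS.
by rewrite integral0_eq// => e _; rewrite integral0_eq.
Qed.

(** Either t comes before the next event, and the state at time t is that of the
    j-th event after service, or the next event comes first and reach_from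
    goes on from it. *)
Lemma outcome_from_event k j om :
  outcome_from k (event_at j om, (xi j om, W j om)) <=
  (\1_(occurs j) om)%:E + reach_from k (event_at j.+1 om).
Proof.
have r0 := reach_from_ge0 k (event_at j.+1 om).
have i0 : 0 <= (\1_(occurs j) om : R)%:E by rewrite lee_fin.
rewrite /outcome_from /=; case: ifPn => [Tt|_]; last exact: adde_ge0.
have Tfin : (event_at j om).1 \is a fin_num.
  by rewrite fin_numE gt_eqF ?event_time_gtNy//= lt_eqF// (le_lt_trans Tt)// ltry.
have TE := esym (fineK Tfin).
have nextE : (event_at j.+1 om).1 =
    (event_at j om).1 + holding (xi j om) (event_at j om).2.
  by rewrite event_atS.
have lateE : ((t - fine (event_at j om).1)%:E < holding (xi j om) (event_at j om).2)
    = (t%:E < (event_at j.+1 om).1).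
  by rewrite nextE EFinB -TE lteBlDl.
rewrite /outcome lateE; case: ifPn => [tT|].
  apply: (@le_trans _ _ (\1_(occurs j) om : R)%:E); last by rewrite leeDl.
  rewrite lee_fin !indicE; case: (boolP (serve _ _ _ \in A)) => // /set_mem As.
  by rewrite mem_set// /occurs /holds /= Tt tT.
rewrite -leNgt => Tt'; rewrite -[leLHS]add0e; apply: leeD => //.
rewrite /reach_from Tt' [(event_at j.+1 om).2](_ : _ =
  jump alpha beta (xi j om) (W j om) (event_at j om).2); last by rewrite event_atS.
rewrite nextE fineD//; first by rewrite opprD addrA.
have : (event_at j om).1 + holding (xi j om) (event_at j om).2 <= t%:E by rewrite -nextE.
rewrite TE; have := holding_gtNy alpha beta (xi j om) (event_at j om).2.
by case: (holding _ _).
Qed.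

(** Telescoping over the events with event_at_markov and outcome_from_event. *)
Lemma mean_reach_from_le k j :
  \int[P]_om reach_from k (event_at j om) <= \sum_(i < k) P (occurs (j + i)%N).
Proof.
have mE i : measurable_fun setT (event_at i) by exact: measurable_event_at.
elim: k j => [|k ih] j.
  rewrite big_ord0 integral0_eq// => om _.
  by rewrite /reach_from reach0 if_same.
under eq_integral do rewrite reach_fromS.
rewrite -(event_at_markov alpha beta drv j (measurable_outcome_from k)
  (outcome_from_ge0 k)).
rewrite big_ord_recl addn0.
have mo := measurable_occurs j.
have mI : measurable_fun setT (fun om => (\1_(occurs j) om)%:E : \bar R).
  by apply/measurable_EFinP; exact: measurable_indic.
have mR : measurable_fun setT (fun om => reach_from k (event_at j.+1 om)).
  exact: (measurableT_comp (measurable_reach_from k) (mE j.+1)).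
apply: (@le_trans _ _ (\int[P]_om
    ((\1_(occurs j) om)%:E + reach_from k (event_at j.+1 om)))).
  apply: ge0_le_integral => //.
  - by move=> om _; exact: outcome_from_ge0.
  - apply: (measurableT_comp (measurable_outcome_from k)).
    by apply: measurable_fun_pair => //; exact: measurable_fun_pair.
  - exact: emeasurable_funD.
  - by move=> om _; exact: outcome_from_event.
rewrite ge0_integralD//; last by move=> om _; exact: reach_from_ge0.
rewrite integral_indic// setIT; apply: leeD => //.
apply: (le_trans (ih j.+1)); rewrite le_eqVlt; apply/orP; left; apply/eqP.
by apply: eq_bigr => i _; rewrite addSnnS.
Qed.

(** The events occurs i are disjoint parts of the event that the process is in A
    at time t. *)
Lemma mean_reach_le_process k : (0 <= t)%R ->
  \int[nu]_x reach k t x <= P (process alpha beta X0 xi W t @^-1` (Some @` A)).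
Proof.
move=> t0; have mr := measurable_reach_x alpha beta mu mA k t.
have r0 x : 0 <= reach k t x by exact: reach_ge0.
have -> : \int[nu]_x reach k t x = \int[P]_om reach_from k (event_at 0 om).
  transitivity (\int[distribution P X0]_x reach k t x).
    by apply: eq_measure_integral => B mB _; exact: (esym (law_X0 drv mB)).
  rewrite (ge0_integral_distribution X0 mr r0); apply: eq_integral => om _ /=.
  by rewrite /reach_from /= lee_fin t0 subr0.
apply: (le_trans (mean_reach_from_le k 0)).
rewrite process_occurs.
have mU : measurable (\big[setU/set0]_(i < k) occurs i).
  by apply: bigsetU_measurable => i _; exact: measurable_occurs.
have <- : P (\big[setU/set0]_(i < k) occurs i) = \sum_(i < k) P (occurs (0 + i)%N).
  apply: measure_semi_additive_ord_I => // [i _|]; first exact: measurable_occurs.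
  exact: (sub_trivIset _ trivIset_occurs).
apply: le_measure; rewrite ?inE//.
  by apply: bigcupT_measurable => j; exact: measurable_occurs.
exact: bigsetU_bigcup.
Qed.

End law_at_time.

Section law_of_size.
Variables (R : realType).
Local Open Scope ereal_scope.

Lemma config_law_size (m : probability R R) n (B : set nat) :
  config_law m n [set x : config R | B (size x)] = (\1_B n)%:E.
Proof.
have sizeE (s : n.-tuple R) : size (theta s) = n by rewrite size_theta.
rewrite /config_law /distribution /pushforward /= indicE.
have [Bn|Bn] := boolP (n \in B).
  rewrite -[RHS](probability_setT (power_prob m n)); congr (power_prob m n _).
  by apply/seteqP; split => // s _ /=; rewrite sizeE; exact: set_mem.
rewrite -[RHS](measure0 (power_prob m n)); congr (power_prob m n _).
apply/seteqP; split => // s /=; rewrite sizeE => Bs.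
by move: Bn; rewrite mem_set.
Qed.

Lemma mixture_law_size (m : probability R R) (pi : probability nat R) (B : set nat) :
  mixture_law m pi [set x : config R | B (size x)] = pi B.
Proof.
rewrite /mixture_law; under eq_eseriesr do rewrite config_law_size.
rewrite [in RHS](_ : B = \bigcup_(n in B) [set n]); last first.
  by apply/seteqP; split => [n Bn|n [k Bk ->]] //; exists n.
rewrite measure_bigcup//; last first.
  by apply/trivIsetP => i j _ _ /eqP ij; apply/seteqP; split => // x [-> /ij].
rewrite [RHS]eseries_mkcond; apply: eq_eseriesr => n _.
by rewrite indicE; case: (n \in B); rewrite ?mule1 ?mule0.
Qed.

End law_of_size.

(** * Stationarity *)

(** A lower bound for the complementary event is an upper bound for the event. *)
Lemma le_of_complement (R : realType) (p q v : \bar R) :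
  (q \is a fin_num -> v \is a fin_num -> p + q <= 1 -> 1 - v <= q -> p <= v)%E.
Proof.
case: q => [q| |] //; case: v => [v| |] // _ _; case: p => [p| |] //.
  by rewrite -EFinD -EFinB !lee_fin; lra.
by move=> _ _; exact: leNye.
Qed.

Theorem theorem1 (R : realType) (alpha beta : nat -> R)
    (mu mubar : probability R R) (pi : probability nat R)
    (alpha_ge0 : forall n, 0 <= alpha n)
    (beta_ge0 : forall n, 0 <= beta n)
    (beta_gt0 : forall n, 0 < beta n <-> (0 < n)%N)
    (mu_supp : mu `]-oo, 0[%classic = 0%E)
    (mu_mean : (\int[mu]_x x%:E = 1)%E)
    (mubar_residual : is_residual_law mu mubar)
    (balance : forall n, (pi [set n.+1] * (beta n.+1)%:E
                          = pi [set n] * (alpha n)%:E)%E)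
    (summable : (\sum_(0 <= n <oo) pi [set n] * (alpha n)%:E < +oo)%E) :
  stationary alpha beta mu (mixture_law mubar pi) /\
  number_stationary alpha beta mu (mixture_law mubar pi) pi.
Proof.
have law_ge d (Om : measurableType d) (P : probability Om R)
    (X0 : {RV P >-> config R}) (xi W : nat -> {RV P >-> R}) (t : R)
    (A : set (config R)) :
    driving mu (mixture_law mubar pi) X0 xi W -> 0 <= t -> measurable A ->
    (mixture_law mubar pi A <=
     P (process alpha beta X0 xi W t @^-1` (Some @` A)))%E.
  move=> drv t0 mA; apply/lee_addgt0Pr => e e0.
  have [k] := mixture_le_reach alpha_ge0 beta_ge0 beta_gt0 mu_supp mu_mean
    mubar_residual balance summable mA t0 e0.
  move=> /le_trans; apply; rewrite leeD2r//.
  exact: (mean_reach_le_process alpha_ge0 beta_ge0 drv mA k t0).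
have stat : stationary alpha beta mu (mixture_law mubar pi).
  move=> d Om P X0 xi W drv t t0 A mA.
  have mproc B : measurable B ->
      measurable (process alpha beta X0 xi W t @^-1` (Some @` B)).
    by move=> mB; exact: (measurable_process alpha_ge0 beta_ge0 drv mB t).
  split; first exact: mproc.
  have mCA := measurableC mA.
  apply/eqP; rewrite eq_le law_ge// andbT.
  have [mX mXC] := (mproc A mA, mproc _ mCA).
  have disj : process alpha beta X0 xi W t @^-1` (Some @` A) `&`
      process alpha beta X0 xi W t @^-1` (Some @` (~` A)) = set0.
    apply/seteqP; split => // om [[x Ax xE] [y nAy]].
    by rewrite -xE => -[yx]; apply: nAy; rewrite yx.
  have nuC : (mixture_law mubar pi (~` A) = 1 - mixture_law mubar pi A)%E.
    exact: probability_setC.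
  have sum_le1 : (P (process alpha beta X0 xi W t @^-1` (Some @` A)) +
      P (process alpha beta X0 xi W t @^-1` (Some @` (~` A))) <= 1)%E.
    rewrite -measureU//; apply: probability_le1; exact: measurableU.
  apply: le_of_complement sum_le1 _; last first.
    by rewrite -nuC; exact: law_ge.
  - exact: (fin_num_measure (mixture_law mubar pi) _ mA).
  - exact: (fin_num_measure P _ mXC).
split => // d Om P X0 xi W drv t t0 B mB.
have mS : measurable [set x : config R | B (size x)].
  have := @measurable_size_config R; move/(_ measurableT _ mB).
  by rewrite setTI.
have [mP PE] := stat d Om P X0 xi W drv t t0 _ mS.
have -> : Defs.number alpha beta X0 xi W t @^-1` (Some @` B) =
    process alpha beta X0 xi W t @^-1` (Some @` [set x : config R | B (size x)]).
  apply/seteqP; split => om /=; rewrite /Defs.number.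
    case: (process _ _ _ _ _ _ _) => [x|] [n Bn] //= [nx]; exists x => //=.
    by rewrite -nx.
  by move=> [x Bx <-]; exists (size x).
by split; [exact: mP|exact: etrans PE (mixture_law_size _ _ _)].
Qed.
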